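(* The cubic fourfold $\zeta$ given by $x_0x_4x_5+x_1x_2x_3=0$ is semistable with closed orbit. For every $a\in\mathbb{C}$, the cubic fourfold $Y$ of type $\tau$ given by $$x_0(x_3^2-x_4x_5)+x_1^2x_4-(a+1)x_1x_2x_3+ax_2^2x_5=0$$ (in particular the fourfold $\omega$, which is the case $a=1$) is semistable. If $a\ne0$, the orbit of $Y$ is closed. For $a=0$, the closure of the orbit of $Y$ contains the orbit of $\zeta$.
   Context: We work over $\mathbb{C}$. Semistability and orbits are in the GIT sense for $\mathrm{SL}(6)$ acting on $\mathbb{P}(\mathrm{Sym}^3W)$, $W=H^0(\mathbb{P}^5,\mathcal{O}(1))$ the space of linear forms in $x_0,\dots,x_5$; ''closed orbit'' means closed in the semistable locus (equivalently, the orbit of the cubic form is closed in $\mathrm{Sym}^3W$). *)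

(* Defs.v *)
From HB Require Import structures.
From mathcomp Require Import all_boot all_order all_algebra.
From mathcomp Require Import classical_sets reals complex mpoly.

Set Implicit Arguments.
Unset Strict Implicit.
Unset Printing Implicit Defensive.

Import GRing.Theory.

Local Open Scope ring_scope.
Local Open Scope classical_set_scope.

(* Points of P(V) are represented by nonzero vectors of V, and subsets of P(V)
   by their punctured cones, i.e. by scaling-invariant sets of nonzero vectors. *)
Section ProjectiveZariski.
Variables (K : fieldType) (V : vectType K).

Definition polyfun (P : {mpoly K[\dim {:V}]}) (v : V) : K :=
  P.@[fun i => coord (vbasis {:V}) i v].

(* The projective zero locus of a family F of homogeneous polynomials. *)
Definition proj_zeros (F : set {mpoly K[\dim {:V}]}) : set V :=
  [set v | v != 0 /\ forall P, F P -> polyfun P v = 0].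

Definition zariski_closed (Z : set V) : Prop :=
  exists F : set {mpoly K[\dim {:V}]},
    (forall P, F P -> exists d, P \is d.-homog) /\ Z = proj_zeros F.

Definition zariski_closure (S : set V) : set V :=
  [set v | forall Z, zariski_closed Z -> S `<=` Z -> Z v].

(* S is closed for the topology induced on the subset X of P(V). *)
Definition zariski_closed_in (X S : set V) : Prop :=
  exists Z, zariski_closed Z /\ S = X `&` Z.

End ProjectiveZariski.

Section LinearSubstitution.
Variable K : fieldType.

(* The image of the basis (x_0, ..., x_5) of W under A, W being identified with
   K^6 by that basis: A . x_j = \sum_i A i j x_i. *)
Definition lin_image (A : 'M[K]_6) : 6.-tuple {mpoly K[6]} :=
  [tuple \sum_(i < 6) A i j *: 'X_i | j < 6].

Lemma dhomog_lin_image d (A : 'M[K]_6) (f : {mpoly K[6]}) :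
  f \is d.-homog -> f \mPo lin_image A \is d.-homog.
Proof.
move=> /dhomogP hf.
rewrite comp_mpolyE big_seq; apply: rpred_sum => m /hf <-; apply: rpredZ.
rewrite /= mdegE.
apply: (big_ind2 (fun (p : {mpoly K[6]}) e => p \is e.-homog)).
- exact: dhomog1.
- by move=> p1 e1 p2 e2; exact: dhomogM.
move=> i _; rewrite -[X in X.-homog]mul1n; apply: dhomogMn.
rewrite tnth_mktuple; apply: rpred_sum => k _; apply: rpredZ.
by rewrite dhomogX /= mdeg1.
Qed.

End LinearSubstitution.

Section CubicFourfolds.
Variable R : realType.
Local Notation C := R[i].

(* Sym^3 W *)
Definition cubic := dhomog 6 C 3.

Definition sl_act (A : 'M[C]_6) (f : cubic) : cubic :=
  DHomog (dhomog_lin_image A (dhomog_is_dhomog f)).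

Definition sl_invariant (P : {mpoly C[\dim {:cubic}]}) : Prop :=
  forall A : 'M[C]_6, \det A = 1 ->
  forall f : cubic, polyfun P (sl_act A f) = polyfun P f.

(* Mumford's definition: some invariant section of O(d), d > 0, does not vanish
   at [f]; the nonvanishing locus is automatically affine in P(Sym^3 W). *)
Definition semistable (f : cubic) : Prop :=
  f != 0 /\
  exists d (P : {mpoly C[\dim {:cubic}]}),
    [/\ (0 < d)%N, P \is d.-homog, sl_invariant P & polyfun P f != 0].

(* The cone over the SL(6)-orbit of the point [f] of P(Sym^3 W). *)
Definition proj_orbit (f : cubic) : set cubic :=
  [set g | g != 0 /\
     exists (c : C) (A : 'M[C]_6),
       [/\ c != 0, \det A = 1 & g = c *: sl_act A f]].

Definition closed_orbit (f : cubic) : Prop :=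
  zariski_closed_in [set g | semistable g] (proj_orbit f).

Local Notation x k := ('X_(inord k : 'I_6) : {mpoly C[6]}).

Definition zeta_form : {mpoly C[6]} := x 0 * x 4 * x 5 + x 1 * x 2 * x 3.

Definition tau_form (a : C) : {mpoly C[6]} :=
  x 0 * (x 3 ^+ 2 - x 4 * x 5) + x 1 ^+ 2 * x 4
    - (a + 1) *: (x 1 * x 2 * x 3) + a *: (x 2 ^+ 2 * x 5).

Lemma dhomog_x k : x k \is 1.-homog.
Proof. by rewrite dhomogX /= mdeg1. Qed.

Lemma dhomog_xxx i j k : x i * x j * x k \is 3.-homog.
Proof. exact: (dhomogM (dhomogM (dhomog_x i) (dhomog_x j)) (dhomog_x k)). Qed.

Lemma dhomog_zeta : zeta_form \is 3.-homog.
Proof. by apply: rpredD; exact: dhomog_xxx. Qed.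

Lemma dhomog_tau a : tau_form a \is 3.-homog.
Proof.
rewrite /tau_form mulrBr !expr2 !mulrA.
by rewrite ?(rpredD, rpredB, rpredN, rpredZ, dhomog_xxx).
Qed.

Definition zeta : cubic := DHomog dhomog_zeta.

Definition tau (a : C) : cubic := DHomog (dhomog_tau a).

Definition omega : cubic := tau 1.

End CubicFourfolds.

(* Main.v *)
Require Import Defs.
From HB Require Import structures.
From mathcomp Require Import all_boot all_order all_algebra all_fingroup.
From mathcomp Require Import ssrcomplements boolp classical_sets reals complex mpoly.
From mathcomp Require Import zify ring lra.

(** By the Kempf-Ness criterion it suffices to exhibit, in each orbit that has to
    be semistable or closed, a form f at which the moment map of SU(6) vanishes:
    the Gram matrix of the partial derivatives of f for the apolar Hermitian
    product is scalar ([critical]).  For zeta this is immediate, for tau_a with a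
    nonzero it is achieved by rescaling the coordinates, and tau_0 degenerates to
    zeta.

    The criterion itself is proved algebraically.  A point g of the Zariski closure
    of GL f is a specialization of X f, X the generic matrix, hence its limit along
    a place O -> C of the field C(X).  Write X = U D V with U, V invertible over the
    valuation ring O and D diagonal (Cartan); moving a triangular factor to the left
    (Iwasawa) one may assume that V reduces to a unitary matrix k.  If det X is a
    unit, the valuations of the entries of D define weights z of sum 0 for which
    k f only has monomials of weight >= 0; as the moment map also vanishes at k f,
    they all have weight 0.  Hence:
    - g = 0 is impossible.  Therefore f is semistable: if all invariants vanished at
      f, then X f |-> 0, det X |-> 1 would define a specialization, because Cayley's
      Omega process (the apolar pairing with the powers of det X) turns every
      monomial in the coefficients of X f and in det X into an invariant of f.
    - In suitable coordinates g is the sum of a point f2 of the orbit of f, of weight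
      0, and of terms of negative weight.  The rank of the differential of the orbit
      map does not increase from f to g, so the term of g - f2 of highest weight is
      tangent to the orbit at f2 and can be removed by a unipotent transformation;
      finally g is in the orbit of f. *)

Set Implicit Arguments.
Unset Strict Implicit.
Unset Printing Implicit Defensive.

Import Order.TTheory GRing.Theory Num.Theory.

Local Open Scope ring_scope.
Local Open Scope classical_set_scope.

(** * Linear substitutions and the apolar pairing *)

Lemma mnm_neq0P n (m : 'X_{1..n}) : m != 0%MM -> exists i, m i != 0%N.
Proof.
move=> m_neq0; apply/existsP; apply: contraR m_neq0; rewrite negb_exists => /forallP m0.
by apply/eqP/mnmP => i; rewrite mnm0E; apply/eqP; have := m0 i; rewrite negbK.
Qed.

Lemma mnm_subUU n (i : 'I_n) : (U_(i) - U_(i) = 0)%MM.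
Proof. by apply/mnmP => l; rewrite mnmBE mnm0E subnn. Qed.

Section MpolyInduction.
Variables (n : nat) (A : comNzRingType).
Implicit Types (p q : {mpoly A[n]}).

Lemma mpoly_ring_ind (P : {mpoly A[n]} -> Prop) :
  (forall p q, P p -> P q -> P (p + q)) -> (forall c p, P p -> P (c *: p)) ->
  P 1 -> (forall i p, P p -> P ('X_i * p)) -> forall p, P p.
Proof.
move=> PD PZ P1 PX p.
have PM m : P 'X_[m].
  have [k] := ubnP (mdeg m); elim: k m => // k IH m lt_mk.
  have [->|m_neq0] := eqVneq m 0%MM; first by rewrite mpolyX0.
  have [i mi] := mnm_neq0P m_neq0.
  have le_im : (U_(i) <= m)%MM by rewrite lep1mP.
  rewrite -(submK le_im) addmC mpolyXD; apply: PX; apply: IH.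
  rewrite -(submK le_im) mdegD mdeg1 addn1 in lt_mk.
  exact: lt_mk.
rewrite [p]mpolyE; elim: (msupp p) => [|m s IH].
  by rewrite big_nil -(scale0r 1); apply: PZ.
by rewrite big_cons; apply: PD => //; apply: PZ.
Qed.

Lemma mpoly_morph_eq (B : comNzRingType) (f g : {rmorphism {mpoly A[n]} -> B}) :
  (forall c, f c%:MP = g c%:MP) -> (forall i, f 'X_i = g 'X_i) -> f =1 g.
Proof.
move=> fgC fgX; elim/mpoly_ring_ind => [p q fgp fgq|c p fgp||i p fgp].
- by rewrite !rmorphD fgp fgq.
- by rewrite -mul_mpolyC !rmorphM /= fgC fgp.
- by rewrite !rmorph1.
- by rewrite !rmorphM /= fgX fgp.
Qed.

End MpolyInduction.

Section LinearSubst.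
Variable n : nat.

(** The substitution of [lin_image] over any commutative ring: it is applied over polynomial rings,
    fraction fields and valuation rings. Storing the image of a variable in a column makes it a left
    action ([lsubM]). *)
Definition lsub (A : comNzRingType) (B : 'M[A]_n) (p : {mpoly A[n]}) :
  {mpoly A[n]} := p \mPo [tuple \sum_(i < n) B i j *: 'X_i | j < n].

HB.instance Definition _ (A : comNzRingType) (B : 'M[A]_n) :=
  GRing.RMorphism.copy (lsub B)
    (comp_mpoly [tuple \sum_(i < n) B i j *: 'X_i | j < n]).
HB.instance Definition _ (A : comNzRingType) (B : 'M[A]_n) :=
  GRing.Linear.copy (lsub B)
    (comp_mpoly [tuple \sum_(i < n) B i j *: 'X_i | j < n]).

Section Ring.
Variable A : comNzRingType.
Implicit Types (B D : 'M[A]_n) (p q : {mpoly A[n]}).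

Lemma lsubZ B c p : lsub B (c *: p) = c *: lsub B p.
Proof. exact: linearZ. Qed.

Lemma lsubD B p q : lsub B (p + q) = lsub B p + lsub B q.
Proof. exact: raddfD. Qed.

Lemma lsub_sum I (r : seq I) B (F : I -> {mpoly A[n]}) :
  lsub B (\sum_(i <- r) F i) = \sum_(i <- r) lsub B (F i).
Proof. exact: raddf_sum. Qed.

Lemma lsubC B c : lsub B c%:MP = c%:MP.
Proof. exact: comp_mpolyC. Qed.

Lemma lsubX B j : lsub B 'X_j = \sum_i B i j *: 'X_i.
Proof. by rewrite /lsub comp_mpolyXU -tnth_nth tnth_mktuple. Qed.

Lemma lsubM B D p : lsub B (lsub D p) = lsub (B *m D) p.
Proof.
apply: (mpoly_morph_eq (f := lsub B \o lsub D) (g := lsub (B *m D))) => [c|j] /=.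
  by rewrite !lsubC.
rewrite !lsubX lsub_sum.
under eq_bigr do rewrite lsubZ lsubX scaler_sumr.
rewrite exchange_big /=; apply: eq_bigr => i _.
rewrite mxE scaler_suml; apply: eq_bigr => k _.
by rewrite scalerA mulrC.
Qed.

Lemma lsub1 p : lsub 1%:M p = p.
Proof.
apply: (mpoly_morph_eq (f := lsub 1%:M) (g := idfun)) => [c|j] /=.
  by rewrite lsubC.
rewrite lsubX (bigD1 j) //= big1 => [|i ij]; rewrite mxE ?eqxx ?scale1r ?addr0 //.
by rewrite (negPf ij) scale0r.
Qed.

Lemma lsub_diag (d : 'I_n -> A) p m :
  (lsub (\matrix_(i, j) (d i *+ (i == j))) p)@_m = (\prod_i d i ^+ m i) * p@_m.
Proof.
rewrite [p in lsub _ p]mpolyE [p in RHS]mpolyE lsub_sum !(raddf_sum (mcoeff m)) /= mulr_sumr.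
apply: eq_bigr => m' _; rewrite lsubZ !mcoeffZ.
have -> : lsub (\matrix_(i, j) (d i *+ (i == j))) 'X_[m'] =
    (\prod_i d i ^+ m' i) *: 'X_[m'].
  rewrite [in LHS]mpolyXE_id rmorph_prod [in RHS]mpolyXE_id -scaler_prod.
  apply: eq_bigr => j _; rewrite rmorphXn /= lsubX (bigD1 j) //= big1.
    by rewrite mxE eqxx addr0 exprZn.
  by move=> i ij; rewrite mxE (negPf ij) scale0r.
rewrite mcoeffZ mcoeffX; have [->|] := eqVneq m' m; last by rewrite !mulr0.
by rewrite !mulr1 mulrC.
Qed.

Lemma mderiv_lsub B p i :
  (lsub B p)^`M(i) = \sum_j B i j *: lsub B (p^`M(j)).
Proof.
elim/mpoly_ring_ind: p => [p q IHp IHq|c p IH||k p IH].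
- rewrite lsubD mderivD IHp IHq -big_split /=; apply: eq_bigr => j _.
  by rewrite mderivD lsubD scalerDr.
- rewrite lsubZ mderivZ IH scaler_sumr; apply: eq_bigr => j _.
  by rewrite mderivZ lsubZ !scalerA mulrC.
- rewrite rmorph1 -mpolyC1 mderivC big1 // => j _.
  by rewrite mderivC raddf0 scaler0.
- have dX : (lsub B 'X_k)^`M(i) = (B i k)%:MP.
    rewrite lsubX linear_sum (bigD1 i) //= big1 => [|l li].
      rewrite addr0 mderivZ mderivX mnm1E eqxx scale1r.
      by rewrite mnm_subUU mpolyX0 -mul_mpolyC mulr1.
    by rewrite mderivZ mderivX mnm1E (negPf li) scale0r scaler0.
  rewrite rmorphM mderivM dX IH mul_mpolyC mulr_sumr.
  under [in RHS]eq_bigr => j _.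
    rewrite mderivM rmorphD !rmorphM /= scalerDr.
    over.
  rewrite big_split /=; congr (_ + _).
    rewrite (bigD1 k) //= big1 => [|j jk].
      rewrite mderivX mnm1E eqxx scale1r addr0.
      by rewrite mnm_subUU mpolyX0 rmorph1 mul1r.
    by rewrite mderivX mnm1E eq_sym (negPf jk) scale0r raddf0 mul0r scaler0.
  by apply: eq_bigr => j _; rewrite scalerAr.
Qed.

Lemma lsub0 B p : (lsub B p)@_0%MM = p@_0%MM.
Proof.
apply: (mpoly_morph_eq (f := mcoeff 0%MM \o lsub B) (g := mcoeff 0%MM)) => [c|j] /=.
  by rewrite lsubC.
rewrite lsubX (raddf_sum (mcoeff 0%MM)) big1 => [|i _] /=.
  by rewrite mcoeffX mnm1_eq0.
by rewrite mcoeffZ mcoeffX mnm1_eq0 mulr0.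
Qed.

Lemma dhomog_lsub d B p : p \is d.-homog -> lsub B p \is d.-homog.
Proof.
move=> /dhomogP hp; rewrite /lsub comp_mpolyE big_seq.
apply: rpred_sum => m /hp <-; apply: rpredZ; rewrite /= mdegE.
apply: (big_ind2 (fun (p : {mpoly A[n]}) e => p \is e.-homog)).
- exact: dhomog1.
- by move=> p1 e1 p2 e2; exact: dhomogM.
move=> i _; rewrite -[X in X.-homog]mul1n; apply: dhomogMn.
rewrite tnth_mktuple; apply: rpred_sum => k _; apply: rpredZ.
by rewrite dhomogX /= mdeg1.
Qed.

Lemma lsub_scalar d c p : p \is d.-homog -> lsub c%:M p = c ^+ d *: p.
Proof.
move=> /dhomogP hp; apply/mpolyP => m.
have -> : c%:M = \matrix_(i, j) (c *+ (i == j)) :> 'M[A]_n.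
  by apply/matrixP => i j; rewrite !mxE.
rewrite lsub_diag mcoeffZ prodrXr -mdegE.
have [m_p|/memN_msupp_eq0->] := boolP (m \in msupp p); last by rewrite !mulr0.
by rewrite (hp _ m_p).
Qed.

End Ring.

Lemma map_lsub (A A' : comNzRingType) (f : {rmorphism A -> A'}) (B : 'M[A]_n) p :
  map_mpoly f (lsub B p) = lsub (map_mx f B) (map_mpoly f p).
Proof.
apply: (mpoly_morph_eq (f := map_mpoly f \o lsub B)
          (g := lsub (map_mx f B) \o map_mpoly f)) => [c|j] /=.
  by rewrite lsubC !map_mpolyC lsubC.
rewrite map_mpolyX !lsubX (raddf_sum (map_mpoly f)); apply: eq_bigr => i _.
by rewrite mxE -(map_mpolyX f) -map_mpolyZ.
Qed.

End LinearSubst.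

Section MapMpoly.
Variables (n : nat) (A A' : comNzRingType) (f : {rmorphism A -> A'}).

Lemma mderiv_map (p : {mpoly A[n]}) i :
  (map_mpoly f p)^`M(i) = map_mpoly f (p^`M(i)).
Proof.
by apply/mpolyP => m; rewrite mcoeff_map_mpoly !mcoeff_deriv mcoeff_map_mpoly raddfMn.
Qed.

Lemma map_mpoly_comp_morph (A'' : comNzRingType) (g : {rmorphism A' -> A''})
  (p : {mpoly A[n]}) : map_mpoly g (map_mpoly f p) = map_mpoly (g \o f) p.
Proof. by apply/mpolyP => m; rewrite !mcoeff_map_mpoly. Qed.

Lemma dhomog_map d (p : {mpoly A[n]}) : p \is d.-homog -> map_mpoly f p \is d.-homog.
Proof.
move=> /dhomogP hp; apply/dhomogP => m; rewrite mcoeff_msupp mcoeff_map_mpoly => fp.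
by apply: hp; rewrite mcoeff_msupp; apply: contraNneq fp => ->; rewrite raddf0.
Qed.

End MapMpoly.

Section Apolar.
Variables (n : nat) (A : comNzRingType).
Implicit Types (p q : {mpoly A[n]}) (B : 'M[A]_n).

Definition mfact (m : 'X_{1..n}) : nat := (\prod_i (m i)`!)%N.

(** The apolar pairing: the constant term of p, read as a differential operator, applied to q. The
    factorials make multiplication by a variable adjoint to its derivative. It is bilinear;
    Hermitian uses conjugate the second argument explicitly. *)
Definition apo p q : A := \sum_(m <- msupp p) p@_m * (q@_m *+ mfact m).

Lemma apowE p q k : (msize p <= k)%N ->
  apo p q = \sum_(m : 'X_{1..n < k}) p@_m * (q@_m *+ mfact m).
Proof.
move=> le_pk; rewrite /apo (big_mksub 'X_{1..n < k}) ?msupp_uniq //=; first last.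
  by move=> m /msize_mdeg_lt /leq_trans; apply.
by rewrite big_rmcond //= => m /memN_msupp_eq0->; rewrite mul0r.
Qed.

Lemma apoDl p1 p2 q : apo (p1 + p2) q = apo p1 q + apo p2 q.
Proof.
pose k := maxn (msize (p1 + p2)) (maxn (msize p1) (msize p2)).
rewrite !(@apowE _ _ k) ?leq_max ?leqnn ?orbT // -big_split /=.
by apply: eq_bigr => m _; rewrite mcoeffD mulrDl.
Qed.

Lemma apoZl c p q : apo (c *: p) q = c * apo p q.
Proof.
pose k := maxn (msize (c *: p)) (msize p).
rewrite !(@apowE _ _ k) ?leq_max ?leqnn ?orbT // mulr_sumr.
by apply: eq_bigr => m _; rewrite mcoeffZ mulrA.
Qed.

Lemma apoDr p q1 q2 : apo p (q1 + q2) = apo p q1 + apo p q2.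
Proof.
by rewrite -big_split; apply: eq_bigr => m _; rewrite mcoeffD mulrnDl mulrDr.
Qed.

Lemma apoZr c p q : apo p (c *: q) = c * apo p q.
Proof.
by rewrite mulr_sumr; apply: eq_bigr => m _; rewrite mcoeffZ -mulrnAr mulrCA.
Qed.

Lemma apo0l q : apo 0 q = 0.
Proof. by rewrite -(scale0r 0) apoZl mul0r. Qed.

Lemma apo0r p : apo p 0 = 0.
Proof. by rewrite -(scale0r 0) apoZr mul0r. Qed.

Lemma apo_suml I (r : seq I) (F : I -> {mpoly A[n]}) q :
  apo (\sum_(i <- r) F i) q = \sum_(i <- r) apo (F i) q.
Proof. by apply: (big_morph (apo^~ q)) => [p1 p2|]; rewrite ?apoDl ?apo0l. Qed.

Lemma apo_sumr I (r : seq I) (F : I -> {mpoly A[n]}) p :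
  apo p (\sum_(i <- r) F i) = \sum_(i <- r) apo p (F i).
Proof. by apply: (big_morph (apo p)) => [q1 q2|]; rewrite ?apoDr ?apo0r. Qed.

Lemma apoX m q : apo 'X_[m] q = q@_m *+ mfact m.
Proof. by rewrite /apo msuppX big_seq1 mcoeffX eqxx mul1r. Qed.

Lemma apo1 q : apo 1 q = q@_0%MM.
Proof.
rewrite -mpolyX0 apoX /mfact big1 // => i _.
by rewrite mnm0E fact0.
Qed.

Lemma mfactU m i : mfact (m + U_(i)) = ((m i).+1 * mfact m)%N.
Proof.
rewrite /mfact (bigD1 i) //= [in RHS](bigD1 i) //= mnmDE mnm1E eqxx addn1 factS mulnA.
by congr (_ * _)%N; apply: eq_bigr => j ji; rewrite mnmDE mnm1E eq_sym (negPf ji) addn0.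
Qed.

Lemma apo_mulX i p q : apo ('X_i * p) q = apo p (q^`M(i)).
Proof.
rewrite [p]mpolyE mulr_sumr !apo_suml; apply: eq_bigr => m _.
rewrite -scalerAr !apoZl -mpolyXD !apoX mcoeff_deriv [(U_(i) + m)%MM]addmC mfactU.
by rewrite mulrnA.
Qed.

(** Induction on p by multiplication with a variable: this becomes a derivative on the right-hand
    argument, and the chain rule [mderiv_lsub] brings in the transpose. *)
Lemma apo_lsub B p q : apo (lsub B p) q = apo p (lsub B^T q).
Proof.
elim/mpoly_ring_ind: p q => [p1 p2 IH1 IH2|c p IH||i p IH] q.
- by rewrite lsubD !apoDl IH1 IH2.
- by rewrite lsubZ !apoZl IH.
- by rewrite rmorph1 !apo1 lsub0.
- rewrite rmorphM /= lsubX mulr_suml apo_suml apo_mulX mderiv_lsub apo_sumr.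
  apply: eq_bigr => j _; rewrite mxE -scalerAl apoZl apoZr.
  by rewrite apo_mulX IH.
Qed.

End Apolar.

Lemma apo_map n (A A' : comNzRingType) (f : {rmorphism A -> A'}) (p q : {mpoly A[n]}) :
  apo (map_mpoly f p) (map_mpoly f q) = f (apo p q).
Proof.
pose k := maxn (msize (map_mpoly f p)) (msize p).
rewrite !(@apowE _ _ _ _ k) ?leq_max ?leqnn ?orbT // rmorph_sum.
by apply: eq_bigr => m _; rewrite !mcoeff_map_mpoly rmorphM rmorphMn.
Qed.

(** * Polynomials vanishing at all points *)

Section Vanishing.
Variables (n : nat) (F : numFieldType).
Implicit Type p : {mpoly F[n]}.

Lemma poly_vanish (p : {poly F}) : (forall x, x != 0 -> p.[x] = 0) -> p = 0.
Proof.
move=> p0; apply/eqP; apply: contraT => p_neq0.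
have := @max_poly_roots _ p [seq i.+1%:R | i <- iota 0 (size p)] p_neq0.
rewrite size_map size_iota ltnn => -> //; last first.
  by rewrite map_inj_uniq ?iota_uniq // => i j /eqP; rewrite eqr_nat => /eqP[].
by apply/allP => _ /mapP[i _ ->]; rewrite /root p0 // pnatr_eq0.
Qed.

(** On the line through v in direction i, p restricts to a one-variable polynomial that vanishes
    everywhere, hence is zero; its derivative at 0 is the partial derivative at v. *)
Lemma meval_deriv_vanish p : (forall v, p.@[v] = 0) -> forall i v, p^`M(i).@[v] = 0.
Proof.
move=> p0 i v.
pose w j : {poly F} := (v j)%:P + (i == j)%:R *: 'X.
have key q : (mmap (@polyC F) w q)^`().[0] = (q^`M(i)).@[v] /\
             forall t, (mmap (@polyC F) w q).[t] = q.@[fun j => v j + (i == j)%:R * t].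
  elim/mpoly_ring_ind: q => [q1 q2 [d1 e1] [d2 e2]|c q [d e]||k q [d e]].
  - rewrite !rmorphD /= derivD hornerD d1 d2 mderivD mevalD; split => // t.
    by rewrite hornerD e1 e2 mevalD.
  - rewrite mmapZ derivM derivC mul0r add0r hornerM hornerC d mderivZ mevalZ; split => // t.
    by rewrite hornerM hornerC e mevalZ.
  - rewrite !rmorph1 -polyC1 derivC horner0 -mpolyC1 mderivC meval0; split => // t.
    by rewrite hornerC mevalC.
  - have q0 : (mmap (@polyC F) w q).[0] = q.@[v].
      by rewrite e; apply: meval_eq => j; rewrite mulr0 addr0.
    rewrite !rmorphM /= mmapX mmap1U derivM hornerD !hornerM d q0 mderivM mevalD !mevalM; split.
      rewrite /w !(derivD, derivC, derivZ, derivX, hornerD, hornerZ, hornerC, hornerX).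
      rewrite mulr0 addr0 mevalXU mulr1 add0r mderivX mnm1E eq_sym.
      have [->|ik] := eqVneq i k; last by rewrite scale0r meval0.
      by rewrite scale1r mnm_subUU mpolyX0 meval1.
    by move=> t; rewrite hornerM e mevalM mevalXU /w !(hornerD, hornerZ, hornerC, hornerX).
have [<- e] := key p.
suff -> : mmap (@polyC F) w p = 0 by rewrite deriv0 horner0.
by apply: poly_vanish => t _; rewrite e p0.
Qed.

(** In characteristic 0 a nonconstant coefficient is, up to a positive integer, a coefficient of
    lower degree of a partial derivative, which vanishes everywhere too. *)
Lemma mpoly_vanish p : (forall v, p.@[v] = 0) -> p = 0.
Proof.
move=> p0; apply/mpolyP => m; rewrite mcoeff0.
have [k] := ubnP (mdeg m); elim: k p p0 m => // k IH p p0 m lt_mk.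
have [->|m_neq0] := eqVneq m 0%MM.
  rewrite -(p0 (fun=> 0)).
  apply: (mpoly_morph_eq (f := mcoeff 0%MM) (g := meval (fun=> 0))) => [c|i] /=.
    by rewrite mpolyCK mevalC.
  by rewrite mcoeffX mnm1_eq0 mevalXU.
have [i mi] := mnm_neq0P m_neq0.
have le_im : (U_(i) <= m)%MM by rewrite lep1mP.
have := IH _ (meval_deriv_vanish p0 i) (m - U_(i))%MM.
rewrite mcoeff_deriv submK // -[in mdeg m](submK le_im) mdegD mdeg1 addn1 in lt_mk *.
by move=> /(_ lt_mk)/eqP; rewrite mulrn_eq0 => /eqP.
Qed.

End Vanishing.

(** * Places and Smith normal form over a valuation ring *)

Section GraphRing.
Variables (K L : fieldType) (G : subringClosed (K * L)%type).

(** The domain of a place, encoded by its graph: the two projections are the inclusion into K and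
    the place itself. *)
Record graph_ring := GraphRing { graph_val : (K * L)%type; _ : graph_val \in G }.

HB.instance Definition _ := [isSub for graph_val].
HB.instance Definition _ := [Choice of graph_ring by <:].
HB.instance Definition _ := [SubChoice_isSubComNzRing of graph_ring by <:].

Definition graph_fst (x : graph_ring) : K := (val x).1.
Definition graph_snd (x : graph_ring) : L := (val x).2.
HB.instance Definition _ := GRing.RMorphism.copy graph_fst (fst \o val).
HB.instance Definition _ := GRing.RMorphism.copy graph_snd (snd \o val).

End GraphRing.

(** * Extension of places *)

Section PlaceExtension.
Variables (K : fieldType) (L : closedFieldType).
Implicit Types (G H : set (K * L)%type).

(* The graph of a ring morphism from a subring of K to L. *)
Definition place_graph G : Prop :=
  [/\ G 1, (forall u v, G u -> G v -> G (u - v)),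
      (forall u v, G u -> G v -> G (u * v)) & forall c, G (0, c) -> c = 0].

Lemma place_graph_max G0 : place_graph G0 ->
  exists H, [/\ G0 `<=` H, place_graph H &
    forall H', H `<=` H' -> place_graph H' -> H' `<=` H].
Proof.
move=> ok0.
(* Taking the union with G0 inside the predicate covers the empty chain as well. *)
have [|A [okA maxA]] := @Zorn_bigcup _ (fun S => place_graph (S `|` G0)).
  move=> F FP Ftot.
  have pair u v : ((\bigcup_(X in F) X) `|` G0) u -> ((\bigcup_(X in F) X) `|` G0) v ->
      exists S, [/\ place_graph S, S `<=` (\bigcup_(X in F) X) `|` G0, S u & S v].
    have sub X : F X -> X `|` G0 `<=` (\bigcup_(X in F) X) `|` G0.
      by move=> FX w [Xw|]; [left; exists X|right].
    move=> [[X FX Xu]|Gu] [[Y FY Yv]|Gv].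
    - have [XY|YX] := Ftot _ _ FX FY.
        by exists (Y `|` G0); split; [exact: FP|exact: sub|left; exact: XY|left].
      by exists (X `|` G0); split; [exact: FP|exact: sub|left|left; exact: YX].
    - by exists (X `|` G0); split; [exact: FP|exact: sub|left|right].
    - by exists (Y `|` G0); split; [exact: FP|exact: sub|right|left].
    - by exists G0; split => // w; right.
  split.
  - by right; case: ok0.
  - by move=> u v Hu Hv; have [S [[_ SB _ _] sS Su Sv]] := pair _ _ Hu Hv; apply/sS/SB.
  - by move=> u v Hu Hv; have [S [[_ _ SM _] sS Su Sv]] := pair _ _ Hu Hv; apply/sS/SM.
  - by move=> c Hc; have [S [[_ _ _ S0] _ Sc _]] := pair _ _ Hc Hc; exact: S0.
exists (A `|` G0); split => [u|//|H' sH okH' u H'u]; first by right.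
apply: contrapT => Hu; apply: (maxA H').
  split; first by move=> w Aw; apply: sH; left.
  by move=> sub; apply: Hu; left; apply: sub.
rewrite (_ : H' `|` G0 = H') //; apply/seteqP; split => w; last by left.
by case=> // ?; apply: sH; right.
Qed.

Lemma place_graph_ring (H : set (K * L)%type) (k0 : {rmorphism L -> K}) :
  place_graph H -> (forall c, H (k0 c, c)) ->
  exists (O : comNzRingType) (i : {rmorphism O -> K}) (f : {rmorphism O -> L})
    (j : {rmorphism L -> O}),
  [/\ injective i, (forall o, H (i o, f o)),
      (forall x c, H (x, c) -> exists o, i o = x /\ f o = c),
      (forall c, i (j c) = k0 c) & (forall c, f (j c) = c)].
Proof.
move=> [H1 HB HM H0] Hk0.
pose Hp : {pred (K * L)%type} := fun u => `[< H u >].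
have Hc : subring_closed Hp.
  split; first exact/asboolP.
    by move=> u v /asboolP Hu /asboolP Hv; apply/asboolP/HB.
  by move=> u v /asboolP Hu /asboolP Hv; apply/asboolP/HM.
pose Hs : subringClosed (K * L)%type :=
  HB.pack_for (subringClosed (K * L)%type) Hp
    (GRing.isSubringClosed.Build (K * L)%type Hp Hc).
pose jf (c : L) : graph_ring Hs := @GraphRing K L Hs (k0 c, c) (asboolT (Hk0 c)).
have jB : zmod_morphism jf by move=> a b; apply: val_inj; rewrite /= rmorphB.
have jM : monoid_morphism jf.
  by split=> [|a b]; apply: val_inj; rewrite /= ?rmorph1 ?rmorphM.
pose j : {rmorphism L -> graph_ring Hs} :=
  HB.pack_for {rmorphism L -> graph_ring Hs} jf
    (GRing.isZmodMorphism.Build L (graph_ring Hs) jf jB)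
    (GRing.isMonoidMorphism.Build L (graph_ring Hs) jf jM).
exists (graph_ring Hs), (@graph_fst K L Hs), (@graph_snd K L Hs), j.
have memH (o : graph_ring Hs) : H (graph_fst o, graph_snd o).
  by case: o => [[x c] xc]; apply/asboolP.
split=> //.
- move=> a b eq_ab; apply/eqP; rewrite -subr_eq0; apply/eqP; apply: val_inj.
  have ab0 : graph_fst (a - b) = 0 by rewrite rmorphB eq_ab subrr.
  have := memH (a - b); rewrite ab0 => /H0; rewrite /graph_fst /graph_snd in ab0 *.
  by case: (val (a - b)) ab0 => x c /= -> ->.
- by move=> x c /asboolP Hxc; exists (@GraphRing K L Hs (x, c) Hxc).
Qed.

Section Maximal.
Variables (H : set (K * L)%type) (O : comNzRingType) (i : {rmorphism O -> K}).
Variables (f : {rmorphism O -> L}) (j : {rmorphism L -> O}).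
Hypothesis okH : place_graph H.
Hypothesis maxH : forall H', H `<=` H' -> place_graph H' -> H' `<=` H.
Hypothesis place_inj : injective i.
Hypothesis place_memO : forall o, H (i o, f o).
Hypothesis place_liftO : forall x c, H (x, c) -> exists o, i o = x /\ f o = c.
Hypothesis fj : forall c, f (j c) = c.

(** Inverting the powers of o in K and those of f o in L enlarges the graph to another place graph,
    so by maximality the inverse was already there. *)
Lemma place_unit (o : O) : f o != 0 -> exists o', o * o' = 1.
Proof.
move=> fo; have [H1 HB HM H0] := okH.
have Ho := place_memO o; set x := i o in Ho; set c := f o in fo Ho.
have x_neq0 : x != 0.
  by apply: contra fo => /eqP x0; apply/eqP/H0; rewrite -x0.
have HX n : H (x ^+ n, c ^+ n).
  elim: n => [|n IH]; first by rewrite !expr0.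
  by rewrite !exprS; apply: (HM (x, c) _ Ho IH).
pose H' : set (K * L)%type :=
  [set u | exists n a b, H (a, b) /\ u = (a / x ^+ n, b / c ^+ n)].
have [] : H' (x^-1, c^-1).
  by exists 1, 1, 1; split; [exact: H1|rewrite !expr1 !mul1r].
have {}maxH' : H' `<=` H.
  apply: maxH => [[a b] Hab|]; first by exists 0, a, b; rewrite !expr0 !divr1.
  split.
  - by exists 0, 1, 1; split; [exact: H1|rewrite !expr0 !divr1].
  - move=> _ _ [n [a [b [Hab ->]]]] [m [a' [b' [Hab' ->]]]].
    exists (n + m), (a * x ^+ m - a' * x ^+ n), (b * c ^+ m - b' * c ^+ n); split.
      exact: (HB (_, _) (_, _) (HM (_, _) (_, _) Hab (HX m)) (HM (_, _) (_, _) Hab' (HX n))).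
    congr (_, _); rewrite !exprD mulrBl !invfM; congr (_ - _).
    + by rewrite mulrACA divff ?mulr1 ?expf_neq0 // mulrC.
    + by rewrite [_^-1 * _]mulrC mulrACA divff ?mulr1 ?expf_neq0 // mulrC.
    + by rewrite mulrACA divff ?mulr1 ?expf_neq0 // mulrC.
    + by rewrite [_^-1 * _]mulrC mulrACA divff ?mulr1 ?expf_neq0 // mulrC.
  - move=> _ _ [n [a [b [Hab ->]]]] [m [a' [b' [Hab' ->]]]].
    exists (n + m), (a * a'), (b * b'); split; first exact: (HM (_, _) (_, _) Hab Hab').
    by congr (_, _); rewrite !exprD !invfM mulrACA.
  - move=> e [n [a [b [Hab [/esym/eqP]]]]].
    rewrite mulf_eq0 invr_eq0 expf_eq0 (negPf x_neq0) andbF orbF => /eqP a0.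
    by rewrite a0 in Hab; rewrite (H0 _ Hab) mul0r.
move=> n [a [b [Hab E]]].
have /place_liftO[o' [io' _]] : H (x^-1, c^-1) by apply: maxH'; exists n, a, b.
by exists o'; apply: place_inj; rewrite rmorphM rmorph1 io' divff.
Qed.

(** If 1 is no polynomial in x with coefficients in the kernel of f, the place extends to O[x]: the
    algebraic relations of x reduce to a proper ideal of L[T], whose root g serves as the value at
    x. Maximality then puts x in O. *)
Lemma place_adjoin x :
  (forall P : {poly O}, map_poly f P = 0 -> (map_poly i P).[x] <> 1) ->
  exists o, i o = x.
Proof.
move=> noP; have [H1 HB HM H0] := okH.
(* J is the ideal of reductions of the polynomials over O that vanish at x. *)
pose J (q : {poly L}) := exists P : {poly O}, (map_poly i P).[x] = 0 /\ q = map_poly f P.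
have Jconst c : J c%:P -> c = 0.
  move=> [P [Px0 cE]]; apply/eqP; apply: contraT => c_neq0.
  have fP0 : f P`_0 = c by rewrite -coef_map -cE coefC eqxx.
  have [o' oo'] : exists o', P`_0 * o' = 1 by apply: place_unit; rewrite fP0.
  (* With o' inverse to the constant coefficient of P, all coefficients of this polynomial reduce to
     0, while its value at x is 1. *)
  case: (noP (1 - o' *: P)).
    apply/polyP => k; rewrite coef_map /= coefB coefZ coef1 coef0 rmorphB rmorphM.
    have -> : f P`_k = c *+ (k == 0) by rewrite -coef_map -cE coefC; case: (k == 0)%N.
    case: k => [|k]; last by rewrite rmorph0 mulr0 subrr.
    by rewrite /= mulr1n -fP0 -rmorphM mulrC oo' subrr.
  by rewrite rmorphB rmorph1 /= map_polyZ hornerD hornerN hornerZ Px0 mulr0 subr0 hornerC.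
have JB p q : J p -> J q -> J (p - q).
  move=> [P [Px ->]] [Q [Qx ->]]; exists (P - Q); rewrite !rmorphB hornerD hornerN Px Qx.
  by rewrite subrr.
have JM r q : J q -> J (r * q).
  move=> [Q [Qx ->]]; exists (map_poly j r * Q).
  rewrite !rmorphM hornerM Qx mulr0; split=> //; congr (_ * _).
  by apply/polyP => k; rewrite !coef_map /= fj.
(* An element of least degree divides all of J, and it is not constant, so it has a root; if J is
   zero any g will do. *)
have [g Jg] : exists g, forall q, J q -> root q g.
  have [[q [q_neq0 Jq]]|noq] := pselect (exists q, q != 0 /\ J q); last first.
    exists 0 => q Jq; have [->|q_neq0] := eqVneq q 0; first exact: root0.
    by case: noq; exists q.
  have ex_n : exists n, `[< exists q : {poly L}, [/\ q != 0, J q & size q = n] >].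
    by exists (size q); apply/asboolP; exists q.
  case: (ex_minnP ex_n) => n /asboolP[{q_neq0 Jq}q [q_neq0 Jq szq]] min_n.
  have /closed_rootP[g qg] : size q != 1.
    apply: contra q_neq0 => /size_poly1P[c c_neq0 qE].
    by move: Jq; rewrite qE => /Jconst->.
  exists g => p Jp.
  suff /eqP pq0 : p %% q == 0.
    by rewrite (divp_eq p q) pq0 addr0 rootM qg orbT.
  apply: contraT => pq_neq0; have Jpq : J (p %% q).
    suff -> : p %% q = p - (p %/ q) * q by apply: JB => //; apply: JM.
    by rewrite {2}(divp_eq p q) addrC addKr.
  have : (n <= size (p %% q)%R)%N by apply: min_n; apply/asboolP; exists (p %% q).
  by rewrite leqNgt -szq ltn_modp q_neq0.
pose H' : set (K * L)%type :=
  [set u | exists P : {poly O}, u = ((map_poly i P).[x], (map_poly f P).[g])].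
have H'x : H' (x, g) by exists 'X; rewrite !map_polyX !hornerX.
suff /(_ _ H'x)/place_liftO[o [io _]] : H' `<=` H by exists o.
apply: maxH.
  move=> [a b] /place_liftO[o [<- <-]]; exists o%:P.
  by rewrite !map_polyC !hornerC.
split.
- by exists 1; rewrite !rmorph1 !hornerC.
- by move=> _ _ [P ->] [Q ->]; exists (P - Q); rewrite !rmorphB !hornerD !hornerN.
- by move=> _ _ [P ->] [Q ->]; exists (P * Q); rewrite !rmorphM !hornerM.
- move=> c [P [/esym Px ->]]; apply/eqP.
  by apply: (Jg (map_poly f P)); exists P.
Qed.

(** Descent on the sum of the sizes: the shorter relation rewrites the leading power of the longer
    one by lower powers, again with coefficients in the kernel of f. Exchanging x with its inverse
    lets A be the longer one. *)
Lemma place_no_two_relations n (x : K) (A B : {poly O}) : x != 0 ->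
  map_poly f A = 0 -> map_poly f B = 0 ->
  (map_poly i A).[x] = 1 -> (map_poly i B).[x^-1] = 1 ->
  (size A + size B <= n)%N -> False.
Proof.
elim: n x A B => [|n IH] x A B x_neq0 fA fB Ax Bx szAB.
  move: szAB; rewrite leqn0 addn_eq0 size_poly_eq0 => /andP[/eqP A0 _].
  by move/eqP: Ax; rewrite A0 rmorph0 horner0 eq_sym oner_eq0.
wlog leBA : x A B x_neq0 fA fB Ax Bx szAB / (size B <= size A)%N => [wl|].
  have [leBA|/ltnW leAB] := leqP (size B) (size A); first exact: (wl x A B).
  apply: (wl x^-1 B A) => //; rewrite ?invr_eq0 ?invrK //.
  by rewrite addnC.
have A_neq0 : A != 0.
  by apply/eqP => A0; move/eqP: Ax; rewrite A0 rmorph0 horner0 eq_sym oner_eq0.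
have B_neq0 : B != 0.
  by apply/eqP => B0; move/eqP: Bx; rewrite B0 rmorph0 horner0 eq_sym oner_eq0.
have [N szA] : exists N, size A = N.+1.
  by exists (size A).-1; rewrite prednK // lt0n size_poly_eq0.
have [m szB] : exists m, size B = m.+1.
  by exists (size B).-1; rewrite prednK // lt0n size_poly_eq0.
have le_mN : (m <= N)%N by rewrite szA szB in leBA.
have fB_ k : f B`_k = 0 by rewrite -coef_map fB coef0.
have fA_ k : f A`_k = 0 by rewrite -coef_map fA coef0.
have [e eB] : exists e, (1 - B`_0) * e = 1.
  by apply: place_unit; rewrite rmorphB rmorph1 /= fB_ subr0 oner_eq0.
(* The relation B says that 1 - B_0, a unit with inverse e, is a sum of terms in negative powers of
   x; multiplying by e and x^N yields x^N = D(x). *)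
pose D : {poly O} := \sum_(l < m) (e * B`_l.+1) *: 'X^(N - l.+1).
have xN : x ^+ N = (map_poly i D).[x].
  have e1 : i e * (1 - i B`_0) = 1 by rewrite -(rmorph1 i) -rmorphB -rmorphM mulrC eB.
  rewrite -[LHS]mul1r -e1.
  have -> : 1 - i B`_0 = \sum_(l < m) i B`_l.+1 * x^-1 ^+ l.+1.
    rewrite -[1]Bx horner_coef size_map_poly_id0; last first.
      by rewrite -(rmorph0 i) (inj_eq place_inj) lead_coef_eq0.
    rewrite szB big_ord_recl /= coef_map expr0 mulr1 addrC addKr.
    by apply: eq_bigr => l _; rewrite coef_map.
  rewrite /D rmorph_sum horner_sum mulr_sumr mulr_suml; apply: eq_bigr => l _.
  rewrite /= map_polyZ /= map_polyXn hornerZ hornerXn rmorphM /= -!mulrA; congr (_ * (_ * _)).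
  have le_lN : (l < N)%N by apply: leq_trans le_mN.
  by rewrite -[in LHS](subnK le_lN) exprD exprVn mulrC mulfK ?expf_neq0.
pose A' := A - A`_N *: 'X^N + A`_N *: D.
apply: (IH x A' B) => //.
- apply/polyP => k; rewrite coef_map /= coef0 !(coefD, coefN, coefZ).
  by rewrite rmorphD rmorphB !rmorphM /= !fA_ !mul0r subrr addr0.
- rewrite rmorphD rmorphB /= !map_polyZ map_polyXn !(hornerD, hornerN, hornerZ, hornerXn).
  by rewrite Ax /= -xN subrK.
suff szA' : (size A' <= N)%N by rewrite szA in szAB; lia.
apply/leq_sizeP => k le_Nk; rewrite !(coefD, coefN, coefZ, coefXn).
have -> : D`_k = 0.
  rewrite coef_sum big1 // => l _; rewrite coefZ coefXn.
  have -> : (k == N - l.+1)%N = false by have := ltn_ord l; lia.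
  by rewrite mulr0.
rewrite mulr0 addr0; have [->|ltNk] := eqVneq k N; first by rewrite mulr1 subrr.
by rewrite mulr0 subr0 nth_default // szA; lia.
Qed.

Lemma place_total x : (exists o, i o = x) \/ (x != 0 /\ exists o, i o = x^-1).
Proof.
have [->|x_neq0] := eqVneq x 0; first by left; exists 0; rewrite rmorph0.
have rel y : (exists o, i o = y) \/
    exists P : {poly O}, map_poly f P = 0 /\ (map_poly i P).[y] = 1.
  have [[P [fP Py]]|noP] := pselect (exists P : {poly O},
      map_poly f P = 0 /\ (map_poly i P).[y] = 1); first by right; exists P.
  by left; apply: place_adjoin => P fP Py; apply: noP; exists P.
have [|[A [fA Ax]]] := rel x; first by left.
have [|[B [fB Bx]]] := rel x^-1; first by right.
by case: (@place_no_two_relations (size A + size B) x A B).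
Qed.

End Maximal.
(** Chevalley's extension theorem: a maximal extension of the given graph has a valuation ring as
    domain. The morphism j is the section of the place given by the constants. *)
Lemma place_exists (G : set (K * L)%type) (k0 : {rmorphism L -> K}) :
  place_graph G -> (forall c, G (k0 c, c)) ->
  exists (O : comNzRingType) (i : {rmorphism O -> K}) (f : {rmorphism O -> L})
    (j : {rmorphism L -> O}),
  [/\ injective i, (forall c, i (j c) = k0 c), (forall c, f (j c) = c),
      (forall x c, G (x, c) -> exists o, i o = x /\ f o = c) &
      (forall o, f o != 0 -> exists o', o * o' = 1) /\
      (forall x, (exists o, i o = x) \/ (x != 0 /\ exists o, i o = x^-1))].
Proof.
move=> okG Gk0; have [H [sGH okH maxH]] := place_graph_max okG.
have Hk0 c : H (k0 c, c) by apply: sGH.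
have [O [i [f [j [inj_i memO liftO ij fj]]]]] := place_graph_ring okH Hk0.
exists O, i, f, j; split=> //; first by move=> x c /sGH/liftO.
split; first exact: (place_unit okH maxH inj_i memO liftO).
exact: (place_total okH maxH inj_i memO liftO fj).
Qed.

End PlaceExtension.

(** * Smith normal form over a valuation ring *)

Section ValuationSmith.
Variables (K : fieldType) (O : comNzRingType) (i : {rmorphism O -> K}).
Hypothesis inj_i : injective i.
Hypothesis total_i : forall x, (exists o, i o = x) \/ (x != 0 /\ exists o, i o = x^-1).

(** Divisibility modulo O, that is, the comparison of valuations without a value group. *)
Definition vdvd (a b : K) := exists o, b = a * i o.

Lemma vdvd_refl a : vdvd a a.
Proof. by exists 1; rewrite rmorph1 mulr1. Qed.

Lemma vdvd_trans b a c : vdvd a b -> vdvd b c -> vdvd a c.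
Proof. by move=> [o ->] [o' ->]; exists (o * o'); rewrite rmorphM mulrA. Qed.

Lemma vdvd_total a b : vdvd a b \/ vdvd b a.
Proof.
have [->|a_neq0] := eqVneq a 0; first by right; exists 0; rewrite rmorph0 mulr0.
have [[o oE]|[ba_neq0 [o oE]]] := total_i (b / a).
  by left; exists o; rewrite oE mulrC divfK.
right; exists o; rewrite oE invf_div mulrC divfK //.
by apply: contraNneq ba_neq0 => ->; rewrite mul0r.
Qed.

Lemma vdvd_min (T : finType) (t : T) (x : T -> K) : exists t0, forall t, vdvd (x t0) (x t).
Proof.
have [t0 min_t0] : exists t0, forall t', t' \in enum T -> vdvd (x t0) (x t').
  elim: (enum T) => [|u s [t0 IH]]; first by exists t.
  have [t0u|ut0] := vdvd_total (x t0) (x u).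
    by exists t0 => t'; rewrite inE => /predU1P[->|/IH].
  exists u => t'; rewrite inE => /predU1P[->|/IH]; first exact: vdvd_refl.
  exact: vdvd_trans.
by exists t0 => t'; apply: min_t0; rewrite mem_enum.
Qed.

(** Gaussian elimination with an entry of least valuation as pivot: it divides all other entries, so
    row and column operations stay integral, and it divides all later diagonal entries. *)
Lemma valuation_smith n (A : 'M[K]_n) :
  exists (U U' V V' : 'M[O]_n) (d : 'rV[K]_n),
  [/\ U *m U' = 1%:M, V *m V' = 1%:M,
      A = map_mx i U *m diag_mx d *m map_mx i V &
      forall k l : 'I_n, (k <= l)%N -> vdvd (d 0 k) (d 0 l)].
Proof.
elim: n A => [|n IH] A; last rewrite -[n.+1]/(1 + n)%N in A *.
  exists 1%:M, 1%:M, 1%:M, 1%:M, 0; split; rewrite ?mulmx1 //; last by case.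
  by apply/matrixP => -[].
have [[p q] min_pq] := vdvd_min (ord0, ord0) (fun u : 'I_n.+1 * 'I_n.+1 => A u.1 u.2).
set a := A p q in min_pq.
have [a0|a_neq0] := eqVneq a 0.
  exists 1%:M, 1%:M, 1%:M, 1%:M, 0; split; rewrite ?mulmx1 //; last first.
    by move=> k l _; exists 0; rewrite !mxE rmorph0 mulr0.
  apply/matrixP => k l; have [o] := min_pq (k, l).
  by rewrite /= -/a a0 mul0r => ->; rewrite linear0 mulmx0 mul0mx mxE.
(* After the pivot is moved to the corner and factored out, N has corner 1; the induction hypothesis
   is applied to its Schur complement, multiplied by the pivot. *)
have [N NE] : exists N : 'M[O]_(1 + n), xrow ord0 p (xcol ord0 q A) = a *: map_mx i N.
  have /choice[F FE] : forall u : 'I_n.+1 * 'I_n.+1,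
      exists o, xrow ord0 p (xcol ord0 q A) u.1 u.2 = a * i o.
    by move=> [k l]; have [o oE] := min_pq (tperm ord0 p k, tperm ord0 q l); exists o; rewrite !mxE oE.
  by exists (\matrix_(k, l) F (k, l)); apply/matrixP => k l; rewrite (FE (k, l)) !mxE.
have N00 : ulsubmx N = 1%:M.
  apply/matrixP => k l; rewrite !ord1 !mxE eqxx; apply: inj_i; rewrite rmorph1.
  have /matrixP/(_ ord0 ord0) := NE; rewrite !mxE !tpermL -/a.
  have -> : lshift n (0 : 'I_1) = ord0 by apply: val_inj.
  by move=> aE; apply: (mulfI a_neq0); rewrite mulr1.
set r := ursubmx N; set c := dlsubmx N; set M := drsubmx N.
have [U [U' [V [V' [d [UU' VV' ME d_le]]]]]] := IH (a *: map_mx i (M - c *m r)).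
have NB : N = block_mx 1%:M r c M by rewrite -N00 submxK.
pose T1 : 'M[O]_(1 + n) := tperm_mx ord0 p; pose T2 : 'M[O]_(1 + n) := tperm_mx ord0 q.
have TT k : tperm_mx ord0 k *m tperm_mx ord0 k = 1%:M :> 'M[O]_(1 + n).
  by rewrite /tperm_mx -perm_mxM tperm2 perm_mx1.
exists (T1 *m block_mx 1%:M 0 c U), (block_mx 1%:M 0 (- U' *m c) U' *m T1),
  (block_mx 1%:M r 0 V *m T2), (T2 *m block_mx 1%:M (- r *m V') 0 V'), (row_mx a%:M d).
have TTK k : map_mx i (tperm_mx ord0 k) *m map_mx i (tperm_mx ord0 k) = 1%:M :> 'M[K]_(1 + n).
  by rewrite -map_mxM TT map_mx1.
split.
- rewrite mulmxA -(mulmxA T1).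
  have -> : block_mx 1%:M 0 c U *m block_mx 1%:M 0 (- U' *m c) U' = 1%:M :> 'M[O]_(1 + n).
    rewrite mulmx_block !(mul1mx, mul0mx, mulmx0, mulmx1, addr0, add0r) UU'.
    by rewrite mulmxA mulmxN UU' mulNmx mul1mx subrr -scalar_mx_block.
  by rewrite mulmx1 TT.
- have TT2 : T2 *m T2 = 1%:M by apply: TT.
  rewrite -mulmxA (mulmxA T2) TT2 mul1mx.
  suff -> : block_mx 1%:M r 0 V *m block_mx 1%:M (- r *m V') 0 V' = 1%:M :> 'M[O]_(1 + n) by [].
  rewrite mulmx_block !(mul1mx, mul0mx, mulmx0, mulmx1, addr0, add0r) VV'.
  by rewrite mulNmx addNr -scalar_mx_block.
- have AE : A = map_mx i T1 *m (a *: map_mx i N) *m map_mx i T2.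
    rewrite -NE xrowE xcolE.
    have TE k : map_mx i (tperm_mx ord0 k) = tperm_mx ord0 k :> 'M[K]_(1 + n).
      by rewrite /tperm_mx map_perm_mx.
    rewrite -(TE p) -(TE q) -/T1 -/T2.
    have TT1 : map_mx i T1 *m map_mx i T1 = 1%:M by apply: TTK.
    have TT2 : map_mx i T2 *m map_mx i T2 = 1%:M by apply: TTK.
    by rewrite !mulmxA TT1 mul1mx -mulmxA TT2 mulmx1.
  rewrite AE !map_mxM -!mulmxA; congr (_ *m _); rewrite !mulmxA; congr (_ *m _).
  rewrite NB diag_mx_row.
  rewrite !(@map_block_mx _ _ i 1 n 1 n) !raddf0 !map_mx1 !mulmx_block !(mul1mx, mul0mx, mulmx0, mulmx1, addr0, add0r).
  have -> : diag_mx a%:M = a%:M :> 'M[K]_1.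
    by apply/matrixP => k l; rewrite !ord1 !mxE eqxx.
  rewrite scale_block_mx mul_scalar_mx mul_mx_scalar scalemx1; congr (block_mx _ _ _ _).
  move: ME; rewrite map_mxB map_mxM scalerBr => /eqP; rewrite subr_eq => /eqP->.
  by rewrite -scalemxAl addrC.
- have a_d l : vdvd a (d 0 l).
    have dE : diag_mx d = map_mx i U' *m (a *: map_mx i (M - c *m r)) *m map_mx i V'.
      rewrite ME !mulmxA -map_mxM (mulmx1C UU') map_mx1 mul1mx.
      by rewrite -mulmxA -map_mxM VV' map_mx1 mulmx1.
    exists ((U' *m (M - c *m r) *m V') l l).
    have /matrixP/(_ l l) := dE; rewrite -scalemxAr -scalemxAl -!map_mxM !mxE eqxx mulr1n.
    by move=> ->.
  move=> k l; rewrite !mxE; case: splitP => k'; case: splitP => l'; rewrite ?ord1 ?mxE /=.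
  + by move=> _ _ _; apply: vdvd_refl.
  + by move=> _ _ _; rewrite ?eqxx mulr1n.
  + by move=> -> ->; rewrite leqn0.
  + by move=> -> ->; rewrite leq_add2l => /d_le.
Qed.

End ValuationSmith.

(** * Integral weights and characters *)

Section OrderedInsertion.

Lemma rat_between (lo up : seq rat) : (forall a b, a \in lo -> b \in up -> a < b) ->
  exists rho, (forall a, a \in lo -> a < rho) /\ (forall b, b \in up -> rho < b).
Proof.
have above (a : rat) (s : seq rat) : (forall b, b \in s -> a < b) ->
    exists2 rho, a < rho & forall b, b \in s -> rho < b.
  elim: s => [|b s IH] lt_as; first by exists (a + 1) => //; lra.
  have [|rho a_rho rho_s] := IH; first by move=> c cs; apply: lt_as; rewrite inE cs orbT.
  have ab : a < b by apply: lt_as; rewrite inE eqxx.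
  exists (Num.min rho ((a + b) / 2)); first by rewrite lt_min a_rho; lra.
  move=> c; rewrite inE gt_min => /predU1P[->|/rho_s->//].
  by apply/orP; right; lra.
elim: lo => [|a lo IH] lt_lu.
  have [rho _ rho_up] : exists2 rho : rat, True & forall b, b \in up -> rho < b.
    elim: up {lt_lu} => [|b s [rho _ rho_s]]; first by exists 0.
    exists (Num.min rho (b - 1)) => // c; rewrite inE gt_min => /predU1P[->|/rho_s->//].
    by apply/orP; right; lra.
  by exists rho.
have [b c blo cup|rho [lo_rho rho_up]] := IH; first by apply: lt_lu; rewrite ?inE ?blo ?orbT.
have [a_rho|rho_a] := ltP a rho.
  by exists rho; split=> // b; rewrite inE => /predU1P[->|/lo_rho].
have [b bup|rho' a_rho' rho'_up] := above a up; first by apply: lt_lu; rewrite ?inE ?eqxx.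
exists rho'; split=> // b; rewrite inE => /predU1P[->//|/lo_rho].
by move=> /lt_trans; apply; apply: le_lt_trans a_rho'.
Qed.

(** P and Q behave as the two sides of a cut. An element on both sides forces rho to be its value;
    otherwise rho is chosen strictly between the two finite sets of values. *)
Lemma rat_insertion (T : eqType) (s : seq T) (r : T -> rat) (P Q : T -> Prop) :
  (forall e, P e \/ Q e) ->
  (forall e1 e2, e1 \in s -> e2 \in s -> P e1 -> Q e2 ->
     r e1 <= r e2 /\ (r e1 = r e2 -> Q e1 /\ P e2)) ->
  exists rho, forall e, e \in s -> (P e <-> r e <= rho) /\ (Q e <-> rho <= r e).
Proof.
move=> PQ key.
have [[e0 [e0s [P0 Q0]]]|noPQ] := pselect (exists e, e \in s /\ (P e /\ Q e)).
  exists (r e0) => e es; split; split.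
  - by move=> Pe; have [] := key e e0 es e0s Pe Q0.
  - move=> le_re; have [//|Qe] := PQ e; have [le_er /(_ _)[]//] := key e0 e e0s es P0 Qe.
    by apply/le_anti; rewrite le_er le_re.
  - by move=> Qe; have [] := key e0 e e0s es P0 Qe.
  - move=> le_re; have [Pe|//] := PQ e; have [le_er /(_ _)[]//] := key e e0 es e0s Pe Q0.
    by apply/le_anti; rewrite le_er le_re.
pose lo := [seq r e | e <- s & `[< P e >]]; pose up := [seq r e | e <- s & `[< Q e >]].
have [a b|rho [lo_rho rho_up]] := @rat_between lo up.
  move=> /mapP[e1 + ->] /mapP[e2 + ->].
  rewrite !mem_filter => /andP[/asboolP P1 s1] /andP[/asboolP Q2 s2].
  have [le12 eq12] := key e1 e2 s1 s2 P1 Q2; rewrite lt_neqAle le12 andbT.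
  by apply/eqP => /eq12[Q1 _]; apply: noPQ; exists e1.
exists rho => e es.
have Plt : P e -> r e < rho.
  by move=> Pe; apply: lo_rho; apply/mapP; exists e; rewrite // mem_filter es andbT; apply/asboolP.
have Qlt : Q e -> rho < r e.
  by move=> Qe; apply: rho_up; apply/mapP; exists e; rewrite // mem_filter es andbT; apply/asboolP.
split; split.
- by move=> /Plt/ltW.
- by move=> le; have [//|/Qlt] := PQ e; rewrite ltNge le.
- by move=> /Qlt/ltW.
- by move=> le; have [/Plt|//] := PQ e; rewrite ltNge le.
Qed.

End OrderedInsertion.

(* By Fourier-Motzkin elimination of the first coordinate. *)
Lemma integral_weight n (N : 'rV[int]_n -> Prop) (s : seq 'rV[int]_n) :
  (forall a b, N a -> N b -> N (a + b)) -> (forall a, N a \/ N (- a)) ->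
  (forall k a, N (a *+ k.+1) -> N a) ->
  exists z : 'cV[int]_n, forall e, e \in s ->
    (N e <-> 0 <= (e *m z) 0 0) /\ (N (- e) <-> (e *m z) 0 0 <= 0).
Proof.
elim: n N s => [|n IH]; last rewrite -[n.+1]/(1 + n)%N.
  move=> N s ND Ntot NV; have N0 : N 0 by have [//|] := Ntot 0; rewrite oppr0.
  exists 0 => e _; rewrite (thinmx0 e) oppr0 mulmx0 mxE lexx.
  by split; split.
move=> N s ND Ntot NV; have NMn a k : N a -> N (a *+ k).
  move=> Na; elim: k => [|k IHk]; last by rewrite mulrS; apply: ND.
  by have [//|] := Ntot 0; rewrite oppr0.
pose hd (e : 'rV[int]_(1 + n)) : int := e 0 0.
pose tl (e : 'rV[int]_(1 + n)) : 'rV[int]_n := rsubmx e.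
have eE (e : 'rV[int]_(1 + n)) : e = row_mx (hd e)%:M (tl e).
  rewrite -[LHS]hsubmxK; congr row_mx; apply/matrixP => k l; rewrite !ord1 !mxE eqxx mulr1n.
  by rewrite /hd; congr (e _ _); apply: val_inj.
(* Up to sign, each vector with nonzero head has positive head; [comb] cancels the heads of two such
   vectors. *)
pose sp := [seq e <- s ++ [seq - e | e <- s] | hd e > 0].
pose comb e1 e2 := hd e1 *: tl e2 - hd e2 *: tl e1.
pose s' := [seq tl e | e <- s] ++ [seq comb e1 e2 | e1 <- sp, e2 <- sp].
pose N' (u : 'rV[int]_n) := N (row_mx (0 : 'rV_1) u).
have [|||z' z'P] := IH N' s'.
- by move=> a b Na Nb; rewrite /N' -[0]addr0 -add_row_mx; apply: ND.
- by move=> a; have := Ntot (row_mx 0 a); rewrite opp_row_mx oppr0.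
- move=> k a; rewrite /N' => Na; apply: (NV k).
  suff <- : row_mx 0 (a *+ k.+1) = (row_mx 0 a) *+ k.+1 :> 'rV[int]_(1 + n) by [].
  by rewrite -[RHS]scaler_nat scale_row_mx scaler0 scaler_nat.
have hd_sp e : e \in sp -> 0 < hd e by rewrite mem_filter => /andP[].
pose ev (u : 'rV[int]_n) : int := (u *m z') 0 0.
(* The value of the first weight at which the total weight of e changes sign. [rat_insertion] gives
   -e the place of the upper side, hence the choice of N (- e) as Q. *)
pose r (e : 'rV[int]_(1 + n)) : rat := - (ev (tl e))%:~R / (hd e)%:~R.
have [e|e1 e2 s1 s2 N1 N2|rho rhoP] :=
  @rat_insertion _ sp r N (fun e => N (- e)); first exact: Ntot.
  have h1 := hd_sp _ s1; have h2 := hd_sp _ s2.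
  have NZ k e : 0 < k -> (N e <-> N (k *: e)).
    case: k => // -[//|k] _; rewrite -[Posz k.+1]natz scaler_nat; split; first exact: NMn.
    exact: NV.
  have cE : hd e1 *: e2 - hd e2 *: e1 = row_mx 0 (comb e1 e2).
    have E1 := eE e1; have E2 := eE e2; rewrite /comb.
    set a1 := hd e1 in E1 *; set a2 := hd e2 in E2 *.
    rewrite [in LHS]E1 [in LHS]E2 !scale_row_mx opp_row_mx add_row_mx.
    congr row_mx; apply/matrixP => k l; rewrite !ord1 !mxE eqxx !mulr1n mulrC subrr //.
  have s'c : comb e1 e2 \in s'.
    by rewrite mem_cat; apply/orP; right; apply: allpairs_f.
  have [Ncp Ncn] := z'P _ s'c.
  have evc : ev (comb e1 e2) = hd e1 * ev (tl e2) - hd e2 * ev (tl e1).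
    by rewrite /ev mulmxBl -!scalemxAl !mxE.
  have r12 : (r e1 <= r e2) = (ev (comb e1 e2) <= 0).
    rewrite /r ler_pdivlMr ?ltr0z // mulrAC ler_pdivrMr ?ltr0z // -!rmorphN -!rmorphM ler_int.
    by rewrite evc; lia.
  have r21 : (r e2 <= r e1) = (0 <= ev (comb e1 e2)).
    rewrite /r ler_pdivlMr ?ltr0z // mulrAC ler_pdivrMr ?ltr0z // -!rmorphN -!rmorphM ler_int.
    by rewrite evc; lia.
  split.
    rewrite r12; apply/Ncn; rewrite /N' -[0]oppr0 -opp_row_mx -cE opprB.
    rewrite -scalerN; apply: ND; [exact: (proj1 (NZ _ _ h2) N1)|exact: (proj1 (NZ _ _ h1) N2)].
  move=> req; have {}Ncp : N (hd e1 *: e2 - hd e2 *: e1).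
    by rewrite cE; apply/Ncp; rewrite -r21 req.
  split.
    apply: (proj2 (NZ _ _ h2)); rewrite scalerN.
    have -> : - (hd e2 *: e1) = hd e1 *: e2 - hd e2 *: e1 + hd e1 *: - e2.
      by rewrite scalerN addrAC subrr add0r.
    by apply: ND => //; exact: (proj1 (NZ _ _ h1) N2).
  apply: (proj2 (NZ _ _ h1)).
  rewrite -(subrK (hd e2 *: e1) (hd e1 *: e2)).
  by apply: ND => //; exact: (proj1 (NZ _ _ h2) N1).
(* The rational weight (rho, z') multiplied by the denominator of rho. *)
exists (col_mx (numq rho)%:M (denq rho *: z')).
have evz (e : 'rV[int]_(1 + n)) :
    (e *m col_mx (numq rho)%:M (denq rho *: z')) 0 0 = hd e * numq rho + denq rho * ev (tl e).
  rewrite [in LHS](eE e) mul_row_col -scalemxAr mul_mx_scalar /ev !mxE eqxx mulr1n.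
  by rewrite mulrC.
have pos e : e \in sp -> (N e <-> 0 <= hd e * numq rho + denq rho * ev (tl e)) /\
    (N (- e) <-> hd e * numq rho + denq rho * ev (tl e) <= 0).
  move=> es; have h := hd_sp _ es; have [NP NQ] := rhoP _ es.
  have rhoE : rho = (numq rho)%:~R / (denq rho)%:~R by rewrite divq_num_den.
  have d0 := denq_gt0 rho.
  have -> : (0 <= hd e * numq rho + denq rho * ev (tl e)) = (r e <= rho).
    rewrite [in RHS]rhoE /r ler_pdivlMr ?ltr0z // mulrAC ler_pdivrMr ?ltr0z //.
    by rewrite -!rmorphN -!rmorphM ler_int; lia.
  have -> : (hd e * numq rho + denq rho * ev (tl e) <= 0) = (rho <= r e).
    rewrite [in RHS]rhoE /r ler_pdivlMr ?ltr0z // mulrAC ler_pdivrMr ?ltr0z //.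
    by rewrite -!rmorphN -!rmorphM ler_int; lia.
  by [].
move=> e es; rewrite evz; have [h|h|h] := ltrgtP (hd e) 0.
- have [|NP NQ] := pos (- e).
    rewrite mem_filter mem_cat map_f // orbT andbT.
    by rewrite /hd mxE oppr_gt0.
  have E : hd (- e) * numq rho + denq rho * ev (tl (- e)) =
      - (hd e * numq rho + denq rho * ev (tl e)).
    by rewrite /hd /tl /ev linearN mulNmx !mxE; ring.
  by rewrite E oppr_ge0 oppr_le0 opprK in NP NQ.
- by apply: pos; rewrite mem_filter h mem_cat es.
- have [NP NQ] : (N' (tl e) <-> 0 <= ev (tl e)) /\ (N' (- tl e) <-> ev (tl e) <= 0).
    by apply: z'P; rewrite mem_cat map_f.
  have d0 := denq_gt0 rho; rewrite h mul0r add0r pmulr_rge0 // pmulr_rle0 //.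
  have E : e = row_mx 0 (tl e).
    by rewrite [LHS]eE h; congr row_mx; apply/matrixP => k l; rewrite !mxE mul0rn.
  have -> : N e = N' (tl e) by rewrite [in LHS]E.
  have -> : N (- e) = N' (- tl e) by rewrite [in LHS]E opp_row_mx oppr0.
  by [].
Qed.

Section Monomials.
Variable F : fieldType.

Definition zmono n (t : 'rV[F]_n) (a : 'rV[int]_n) : F := \prod_i t 0 i ^ a 0 i.

Lemma zmono_neq0 n (t : 'rV[F]_n) a : (forall i, t 0 i != 0) -> zmono t a != 0.
Proof. by move=> t0; apply/prodf_neq0 => i _; apply: expfz_neq0. Qed.

Lemma zmonoD n (t : 'rV[F]_n) a b : (forall i, t 0 i != 0) ->
  zmono t (a + b) = zmono t a * zmono t b.
Proof.
by move=> t0; rewrite -big_split; apply: eq_bigr => i _; rewrite mxE expfzDr.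
Qed.

Lemma zmono0 n (t : 'rV[F]_n) : zmono t 0 = 1.
Proof. by rewrite /zmono big1 // => i _; rewrite mxE expr0z. Qed.

Lemma zmonoZ n (t : 'rV[F]_n) a k : zmono t (k *: a) = zmono t a ^ k.
Proof.
rewrite /zmono; elim/big_rec2: _ => [|i x y _ ->]; first by rewrite exp1rz.
by rewrite mxE [k * _]mulrC -exprz_exp expfzMl.
Qed.

Lemma zmonoN n (t : 'rV[F]_n) a : zmono t (- a) = (zmono t a)^-1.
Proof. by rewrite -scaleN1r zmonoZ exprN1. Qed.

Lemma zmono_row m n (t1 : 'rV[F]_m) (t2 : 'rV[F]_n) a1 a2 :
  zmono (row_mx t1 t2) (row_mx a1 a2) = zmono t1 a1 * zmono t2 a2.
Proof.
rewrite /zmono big_split_ord /=; congr (_ * _); apply: eq_bigr => i _.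
  by rewrite !row_mxEl.
by rewrite !row_mxEr.
Qed.

End Monomials.

(** E is the graph of a character of a subgroup of Z^n. It extends to Z^n because the multiplicative
    group of L is divisible; the extension is made one coordinate at a time. *)
Lemma character_extension (L : numClosedFieldType) n (E : 'rV[int]_n -> L -> Prop) :
  (forall a b x y, E a x -> E b y -> E (a - b) (x / y)) ->
  (forall a x, E a x -> x != 0) -> (forall x, E 0 x -> x = 1) ->
  exists t : 'rV[L]_n, (forall i, t 0 i != 0) /\ forall a x, E a x -> x = zmono t a.
Proof.
elim: n E => [|n IH]; last rewrite -[n.+1]/(1 + n)%N.
  move=> E EB En0 E0; exists 0; split=> [[]//|a x]; rewrite (thinmx0 a) => /E0->.
  by rewrite zmono0.
move=> E EB En0 E0; pose hd (e : 'rV[int]_(1 + n)) : int := e 0 0.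
pose tl (e : 'rV[int]_(1 + n)) : 'rV[int]_n := rsubmx e.
have eE (e : 'rV[int]_(1 + n)) : e = row_mx (hd e)%:M (tl e).
  rewrite -[LHS]hsubmxK; congr row_mx; apply/matrixP => k l; rewrite !ord1 !mxE eqxx mulr1n.
  by rewrite /hd; congr (e _ _); apply: val_inj.
have [a b x y Ea Eb|a x /En0//|x|t' [t'0 t'P]] := IH (fun a x => E (row_mx (0 : 'rV_1) a) x).
- by rewrite -[0]subr0 -add_row_mx -opp_row_mx; apply: EB.
- by rewrite row_mx0 => /E0.
have mono1 (u : L) k : zmono (u%:M : 'rV_1) (k%:M) = u ^ k.
  by rewrite /zmono big_ord1 !mxE eqxx !mulr1n.
have row0 (e : 'rV[int]_(1 + n)) : hd e = 0 -> e = row_mx 0 (tl e).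
  by move=> h; rewrite [LHS]eE h; congr row_mx; apply/matrixP => k l; rewrite !mxE mul0rn.
have t_neq0 u : u != 0 -> forall i, (row_mx (u%:M : 'rV_1) t' : 'rV[L]_(1 + n)) 0 i != 0.
  move=> u0 i; rewrite mxE; case: splitP => j _; rewrite ?ord1 ?mxE ?eqxx ?mulr1n //.
have [[a1 [x1 [E1 h1]]]|allh0] := pselect (exists a x, E a x /\ hd a != 0); last first.
  exists (row_mx 1%:M t'); split; first exact: t_neq0 (oner_neq0 _).
  move=> a x Eax; have h : hd a = 0.
    by apply/eqP; apply: contra_notT allh0 => h; exists a, x.
  rewrite [a]eE zmono_row mono1 exp1rz mul1r; apply: t'P.
  by rewrite -row0.
have E01 : E 0 1 by have := EB _ _ _ _ E1 E1; rewrite subrr divff ?(En0 _ _ E1).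
have EN a x : E a x -> E (- a) x^-1.
  by move=> Eax; have := EB _ _ _ _ E01 Eax; rewrite sub0r div1r.
have ED a b x y : E a x -> E b y -> E (a + b) (x * y).
  by move=> Ea Eb; have := EB _ _ _ _ Ea (EN _ _ Eb); rewrite opprK invrK.
have EMn a x k : E a x -> E (a *+ k) (x ^+ k).
  by move=> Ea; elim: k => [//|k IHk]; rewrite mulrS exprS; apply: ED.
have EZ a x k : E a x -> E (k *: a) (x ^ k).
  move=> Ea; case: k => k; first by rewrite -[Posz k]natz scaler_nat natz; apply: EMn.
  rewrite NegzE scaleNr -exprnN; apply: EN.
  by rewrite -[Posz k.+1]natz scaler_nat; apply: EMn.
(* The heads occurring in E form a subgroup of Z; its least positive element k generates it. *)
pose hasn k := `[< (0 < k)%N /\ exists a x, E a x /\ hd a = k >].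
have ex_k : exists k, hasn k.
  exists `|hd a1|%N; apply/asboolP; split; first by rewrite absz_gt0.
  have [h|h] := leP 0 (hd a1); first by exists a1, x1; rewrite gez0_abs.
  exists (- a1), x1^-1; split; first exact: EN.
  by rewrite /hd mxE ltz0_abs.
case: (ex_minnP ex_k) => k /asboolP[k_gt0 [a0 [x0 [Ea0 hk]]]] min_k.
(* The first coordinate u has to satisfy u^k = y for the value at a0 to come out right. *)
pose y := x0 / zmono t' (tl a0).
have y0 : y != 0 by rewrite mulf_neq0 ?invr_eq0 ?zmono_neq0 // (En0 _ _ Ea0).
pose u := k.-root y.
have u0 : u != 0 by rewrite rootC_eq0.
have uk : u ^+ k = y by rewrite rootCK.
exists (row_mx u%:M t'); split; first exact: t_neq0.
move=> a x Ea; pose q := (hd a %/ k)%Z.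
have Eb := EB _ _ _ _ Ea (EZ _ _ q Ea0); set b := a - _ in Eb.
have hb : hd b = (hd a %% k)%Z.
  by rewrite /b /hd !mxE -/(hd a) -/(hd a0) hk /q {1}(divz_eq (hd a) k); ring.
have hb0 : hd b = 0.
  rewrite hb; have k0 : (k : int) != 0 by rewrite -lt0n.
  have := modz_ge0 (hd a) k0; have := ltz_mod (hd a) k0.
  case: (hd a %% k)%Z hb => // r hbr lt_rk _; have [->//|r0] := eqVneq r 0%N.
  suff : (k <= r)%N by move: lt_rk; rewrite ltz_nat; lia.
  by apply: min_k; apply/asboolP; split; [rewrite lt0n | exists b, (x / x0 ^ q)].
have := t'P (tl b) (x / x0 ^ q); rewrite -row0 // => /(_ Eb) xE.
have x00 := En0 _ _ Ea0.
have -> : x = zmono t' (tl b) * x0 ^ q by rewrite -xE divfK // expfz_neq0.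
have -> : tl b = tl a - q *: tl a0 by rewrite /tl /b linearB linearZ.
rewrite zmonoD // zmonoN zmonoZ [in RHS](eE a) zmono_row mono1.
have -> : hd a = k%:Z * q by rewrite mulrC (divz_eq (hd a) k) -hb hb0 addr0.
rewrite -exprz_exp -exprnP uk /y expfzMl exprz_inv -invr_expz.
by rewrite mulrC mulrCA mulrC; ring.
Qed.

(** * The moment map and limits along a place *)

Definition mrow n (m : 'X_{1..n}) : 'rV[int]_n := \row_i (m i)%:Z.
Definition mwt n (z : 'cV[int]_n) (m : 'X_{1..n}) : int := (mrow m *m z) 0 0.

Lemma mwtE n (z : 'cV[int]_n) m : mwt z m = \sum_i (m i)%:Z * z i 0.
Proof. by rewrite /mwt mxE; apply: eq_bigr => i _; rewrite mxE. Qed.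

Lemma mwtD n (z : 'cV[int]_n) m m' : mwt z (m + m') = mwt z m + mwt z m'.
Proof. by rewrite !mwtE -big_split; apply: eq_bigr => i _; rewrite mnmDE PoszD mulrDl. Qed.

Lemma mwtU n (z : 'cV[int]_n) i : mwt z U_(i) = z i 0.
Proof.
rewrite mwtE (bigD1 i) //= mnm1E eqxx mul1r big1 ?addr0 // => j ji.
by rewrite mnm1E eq_sym (negPf ji) mul0r.
Qed.

Lemma zmono_mrow (F : fieldType) n (t : 'rV[F]_n) m : zmono t (mrow m) = \prod_i t 0 i ^+ m i.
Proof. by apply: eq_bigr => i _; rewrite mxE. Qed.

Lemma lsub_diag_mx (A : comNzRingType) n (d : 'rV[A]_n) p m :
  (lsub (diag_mx d) p)@_m = (\prod_i d 0 i ^+ m i) * p@_m.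
Proof.
rewrite -lsub_diag; congr ((lsub _ _)@__).
by apply/matrixP => i j; rewrite !mxE.
Qed.

Lemma mcoeff_mulX_deriv (A : comNzRingType) n (p : {mpoly A[n]}) i m :
  ('X_i * p^`M(i))@_m = p@_m *+ m i.
Proof.
rewrite [p]mpolyE (raddf_sum (mderiv i)) mulr_sumr !(raddf_sum (mcoeff m)) /= -sumrMnl.
apply: eq_bigr => m' _; rewrite mderivZ mderivX -!scalerAr !mcoeffZ mcoeffX.
have [mi0|mi_neq0] := eqVneq (m' i) 0%N.
  rewrite mi0 mul0r mulr0; have [<-|] := eqVneq m' m; first by rewrite mi0.
  by rewrite mulr0 mul0rn.
rewrite -mpolyXD addmC submK ?lep1mP // mcoeffX.
by have [<-|] := eqVneq m' m; rewrite ?mulr0 ?mul0rn // !mulr1 mulr_natr.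
Qed.

Section Critical.
Variables (C : numClosedFieldType) (n : nat).
Implicit Types (f : {mpoly C[n]}).

Definition moment f i j : C := apo f^`M(i) (map_mpoly Num.conj f^`M(j)).

(* The vanishing of the moment map of SU(n) at f. *)
Definition critical f := exists s, forall i j, moment f i j = s *+ (i == j).

(** The apolar Hermitian product is unitarily invariant, so the moment matrix is conjugated by U,
    and a scalar matrix is fixed by conjugation. *)
Lemma critical_unitary f (U : 'M[C]_n) : U \is unitarymx -> critical f -> critical (lsub U f).
Proof.
move=> /unitarymxP UU [s sP]; exists s => i j.
have UU' : U^T *m map_mx Num.conj U = 1%:M.
  have /(congr1 trmx) := mulmx1C UU; rewrite trmx_mul trmx1 map_trmx trmxK.
  by [].
rewrite /moment !mderiv_lsub (raddf_sum (map_mpoly _)) apo_suml.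
have -> : (s *+ (i == j)) = \sum_k U i k * (U j k)^* * s.
  have /matrixP/(_ i j) := UU; rewrite !mxE -mulr_suml => E.
  rewrite -[s *+ _]mulr_natl -E; congr (_ * _); apply: eq_bigr => k _.
  by rewrite !mxE.
apply: eq_bigr => k _; rewrite apoZl apo_sumr -mulrA; congr (_ * _).
rewrite (bigD1 k) //= map_mpolyZ map_lsub apoZr apo_lsub lsubM UU' lsub1.
rewrite -/(moment f k k) sP eqxx big1 ?addr0 // => l lk.
rewrite map_mpolyZ map_lsub apoZr apo_lsub lsubM UU' lsub1.
by rewrite -/(moment f k l) sP eq_sym (negPf lk) mulr0.
Qed.

(** The trace of diag(z) times the moment matrix is 0. By adjunction it is the sum over m of the
    weight of m times m! |f_m|^2, whose terms are all nonnegative, so each of them vanishes. *)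
Lemma critical_weight0 f (z : 'cV[int]_n) : critical f -> \sum_i z i 0 = 0 ->
  (forall m, f@_m != 0 -> 0 <= mwt z m) -> forall m, f@_m != 0 -> mwt z m = 0.
Proof.
move=> [s sP] z0 wt_ge0 m fm.
pose k := maxn (\max_i msize ('X_i * f^`M(i))) (mdeg m).+1.
have E : \sum_(m : 'X_{1..n < k}) (mwt z m)%:~R * (`|f@_m| ^+ 2 *+ mfact m) = 0 :> C.
  transitivity (\sum_i (z i 0)%:~R * moment f i i : C); last first.
    under eq_bigr do rewrite sP eqxx mulr1n.
    by rewrite -mulr_suml -rmorph_sum z0 rmorph0 mul0r.
  under [in RHS]eq_bigr => i _.
    rewrite /moment -mderiv_map -apo_mulX (@apowE _ _ _ _ k); last first.
      by rewrite leq_max (@leq_bigmax _ (fun i => msize ('X_i * f^`M(i)))).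
    rewrite mulr_sumr.
    over.
  rewrite exchange_big /=; apply: eq_bigr => m' _.
  rewrite mwtE rmorph_sum mulr_suml; apply: eq_bigr => i _.
  rewrite mcoeff_mulX_deriv mcoeff_map_mpoly normCK rmorphM /= -[f@__ *+ _]mulr_natl.
  by rewrite -!mulrnAr -!mulrA mulrCA.
have ltmk : (mdeg m < k)%N by rewrite leq_max leqnn orbT.
have T_ge0 (m' : 'X_{1..n < k}) : true -> 0 <= (mwt z m')%:~R * (`|f@_m'| ^+ 2 *+ mfact m') :> C.
  move=> _; have [->|fm'] := eqVneq f@_m' 0; first by rewrite normr0 expr0n mul0rn mulr0.
  by rewrite mulr_ge0 ?ler0z ?wt_ge0 // mulrn_wge0 // exprn_ge0.
have := psumr_eq0P T_ge0 E (i := BMultinom ltmk) isT.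
move/eqP; rewrite mulf_eq0 intr_eq0 => /orP[/eqP//|].
rewrite /= mulrn_eq0 expf_eq0 normr_eq0 (negPf fm) orbF.
rewrite /mfact; have : (0 < \prod_(i < n) (m i)`!)%N by rewrite prodn_gt0 // => i; exact: fact_gt0.
by case: (\prod_(i < n) _)%N.
Qed.

End Critical.

Section GenericMatrix.
Variable n : nat.
Local Notation NN := #|{: 'I_n * 'I_n}|.

Definition genmx (A : comNzRingType) : 'M[{mpoly A[NN]}]_n :=
  \matrix_(i, j) 'X_(enum_rank (i, j)).

Definition gen_act (A : comNzRingType) (f : {mpoly A[n]}) : {mpoly {mpoly A[NN]}[n]} :=
  lsub (genmx A) (map_mpoly (@mpolyC NN A) f).

End GenericMatrix.

Section Valuative.
Variables (K : fieldType) (C : numClosedFieldType) (O : comNzRingType).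
Variables (i : {rmorphism O -> K}) (phi : {rmorphism O -> C}) (j : {rmorphism C -> O}).
Hypothesis inj_i : injective i.
Hypothesis phij : forall c, phi (j c) = c.
Hypothesis unit_i : forall o, phi o != 0 -> exists o', o * o' = 1.
Hypothesis total_i : forall x, (exists o, i o = x) \/ (x != 0 /\ exists o, i o = x^-1).

(** A valuation ring is integrally closed: if 1/x lies in O, then x is x^(k+1) times the k-th power
    of 1/x. *)
Lemma valuation_root x k : (exists o, i o = x ^+ k.+1) -> exists o, i o = x.
Proof.
move=> [o oE]; have [//|[x0 [o' o'E]]] := total_i x.
exists (o * o' ^+ k); rewrite rmorphM rmorphXn o'E oE exprVn exprS mulfK //.
by rewrite expf_neq0.
Qed.

(* The Cartan decomposition, with the right-hand factor adjusted by the
   Iwasawa decomposition of its reduction. *)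
Lemma valuation_cartan n (A : 'M[K]_n) : \det A != 0 ->
  exists (U U' V V' : 'M[O]_n) (d : 'rV[K]_n),
  [/\ U *m U' = 1%:M, V *m V' = 1%:M,
      A = map_mx i U *m diag_mx d *m map_mx i V, (forall k, d 0 k != 0) &
      map_mx phi V \is unitarymx].
Proof.
move=> detA; have [U [U' [V [V' [d [UU' VV' AE d_le]]]]]] := valuation_smith inj_i total_i A.
have d0 k : d 0 k != 0.
  apply: contraNneq detA => dk; rewrite AE !det_mulmx det_diag (bigD1 k) //= dk.
  by rewrite mul0r mulr0 mul0r.
pose B := map_mx phi V; pose B' := map_mx phi V'.
have BB' : B *m B' = 1%:M by rewrite -map_mxM VV' map_mx1.
(* Gram-Schmidt on the rows writes the reduction B as p k with p lower triangular and k unitary; p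
   is to be moved across the diagonal factor. *)
pose k := schmidt B.
have ku : k \is unitarymx by apply: schmidt_unitarymx.
pose p := B *m k^t*%sesqui; pose p' := k *m B'.
have pk : p *m k = B by rewrite mulmxKtV.
have pp' : p *m p' = 1%:M by rewrite mulmxA pk.
have p_trig (a b : 'I_n) : (a < b)%N -> p a b = 0.
  move=> ltab.
  have sub : (row a B <= kermx (col b (k^t*)%sesqui))%MS.
    apply: submx_trans (row_schmidt_sub B a) _; apply/sumsmx_subP => c le_ca.
    rewrite genmxE; apply/sub_kermxP; apply/matrixP => x y; rewrite !ord1.
    have /unitarymxP/matrixP/(_ c b) := ku; rewrite !mxE.
    rewrite (_ : (c == b) = false); last by apply/eqP => cb; move: le_ca; rewrite cb leqNgt ltab.
    by move=> E; rewrite -[RHS]E; apply: eq_bigr => l _; rewrite !mxE.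
  have /matrixP/(_ 0 0) := sub_kermxP sub; rewrite !mxE => E; rewrite -[RHS]E.
  by apply: eq_bigr => l _; rewrite !mxE.
pose W := map_mx j p; pose W' := map_mx j p'.
have WW' : W *m W' = 1%:M by rewrite -map_mxM pp' map_mx1.
(* The entry of E at (a, b) is W a b d_a / d_b. It is integral: for b <= a the diagonal entry d_b
   divides d_a, and above the diagonal W vanishes. *)
have [E EE] : exists E : 'M[O]_n, map_mx i E *m diag_mx d = diag_mx d *m map_mx i W.
  have /choice[F FE] : forall u : 'I_n * 'I_n, exists o, i o * d 0 u.2 = d 0 u.1 * i (W u.1 u.2).
    move=> [a b] /=; have [leba|ltab] := leqP b a.
      have [o ->] := d_le _ _ leba; exists (o * W a b).
      by rewrite rmorphM; ring.
    have Wab : W a b = 0 by rewrite mxE p_trig // rmorph0.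
    by exists 0; rewrite Wab rmorph0 mul0r mulr0.
  exists (\matrix_(a, b) F (a, b)); apply/matrixP => a b.
  transitivity (i (F (a, b)) * d 0 b); first by rewrite mul_mx_diag !mxE.
  by rewrite (FE (a, b)) mul_diag_mx mxE; congr (_ * _); rewrite [RHS]mxE.
pose E' := \det W' *: \adj E.
have detE : \det E = \det W.
  apply: inj_i; rewrite -!det_map_mx.
  have /(congr1 determinant) := EE; rewrite !det_mulmx [RHS]mulrC => /mulIf; apply.
  by rewrite det_diag; apply/prodf_neq0 => a _.
have EE' : E *m E' = 1%:M.
  rewrite -scalemxAr mul_mx_adj detE scale_scalar_mx mulrC -det_mulmx WW' det1.
  by [].
exists (U *m E), (E' *m U'), (W' *m V), (V' *m W), d; split=> //.
- by rewrite mulmxA -(mulmxA U) EE' mulmx1.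
- by rewrite mulmxA -(mulmxA W') VV' mulmx1 (mulmx1C WW').
- rewrite AE !map_mxM -!mulmxA; congr (_ *m _); rewrite !mulmxA EE.
  by rewrite -!mulmxA; congr (_ *m _); rewrite mulmxA -map_mxM WW' map_mx1 mul1mx.
- rewrite map_mxM -map_mx_comp (_ : map_mx (phi \o j) p' = p').
    by rewrite -mulmxA (mulmx1C BB') mulmx1.
  by apply/matrixP => a b; rewrite !mxE /= phij.
Qed.

(** By the Cartan decomposition the coefficients of U' G are those of V f multiplied by d^m, all
    being integral. A coefficient of k f that is nonzero forces d^m into O, one of B g forces d^-m
    into O. Criticality makes the first kind of weight 0, and on weight 0 the units d^m reduce to a
    character t^m. *)
Lemma valuative_limit n dg (A : 'M[K]_n) (f g : {mpoly C[n]}) (G : {mpoly O[n]}) u :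
  f \is dg.-homog -> g \is dg.-homog -> critical f ->
  map_mpoly i G = lsub A (map_mpoly (i \o j) f) -> map_mpoly phi G = g ->
  (exists o, i o = \det A ^+ u.+1 /\ phi o != 0) ->
  exists (B k : 'M[C]_n) (z : 'cV[int]_n) (t : 'rV[C]_n),
  [/\ B \in unitmx, k \in unitmx, forall l, t 0 l != 0,
      (forall m, (lsub k f)@_m != 0 -> mwt z m = 0) &
      forall m, ((lsub B g)@_m != 0 -> mwt z m <= 0) /\
        (mwt z m = 0 -> (lsub B g)@_m = (\prod_l t 0 l ^+ m l) * (lsub k f)@_m)].
Proof.
move=> fhom ghom fcrit iG phiG [oD [oDE phioD]].
have [oD' oDD'] := unit_i phioD.
have detA0 : \det A != 0.
  apply/eqP => dA0; move: oDE oDD'; rewrite dA0 expr0n /= => oD0.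
  have -> : oD = 0 by apply: inj_i; rewrite oD0 rmorph0.
  by rewrite mul0r => /esym/eqP; rewrite oner_eq0.
have [U [U' [V [V' [d [UU' VV' AE d0 ku]]]]]] := valuation_cartan detA0.
pose k := map_mx phi V; pose B := map_mx phi U'.
pose G1 := lsub U' G; pose F1 := lsub V (map_mpoly j f).
have GF m : i G1@_m = zmono d (mrow m) * i F1@_m.
  rewrite zmono_mrow -!mcoeff_map_mpoly /G1 /F1 !map_lsub iG map_mpoly_comp_morph AE.
  rewrite -!lsubM -lsub_diag_mx; congr (_@_m); rewrite lsubM -map_mxM (mulmx1C UU') map_mx1.
  by rewrite lsub1.
have phiF m : phi F1@_m = (lsub k f)@_m.
  rewrite -mcoeff_map_mpoly /F1 map_lsub map_mpoly_comp_morph; congr ((lsub _ _)@_m).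
  by apply/mpolyP => m'; rewrite mcoeff_map_mpoly /= phij.
have phiG1 m : phi G1@_m = (lsub B g)@_m.
  by rewrite -mcoeff_map_mpoly /G1 map_lsub phiG.
pose N e := exists o, i o = zmono d e.
(* The all-ones vector is included because its value on d is the determinant of A up to a unit; this
   makes the weights sum to 0. *)
pose s := [seq mrow (val m) | m <- enum {: 'X_{1..n < dg.+1}}] ++ [:: const_mx 1].
have [||q a|z zP] := @integral_weight n N s.
- by move=> a b [o oE] [o' o'E]; exists (o * o'); rewrite rmorphM oE o'E zmonoD.
- move=> a; rewrite /N zmonoN; have [[o oE]|[_ [o oE]]] := total_i (zmono d a).
    by left; exists o.
  by right; exists o.
- by rewrite /N -scaler_nat natz zmonoZ => /valuation_root.
have zm m : (mdeg m <= dg)%N ->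
    (N (mrow m) <-> 0 <= mwt z m) /\ (N (- mrow m) <-> mwt z m <= 0).
  move=> le_m; apply: zP; rewrite mem_cat; apply/orP; left.
  by apply/mapP; exists (BMultinom (le_m : mdeg m < dg.+1)%N); rewrite ?mem_enum.
have z1 : \sum_l z l 0 = 0.
  have [N1 N1'] : (N (const_mx 1) <-> 0 <= ((const_mx 1 : 'rV[int]_n) *m z) 0 0) /\
      (N (- const_mx 1) <-> ((const_mx 1 : 'rV[int]_n) *m z) 0 0 <= 0).
    by apply: zP; rewrite mem_cat inE eqxx orbT.
  have -> : \sum_l z l 0 = ((const_mx 1 : 'rV[int]_n) *m z) 0 0.
    by rewrite mxE; apply: eq_bigr => l _; rewrite mxE mul1r.
  have dE : zmono d (const_mx 1) = \det A * i (\det U' * \det V').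
    rewrite AE !det_mulmx det_diag rmorphM -!det_map_mx.
    have -> : zmono d (const_mx 1) = \prod_l d 0 l by apply: eq_bigr => l _; rewrite mxE.
    have UU1 : \det (map_mx i U) * \det (map_mx i U') = 1.
      by rewrite -det_mulmx -map_mxM UU' map_mx1 det1.
    have VV1 : \det (map_mx i V) * \det (map_mx i V') = 1.
      by rewrite -det_mulmx -map_mxM VV' map_mx1 det1.
    rewrite [RHS](_ : _ = (\prod_l d 0 l) * (\det (map_mx i U) * \det (map_mx i U')) *
      (\det (map_mx i V) * \det (map_mx i V'))); first by rewrite UU1 VV1 !mulr1.
    by ring.
  have [oa oaE] : exists o, i o = \det A by apply: (@valuation_root _ u); exists oD.
  have [ob obE] : exists o, i o = (\det A)^-1.
    apply: (@valuation_root _ u); exists oD'; rewrite exprVn -oDE.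
    have := congr1 i oDD'; rewrite rmorphM rmorph1 oDE => E.
    by rewrite -[LHS](mulKf (expf_neq0 u.+1 detA0)) E mulr1.
  apply/le_anti/andP; split.
    apply/N1'; exists (ob * (\det U * \det V)); rewrite zmonoN dE invfM rmorphM obE; congr (_ * _).
    have : i (\det U * \det V) * i (\det U' * \det V') = 1.
      by rewrite -rmorphM mulrACA -!det_mulmx UU' VV' mulmx1 det1 rmorph1.
    move=> E; have nz : i (\det U' * \det V') != 0.
      by apply: contra_eq_neq E => ->; rewrite mulr0 eq_sym oner_eq0.
    by apply: (mulIf nz); rewrite E mulVf.
  by apply/N1; exists (oa * (\det U' * \det V')); rewrite rmorphM oaE dE.
have dgm (h : {mpoly C[n]}) m : h \is dg.-homog -> h@_m != 0 -> (mdeg m <= dg)%N.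
  by move=> /dhomogP hh hm; rewrite (hh m) // mcoeff_msupp.
(* The residues of those monomials in d that are units form a partial character. *)
pose E a x := exists o o', [/\ i o = zmono d a, o * o' = 1 & phi o = x].
have [a b x y|a x|x|t [t0 tP]] := @character_extension C n E.
- move=> [o1 [o1' [i1 e1 <-]]] [o2 [o2' [i2 e2 <-]]]; exists (o1 * o2'), (o1' * o2); split.
  + rewrite zmonoD // zmonoN rmorphM i1; congr (_ * _).
    have := congr1 i e2; rewrite rmorphM rmorph1 i2 => E2.
    by rewrite -[LHS](mulKf (zmono_neq0 b d0)) E2 mulr1.
  + by rewrite mulrACA e1 [o2' * _]mulrC e2 mulr1.
  + rewrite rmorphM; congr (_ * _); have := congr1 phi e2; rewrite rmorphM rmorph1 => E2.
    have nz : phi o2 != 0 by apply: contra_eq_neq E2 => ->; rewrite mul0r eq_sym oner_eq0.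
    by rewrite -[LHS](mulKf nz) E2 mulr1.
- move=> [o1 [o1' [i1 e1 <-]]]; apply: contra_eq_neq (congr1 phi e1) => p0.
  by rewrite rmorphM p0 mul0r rmorph1 eq_sym oner_eq0.
- move=> [o1 [o1' [i1 e1 <-]]]; suff -> : o1 = 1 by rewrite rmorph1.
  by apply: inj_i; rewrite i1 zmono0 rmorph1.
have f0wt m : (lsub k f)@_m != 0 -> mwt z m = 0.
  apply: critical_weight0 => //; first exact: critical_unitary.
  move=> {}m fm; have lem := dgm _ _ (dhomog_lsub k fhom) fm.
  apply/(proj1 (zm _ lem)); rewrite -phiF in fm; have [o' oo'] := unit_i fm.
  by exists (G1@_m * o'); rewrite rmorphM GF -mulrA -rmorphM oo' rmorph1 mulr1.
exists B, k, z, t; split=> //.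
- have BB : map_mx phi U *m B = 1%:M by rewrite -map_mxM UU' map_mx1.
  by have [] := mulmx1_unit BB.
- exact: unitarymx_unit.
move=> m; split.
  move=> gm; have lem := dgm _ _ (dhomog_lsub B ghom) gm.
  apply/(proj2 (zm _ lem)); rewrite -phiG1 in gm; have [o' oo'] := unit_i gm.
  exists (F1@_m * o'); rewrite zmonoN.
  have := congr1 i oo'; rewrite rmorphM GF rmorph1 -mulrA => E1.
  by rewrite -[LHS](mulKf (zmono_neq0 (mrow m) d0)) rmorphM E1 mulr1.
move=> wt0; have [lem|ltm] := leqP (mdeg m) dg; last first.
  have zero (h : {mpoly C[n]}) : h \is dg.-homog -> h@_m = 0.
    by move=> hh; apply/eqP; apply: contraTT ltm => /(dgm _ _ hh); rewrite -leqNgt.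
  by rewrite !zero ?mulr0 ?dhomog_lsub.
have [/proj2 Np /proj2 Nn] := zm _ lem.
have [|o oE] := Np; first by rewrite wt0.
have [|o' o'E] := Nn; first by rewrite wt0.
have oo' : o * o' = 1.
  by apply: inj_i; rewrite rmorphM rmorph1 oE o'E zmonoN divff ?zmono_neq0.
rewrite -zmono_mrow -(tP (mrow m) (phi o)); last by exists o, o'.
rewrite -phiF -phiG1 -rmorphM; congr (phi _); apply: inj_i.
by rewrite GF rmorphM oE.
Qed.

End Valuative.

(** * The generic matrix *)

Section MapMap.
Variables (n : nat) (A B B' D : comNzRingType).

Lemma map_mpoly_square (f : {rmorphism A -> B}) (g : {rmorphism B -> D})
    (f' : {rmorphism A -> B'}) (g' : {rmorphism B' -> D}) (p : {mpoly A[n]}) :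
  (forall x, g (f x) = g' (f' x)) ->
  map_mpoly g (map_mpoly f p) = map_mpoly g' (map_mpoly f' p).
Proof. by move=> E; apply/mpolyP => m; rewrite !mcoeff_map_mpoly /= E. Qed.

Lemma map_mpoly_triangle (f : {rmorphism A -> B}) (g : {rmorphism B -> D})
    (h : {rmorphism A -> D}) (p : {mpoly A[n]}) :
  (forall x, g (f x) = h x) -> map_mpoly g (map_mpoly f p) = map_mpoly h p.
Proof. by move=> E; apply/mpolyP => m; rewrite !mcoeff_map_mpoly /= E. Qed.

Lemma map_mpoly_cancel (f : {rmorphism A -> B}) (g : {rmorphism B -> A}) (p : {mpoly A[n]}) :
  (forall x, g (f x) = x) -> map_mpoly g (map_mpoly f p) = p.
Proof. by move=> E; apply/mpolyP => m; rewrite !mcoeff_map_mpoly /= E. Qed.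

End MapMap.

Section GenericMatrixTheory.
Variable n : nat.
Local Notation NN := #|{: 'I_n * 'I_n}|.

Lemma map_genmx (A A' : comNzRingType) (s : {rmorphism A -> A'}) :
  map_mx (map_mpoly s) (genmx n A) = genmx n A'.
Proof. by apply/matrixP => i j; rewrite !mxE map_mpolyX. Qed.

Lemma map_gen_act (A A' : comNzRingType) (s : {rmorphism A -> A'}) (f : {mpoly A[n]}) :
  map_mpoly (map_mpoly s) (gen_act f) = gen_act (map_mpoly s f).
Proof.
rewrite /gen_act map_lsub /= map_genmx.
apply: (congr1 (lsub (genmx n A'))).
by apply: map_mpoly_square => c; apply: map_mpolyC.
Qed.

Section Eval.
Variable C : comNzRingType.

Definition mxeval (B : 'M[C]_n) (k : 'I_NN) : C := B (enum_val k).1 (enum_val k).2.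

Lemma mxeval_genmx B : map_mx (meval (mxeval B)) (genmx n C) = B.
Proof. by apply/matrixP => i j; rewrite !mxE mevalXU /mxeval enum_rankK. Qed.

Lemma mxeval_det B : (\det (genmx n C)).@[mxeval B] = \det B.
Proof. by rewrite -det_map_mx mxeval_genmx. Qed.

Lemma mxeval_gen_act B (f : {mpoly C[n]}) :
  map_mpoly (meval (mxeval B)) (gen_act f) = lsub B f.
Proof.
rewrite /gen_act map_lsub /= mxeval_genmx; apply: (congr1 (lsub B)).
by apply: map_mpoly_cancel => c; apply: mevalC.
Qed.

(* The substitution X |-> X B on the generic matrix. *)
Definition rtrans (B : 'M[C]_n) : 'M[C]_NN :=
  \matrix_(k, l) (B (enum_val k).2 (enum_val l).2 *+ ((enum_val k).1 == (enum_val l).1)).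

Lemma rtrans_tr B : (rtrans B)^T = rtrans B^T.
Proof. by apply/matrixP => k l; rewrite !mxE eq_sym. Qed.

Lemma lsub_rtrans_genmx B :
  map_mx (lsub (rtrans B)) (genmx n C) = genmx n C *m map_mx (@mpolyC NN C) B.
Proof.
apply/matrixP => i j; rewrite !mxE lsubX.
rewrite (reindex (@enum_rank {: 'I_n * 'I_n})) /=; last first.
  by apply: onW_bij; apply: enum_rank_bij.
rewrite (eq_bigr (fun u : 'I_n * 'I_n =>
   (fun a b => (B b j *+ (a == i)) *: 'X_(enum_rank (a, b))) u.1 u.2)); last first.
  by move=> [a b] _; rewrite mxE !enum_rankK.
rewrite -(pair_bigA _ (fun a b => (B b j *+ (a == i)) *: 'X_(enum_rank (a, b)))) /=.
rewrite (bigD1 i) //= [X in _ + X]big1 ?addr0 => [|a ai]; last first.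
  by rewrite big1 // => b _; rewrite (negPf ai) scale0r.
apply: eq_bigr => b _.
by rewrite eqxx mulr1n !mxE mulrC mul_mpolyC.
Qed.

Lemma lsub_rtrans_det B :
  lsub (rtrans B) (\det (genmx n C)) = (\det B) *: \det (genmx n C).
Proof.
rewrite -det_map_mx lsub_rtrans_genmx det_mulmx -mul_mpolyC mulrC.
by rewrite det_map_mx.
Qed.

Lemma map_lsub_rtrans_gen_act B (f : {mpoly C[n]}) :
  map_mpoly (lsub (rtrans B)) (gen_act f) = gen_act (lsub B f).
Proof.
rewrite /gen_act !map_lsub /= lsub_rtrans_genmx lsubM.
apply: (congr1 (lsub (genmx n C *m map_mx (@mpolyC NN C) B))).
by apply: map_mpoly_triangle => c; apply: lsubC.
Qed.

Lemma dhomog_det_genmx : \det (genmx n C) \is n.-homog.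
Proof.
rewrite /determinant; apply: rpred_sum => s _.
have prodh : \prod_i genmx n C i (s i) \is (\sum_(i < n) 1)%N.-homog.
  apply: (big_ind2 (fun (p : {mpoly C[NN]}) e => p \is e.-homog)).
  - exact: dhomog1.
  - by move=> p1 e1 p2 e2; exact: dhomogM.
  - by move=> i _; rewrite mxE dhomogX /= mdeg1.
rewrite sum1_card card_ord in prodh.
by rewrite mulr_sign; case: (odd_perm s); rewrite ?rpredN.
Qed.

End Eval.

Lemma det_genmx_neq0 (C : comNzRingType) : \det (genmx n C) != 0.
Proof.
apply: contraTneq (oner_neq0 C) => d0.
by rewrite -(det1 C n) -mxeval_det d0 meval0 eqxx.
Qed.

(** Invertible matrices are Zariski dense: F times the determinant vanishes on all matrices. *)
Lemma mpoly_vanish_unitmx (C : numFieldType) (F : {mpoly C[NN]}) :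
  (forall B, B \in unitmx -> F.@[mxeval B] = 0) -> F = 0.
Proof.
move=> F0; have : F * \det (genmx n C) = 0.
  apply: mpoly_vanish => v; pose B : 'M[C]_n := \matrix_(i, j) v (enum_rank (i, j)).
  have -> : (F * \det (genmx n C)).@[v] = (F * \det (genmx n C)).@[mxeval B].
    apply: meval_eq => k; rewrite /mxeval mxE -surjective_pairing.
    by rewrite enum_valK.
  rewrite mevalM mxeval_det; have [Bu|] := boolP (B \in unitmx).
    by rewrite F0 // mul0r.
  by rewrite unitmxE unitfE negbK => /eqP->; rewrite mulr0.
by move/eqP; rewrite mulf_eq0 (negPf (det_genmx_neq0 C)) orbF => /eqP.
Qed.

End GenericMatrixTheory.

Lemma apo_homog n (A : comNzRingType) (p q : {mpoly A[n]}) d e :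
  p \is d.-homog -> q \is e.-homog -> d != e -> apo p q = 0.
Proof.
move=> /dhomogP hp /dhomogP hq de; rewrite /apo big_seq big1 // => m mp.
rewrite [q@_m](_ : _ = 0) ?mul0rn ?mulr0 //; apply: memN_msupp_eq0.
by apply: contra de => /hq <-; rewrite (hp _ mp).
Qed.

Lemma apo_conj_neq0 n (C : numClosedFieldType) (p : {mpoly C[n]}) :
  p != 0 -> apo p (map_mpoly Num.conj p) != 0.
Proof.
move=> p0; have T_ge0 m : 0 <= p@_m * ((map_mpoly Num.conj p)@_m *+ mfact m).
  by rewrite mcoeff_map_mpoly /= mulrnAr -normCK mulrn_wge0 // exprn_ge0.
have lp := mlead_supp p0.
rewrite /apo (bigD1_seq (mlead p)) ?msupp_uniq //= gt_eqF // ltr_pwDl //; last first.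
  by apply: sumr_ge0 => m _; apply: T_ge0.
rewrite lt_neqAle T_ge0 andbT eq_sym mcoeff_map_mpoly /= mulrnAr -normCK.
rewrite mulrn_eq0 expf_eq0 normr_eq0 /= mleadc_eq0 (negPf p0) orbF.
rewrite /mfact; have : (0 < \prod_(i < n) ((mlead p) i)`!)%N.
  by rewrite prodn_gt0 // => i; exact: fact_gt0.
by case: (\prod_(i < n) _)%N.
Qed.

Lemma mcoeff_truncated n (A : comNzRingType) (h : 'X_{1..n} -> A) k m :
  (\sum_(m : 'X_{1..n < k}) h m *: 'X_[m])@_m = if (mdeg m < k)%N then h m else 0.
Proof.
rewrite (raddf_sum (mcoeff m)) /=; case: ifPn => [ltm|gem].
  rewrite (bigD1 (BMultinom ltm)) //= mcoeffZ mcoeffX eqxx mulr1 big1 ?addr0 // => m' ne.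
  rewrite mcoeffZ mcoeffX (_ : (_ == m) = false) ?mulr0 //.
  by apply: contraNF ne => /eqP E; apply/eqP/val_inj.
rewrite big1 // => m' _; rewrite mcoeffZ mcoeffX (_ : (_ == m) = false) ?mulr0 //.
by apply: contraNF gem => /eqP <-; apply: bmdeg.
Qed.

Section LimitAnalysis.
Variables (C : numClosedFieldType) (n dg : nat).
Local Notation NN := #|{: 'I_n * 'I_n}|.

(** T is a ring of test functions, p1 their values at the generic point X f, p2 their values at g.
    The implication from p1 to p2 makes g a specialization, which a place of the field C(X)
    realizes. *)
Lemma limit_analysis (f g : {mpoly C[n]}) (T : comNzRingType)
    (p1 : {rmorphism T -> {mpoly C[NN]}}) (p2 : {rmorphism T -> C}) u :
  f \is dg.-homog -> g \is dg.-homog -> critical f ->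
  (forall t, p1 t = 0 -> p2 t = 0) ->
  (forall c, exists t, p1 t = c%:MP /\ p2 t = c) ->
  (forall m, exists t, p1 t = (gen_act f)@_m /\ p2 t = g@_m) ->
  (exists t, p1 t = \det (genmx n C) ^+ u.+1 /\ p2 t != 0) ->
  exists (B k : 'M[C]_n) (z : 'cV[int]_n) (t : 'rV[C]_n),
  [/\ B \in unitmx, k \in unitmx, forall l, t 0 l != 0,
      (forall m, (lsub k f)@_m != 0 -> mwt z m = 0) &
      forall m, ((lsub B g)@_m != 0 -> mwt z m <= 0) /\
        (mwt z m = 0 -> (lsub B g)@_m = (\prod_l t 0 l ^+ m l) * (lsub k f)@_m)].
Proof.
move=> fhom ghom fcrit p12 pC pm [td [td1 td2]].
pose K : fieldType := {fraction {mpoly C[NN]}}.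
pose k0 : {rmorphism C -> K} := @tofrac {mpoly C[NN]} \o @mpolyC NN C.
pose G0 : set (K * C)%type := fun u => exists t, u = (tofrac (p1 t), p2 t).
have okG0 : place_graph (L := C) G0.
  split.
  - by exists 1; rewrite !rmorph1.
  - by move=> _ _ [t ->] [t' ->]; exists (t - t'); rewrite !rmorphB.
  - by move=> _ _ [t ->] [t' ->]; exists (t * t'); rewrite !rmorphM.
  - move=> c [t [/esym/eqP]]; rewrite tofrac_eq0 => /eqP/p12 p2t ->.
    by [].
have G0c c : G0 (k0 c, c) by have [t [t1 t2]] := pC c; exists t; rewrite t1 t2.
have [O [i [phi [j [inj_i ij phij liftO [unit_i total_i]]]]]] := place_exists okG0 G0c.
pose A : 'M[K]_n := map_mx (@tofrac _) (genmx n C).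
have AE : map_mpoly (@tofrac _) (gen_act f) = lsub A (map_mpoly (i \o j) f).
  rewrite /gen_act map_lsub /=; apply: (congr1 (lsub A)).
  by apply: map_mpoly_triangle => c; rewrite /= ij.
have /choice[h hP] : forall m, exists o, i o = tofrac (gen_act f)@_m /\ phi o = g@_m.
  by move=> m; have [t [t1 t2]] := pm m; apply: liftO; exists t; rewrite t1 t2.
(* The integral lifts of the coefficients, assembled up to degree dg; higher coefficients of both
   forms are 0. *)
pose G : {mpoly O[n]} := \sum_(m : 'X_{1..n < dg.+1}) h m *: 'X_[m].
have GE (L : fieldType) (s : {rmorphism O -> L}) (q : {mpoly L[n]}) :
    q \is dg.-homog -> (forall m, s (h m) = q@_m) -> map_mpoly s G = q.
  move=> /dhomogP hq sh; apply/mpolyP => m; rewrite mcoeff_map_mpoly.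
  rewrite mcoeff_truncated; case: ifPn => [ltm|gem]; first exact: sh.
  have -> : q@_m = 0 by apply: memN_msupp_eq0; apply: contra gem => /hq ->.
  exact: rmorph0.
apply: (valuative_limit (i := i) (phi := phi) (j := j) inj_i phij unit_i total_i
          (A := A) (G := G) (u := u) fhom ghom fcrit).
- rewrite -AE; apply: GE => [|m]; last by rewrite mcoeff_map_mpoly; have [] := hP m.
  by apply: dhomog_map; apply: dhomog_lsub; apply: dhomog_map.
- by apply: (GE C phi g ghom) => m; exact: (proj2 (hP m)).
have [|o [oE1 oE2]] := liftO (tofrac (p1 td)) (p2 td); first by exists td.
exists o; split; last by rewrite oE2.
by rewrite oE1 td1 rmorphXn det_map_mx.
Qed.

End LimitAnalysis.

(** * Invariants and semistability *)

Section HomogeneousComponents.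
Variables (N : nat) (C : numFieldType).
Implicit Types (P : {mpoly C[N]}) (w : 'I_N -> C).

Lemma meval_homog d P w (a : C) : P \is d.-homog -> P.@[fun i => a * w i] = a ^+ d * P.@[w].
Proof.
move=> /dhomogP hP; rewrite !mevalE mulr_sumr big_seq [RHS]big_seq.
apply: eq_bigr => m /hP <-; under eq_bigr do rewrite exprMn.
by rewrite big_split /= prodrXr -mdegE mulrCA.
Qed.

Lemma meval_homog_components P w (a : C) :
  P.@[fun i => a * w i] =
  \sum_(d < msize P) a ^+ d * (pihomog mdeg d P).@[w].
Proof.
rewrite {1}(pihomog_partitionE (leqnn (msize P))) raddf_sum /=.
by apply: eq_bigr => d _; rewrite (meval_homog _ _ (pihomogP mdeg d P)).
Qed.

Lemma pihomog_eq0 d P : (msize P <= d)%N -> pihomog mdeg d P = 0.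
Proof.
move=> led; rewrite pihomogE big_seq_cond big1 // => m /andP[/msize_mdeg_lt + /eqP dm].
by rewrite dm ltnNge led.
Qed.

(** Both sides of the scaling law are polynomials in a, with the values of the homogeneous
    components as coefficients on one side; the coefficients of a^e are compared. *)
Lemma homog_component_scaling e P w :
  (forall a, a != 0 -> P.@[fun i => a * w i] = a ^+ e * P.@[w]) ->
  (pihomog mdeg e P).@[w] = P.@[w].
Proof.
move=> Pe; pose Q : {poly C} := \sum_(d < msize P) (pihomog mdeg d P).@[w] *: 'X^d.
have QE : Q = P.@[w] *: 'X^e.
  apply/eqP; rewrite -subr_eq0; apply/eqP; apply: poly_vanish => a a0.
  rewrite hornerD hornerN hornerZ hornerXn horner_sum.
  rewrite [X in _ - X]mulrC -Pe // meval_homog_components -sumrB big1 // => d _.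
  by rewrite hornerZ hornerXn mulrC subrr.
have := congr1 (fun q : {poly C} => q`_e) QE; rewrite coefZ coefXn eqxx mulr1 => <-.
rewrite coef_sum; have [lte|gee] := ltnP e (msize P).
  rewrite (bigD1 (Ordinal lte)) //= coefZ coefXn eqxx mulr1 big1 ?addr0 // => d de.
  by rewrite coefZ coefXn (_ : (e == d) = false) ?mulr0 //; apply: contraNF de => /eqP E; apply/eqP/val_inj.
rewrite pihomog_eq0 // meval0 big1 // => d _.
by rewrite coefZ coefXn gtn_eqF ?mulr0 //; apply: leq_trans gee.
Qed.

Lemma homog_component_vanish P w :
  (forall a, a != 0 -> P.@[fun i => a * w i] = 0) -> forall d, (pihomog mdeg d P).@[w] = 0.
Proof.
move=> P0 d.
have Pw : P.@[w] = 0.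
  by rewrite -[RHS](P0 1 (oner_neq0 _)); apply: meval_eq => i; rewrite mul1r.
by rewrite homog_component_scaling // => a a0; rewrite P0 // Pw mulr0.
Qed.

End HomogeneousComponents.

(** * Coordinates on forms and the Omega process *)

Section Coordinates.
Variables (C : numClosedFieldType) (n' dg : nat).
Local Notation n := n'.+1.
Local Notation V := (dhomog n C dg).
Local Notation N := (\dim {:V}).
Local Notation NN := #|{: 'I_n * 'I_n}|.
Implicit Type v : V.

Definition vcoord (i : 'I_N) v : C := coord (vbasis {:V}) i v.
Definition vbas (i : 'I_N) : {mpoly C[n]} := val (vbasis {:V})`_i.
(** The default value 0 is taken when the degree of m is not dg, so that sums may run over all
    monomials of bounded degree. *)
Definition emon (m : 'X_{1..n}) : V := insubd 0 'X_[m].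

Lemma val_dhomogZ (a : C) v : val (a *: v) = a *: val v.
Proof. by []. Qed.

Lemma vcoordK v : val v = \sum_i vcoord i v *: vbas i.
Proof.
rewrite {1}(coord_vbasis (memvf v)) raddf_sum /=.
by apply: eq_bigr => i _; exact: val_dhomogZ.
Qed.

Lemma val_emon m : val (emon m) = if mdeg m == dg then 'X_[m] else 0.
Proof. by rewrite val_insubd dhomogX. Qed.

Lemma vcoordE v i :
  vcoord i v = \sum_(m : 'X_{1..n < dg.+1}) vcoord i (emon m) * (val v)@_m.
Proof.
have vE : v = \sum_(m : 'X_{1..n < dg.+1}) (val v)@_m *: emon m.
  apply: val_inj; rewrite raddf_sum /=.
  have le_sz : (msize (val v) <= dg.+1)%N.
    rewrite msizeE; apply/bigmax_leqP_seq => m mv _; rewrite ltnS.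
    by have /dhomogP->  := dhomog_is_dhomog v.
  rewrite {1}(mpolywE le_sz); apply: eq_bigr => m _.
  apply/esym; etransitivity; first exact: val_dhomogZ.
  rewrite val_emon; case: ifPn => // ne.
  by rewrite (dhomog_nemf_coeff (dhomog_is_dhomog v)) // !scale0r.
rewrite /vcoord {1}vE linear_sum; apply: eq_bigr => m _.
by rewrite linearZ /= mulrC.
Qed.

Section Coord.
Variables (A : comNzRingType) (c : {rmorphism C -> A}).
Implicit Type h : {mpoly A[n]}.

(** The coordinates for [vbasis] extended to forms with coefficients in A, through their expression
    in the coefficients of monomials. *)
Definition gcoord i h : A :=
  \sum_(m : 'X_{1..n < dg.+1}) c (vcoord i (emon m)) * h@_m.

Lemma gcoordK h : h \is dg.-homog -> h = \sum_i gcoord i h *: map_mpoly c (vbas i).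
Proof.
move=> hh; apply/mpolyP => m; rewrite (raddf_sum (mcoeff m)) /=.
under eq_bigr do rewrite mcoeffZ mcoeff_map_mpoly mulr_suml.
rewrite exchange_big /=.
have [mdg|ne] := eqVneq (mdeg m) dg; last first.
  rewrite (dhomog_nemf_coeff hh) // big1 // => m' _.
  rewrite big1 // => i _; rewrite /vbas (dhomog_nemf_coeff (dhomog_is_dhomog _)) //.
  by rewrite rmorph0 mulr0.
have E (m' : 'X_{1..n < dg.+1}) :
    \sum_i c (vcoord i (emon m')) * h@_m' * c (vbas i)@_m = h@_m' *+ (val m' == m).
  under eq_bigr do rewrite mulrAC -rmorphM.
  rewrite -mulr_suml -rmorph_sum /=.
  have -> : \sum_i vcoord i (emon m') * (vbas i)@_m = (val (emon m'))@_m.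
    by rewrite [val _]vcoordK (raddf_sum (mcoeff m)); apply: eq_bigr => i _; rewrite /= mcoeffZ.
  rewrite val_emon; case: ifPn => [_|ne].
    by rewrite mcoeffX rmorph_nat mulr_natl.
  rewrite mcoeff0 rmorph0 mul0r (_ : (_ == m) = false) //.
  by apply: contraNF ne => /eqP->; rewrite mdg.
under eq_bigr do rewrite E.
have ltm : (mdeg m < dg.+1)%N by rewrite mdg.
rewrite (bigD1 (BMultinom ltm)) //= eqxx mulr1n big1 ?addr0 // => m' ne.
by rewrite (_ : (_ == m) = false) //; apply: contraNF ne => /eqP E'; apply/eqP/val_inj.
Qed.

Lemma gcoordZ i a h : gcoord i (a *: h) = a * gcoord i h.
Proof.
by rewrite /gcoord mulr_sumr; apply: eq_bigr => m _; rewrite mcoeffZ mulrCA.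
Qed.

Definition peval (P : {mpoly C[N]}) h : A := mmap c (gcoord^~ h) P.

End Coord.

Lemma gcoord_id i v : gcoord idfun i (val v) = vcoord i v.
Proof. by rewrite vcoordE. Qed.

Lemma peval_id P v : peval idfun P (val v) = polyfun P v.
Proof.
rewrite /peval /polyfun; apply: meval_eq => i.
exact: gcoord_id.
Qed.

Section Natural.
Variables (A A' : comNzRingType) (c : {rmorphism C -> A}) (c' : {rmorphism C -> A'}).
Variable s : {rmorphism A -> A'}.
Hypothesis sc : forall x, s (c x) = c' x.

Lemma gcoord_map i h : s (gcoord c i h) = gcoord c' i (map_mpoly s h).
Proof.
rewrite /gcoord rmorph_sum; apply: eq_bigr => m _.
by rewrite rmorphM /= sc mcoeff_map_mpoly.
Qed.

Lemma peval_map P h : s (peval c P h) = peval c' P (map_mpoly s h).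
Proof.
apply: (mpoly_morph_eq (f := s \o mmap c ((gcoord c)^~ h))
         (g := mmap c' ((gcoord c')^~ (map_mpoly s h)))) => [x|i] /=.
  by rewrite !mmapC sc.
by rewrite !mmapX !mmap1U gcoord_map.
Qed.

End Natural.

(** The generic form. A construction that commutes with ring morphisms, applied to it, gives the
    polynomial function that the construction defines on V. *)
Definition gen_vec : {mpoly {mpoly C[N]}[n]} :=
  \sum_i 'X_i *: map_mpoly (@mpolyC N C) (vbas i).

Lemma gen_vec_eval v : map_mpoly (meval (vcoord^~ v)) gen_vec = val v.
Proof.
rewrite /gen_vec (raddf_sum (map_mpoly _)) vcoordK; apply: eq_bigr => i _ /=.
rewrite map_mpolyZ /= mevalXU; apply: (congr1 (fun q => vcoord i v *: q)).
by apply: map_mpoly_cancel => x; apply: mevalC.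
Qed.

Section Invariants.
Variables (mu : 'X_{1..N}) (j M : nat).

Section Form.
Variables (A : comNzRingType) (c : {rmorphism C -> A}).
Let cc : {rmorphism C -> {mpoly A[NN]}} := @mpolyC NN A \o c.

Definition omega_arg (h : {mpoly A[n]}) : {mpoly A[NN]} :=
  mmap1 (fun i => gcoord cc i (gen_act h)) mu * \det (genmx n A) ^+ j.

(* Cayley's Omega process, in the guise of the apolar pairing with det^M. *)
Definition omega_form (h : {mpoly A[n]}) : A :=
  apo (omega_arg h) (\det (genmx n A) ^+ M).

Lemma gen_actZ a (h : {mpoly A[n]}) : gen_act (a *: h) = a%:MP *: gen_act h.
Proof. by rewrite /gen_act map_mpolyZ lsubZ. Qed.

Lemma omega_formZ a h : omega_form (a *: h) = a ^+ mdeg mu * omega_form h.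
Proof.
rewrite /omega_form -apoZl; congr (apo _ _).
rewrite /omega_arg scalerAl; congr (_ * _).
rewrite /mmap1 -[RHS]mul_mpolyC (rmorphXn (@mpolyC NN A)) /= mdegE -prodrXr -big_split /=.
by apply: eq_bigr => i _; rewrite gen_actZ gcoordZ exprMn.
Qed.

End Form.

Lemma omega_form_map (A A' : comNzRingType) (c : {rmorphism C -> A})
    (c' : {rmorphism C -> A'}) (s : {rmorphism A -> A'}) h :
  (forall x, s (c x) = c' x) -> s (omega_form c h) = omega_form c' (map_mpoly s h).
Proof.
move=> sc; rewrite /omega_form -apo_map !rmorphXn /= -det_map_mx /= map_genmx.
congr (apo _ _); rewrite /omega_arg rmorphM rmorphXn /= -det_map_mx /= map_genmx.
congr (_ * _); rewrite /mmap1 rmorph_prod /=; apply: eq_bigr => i _.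
rewrite rmorphXn /=; congr (_ ^+ _); rewrite -map_gen_act.
by apply: gcoord_map => x /=; rewrite map_mpolyC /= sc.
Qed.

(** Acting by B on h amounts to substituting X B for X; the adjoint substitution uses the transpose
    of B and multiplies det X by det B = 1. *)
Lemma omega_form_invariant (B : 'M[C]_n) (h : {mpoly C[n]}) :
  \det B = 1 -> omega_form idfun (lsub B h) = omega_form idfun h.
Proof.
move=> detB.
have argE : omega_arg idfun (lsub B h) = lsub (rtrans B) (omega_arg idfun h).
  rewrite /omega_arg rmorphM rmorphXn /= lsub_rtrans_det detB scale1r; congr (_ * _).
  rewrite /mmap1 rmorph_prod /=; apply: eq_bigr => i _; rewrite rmorphXn /=.
  congr (_ ^+ _); rewrite -map_lsub_rtrans_gen_act.
  by apply/esym/gcoord_map => x /=; rewrite lsubC.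
rewrite /omega_form argE apo_lsub rtrans_tr rmorphXn /= lsub_rtrans_det det_tr detB.
by rewrite scale1r.
Qed.

Lemma omega_form_poly : exists P : {mpoly C[N]},
  [/\ P \is (mdeg mu).-homog &
      forall v, polyfun P v = omega_form idfun (val v)].
Proof.
pose P0 := omega_form (@mpolyC N C) gen_vec.
have P0E v : P0.@[vcoord^~ v] = omega_form idfun (val v).
  rewrite -(gen_vec_eval v) /P0.
  by apply: (omega_form_map (s := meval (vcoord^~ v))) => x; apply: mevalC.
exists (pihomog mdeg (mdeg mu) P0); split; first exact: pihomogP.
move=> v; rewrite -P0E; apply: homog_component_scaling => a a0.
transitivity (P0.@[vcoord^~ (a *: v)]).
  by apply: meval_eq => i; rewrite /vcoord linearZ.
by rewrite P0E val_dhomogZ omega_formZ -P0E.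
Qed.

End Invariants.

Definition sl_inv (P : {mpoly C[N]}) := forall (B : 'M[C]_n) v w,
  \det B = 1 -> val w = lsub B (val v) -> polyfun P w = polyfun P v.

(** If all invariants of positive degree vanished at f, then 0 would be a limit of X f along which
    det X specializes to 1; but the weight 0 part of such a limit is k f up to a torus element. *)
Theorem critical_semistable v : critical (val v) -> v != 0 ->
  exists d (P : {mpoly C[N]}), [/\ (0 < d)%N, P \is d.-homog, sl_inv P & polyfun P v != 0].
Proof.
move=> vcrit; apply: contraPP => nss; set f := val v in vcrit.
have om0 mu j M : mu != 0%MM -> omega_form mu j M idfun f = 0.
  move=> mu0; have [P [Phom PE]] := omega_form_poly mu j M.
  rewrite -PE; apply/eqP; apply: contra_notT nss => Pv.
  exists (mdeg mu), P; split=> //; first by rewrite lt0n mdeg_eq0.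
  by move=> B v1 w detB wE; rewrite !PE wE omega_form_invariant.
pose D := \det (genmx n C).
pose cc : {rmorphism C -> {mpoly C[NN]}} := @mpolyC NN C \o idfun.
pose w i := gcoord cc i (gen_act f).
(* The variable of [{poly _}] stands for the determinant: p1 evaluates at (X f, det X), and p2 below
   at (0, 1). *)
pose p1 : {rmorphism {poly {mpoly C[N]}} -> {mpoly C[NN]}} :=
  horner_eval D \o map_poly (mmap cc w).
pose p2 : {rmorphism {poly {mpoly C[N]}} -> C} :=
  horner_eval 1 \o map_poly (mcoeff 0%MM).
have fhom : f \is dg.-homog by apply: dhomog_is_dhomog.
have homX : gen_act f \is dg.-homog by apply: dhomog_lsub; apply: dhomog_map.
(* In the pairing of p1 P with D^M, nonconstant monomials in the coordinates give invariants of f,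
   which vanish, and powers of D other than D^M are orthogonal by degree. So the constant term of
   the M-th coefficient of P is 0. *)
have p12 P : p1 P = 0 -> p2 P = 0.
  move=> p1P; rewrite /p2 /= /horner_eval horner_coef big1 // => M _.
  rewrite coef_map expr1n mulr1 /=; set a := P`_M.
  have /eqP : apo (p1 P) (D ^+ M) = 0 by rewrite p1P apo0l.
  have DM j : apo (D ^+ j) (D ^+ M) = 0 \/ j = M.
    have [->|jM] := eqVneq j M; [by right | left].
    have Dh := dhomog_det_genmx n C.
    apply: (apo_homog (dhomogMn j Dh) (dhomogMn M Dh)).
    by rewrite eqn_pmul2l.
  have DMM : apo (D ^+ M) (D ^+ M) != 0.
    have -> : apo (D ^+ M) (D ^+ M) = apo (D ^+ M) (map_mpoly Num.conj (D ^+ M)).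
      by rewrite rmorphXn /= -det_map_mx /= map_genmx.
    by apply: apo_conj_neq0; rewrite expf_neq0 ?det_genmx_neq0.
  rewrite /p1 /= /horner_eval horner_coef apo_suml.
  have term (l : nat) : apo ((map_poly (mmap cc w) P)`_l * D ^+ l) (D ^+ M) =
      (P`_l)@_0%MM * apo (D ^+ l) (D ^+ M).
    rewrite coef_map /= {1}[P`_l]mpolyE raddf_sum mulr_suml apo_suml.
    have tm m : apo (mmap cc w ((P`_l)@_m *: 'X_[m]) * D ^+ l) (D ^+ M) =
        (P`_l)@_m * omega_form m l M idfun f.
      by rewrite mmapZ mmapX /= mul_mpolyC -scalerAl apoZl.
    under eq_bigr do rewrite tm.
    have [in0|out0] := boolP (0%MM \in msupp P`_l).
      rewrite (bigD1_seq 0%MM) ?msupp_uniq //= big1 ?addr0 => [|m m0]; last first.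
        by rewrite om0 ?mulr0.
      by rewrite /omega_form /omega_arg mmap11 mul1r.
    rewrite (memN_msupp_eq0 out0) mul0r big_seq big1 // => m ms.
    by rewrite om0 ?mulr0 //; apply: contraNneq out0 => <-.
  under eq_bigr do rewrite term.
  have [ltM|geM] := ltnP M (size (map_poly (mmap cc w) P)).
    rewrite (bigD1 (Ordinal ltM)) //= big1 ?addr0 => [|l lM].
      by rewrite mulf_eq0 (negPf DMM) orbF => /eqP.
    have [->|E] := DM l; rewrite ?mulr0 //.
    by case/eqP: lM; apply: val_inj.
  move=> _; have aE : apo ((map_poly (mmap cc w) P)`_M * D ^+ M) (D ^+ M) = 0.
    by rewrite nth_default // mul0r apo0l.
  by move/eqP: aE; rewrite term mulf_eq0 (negPf DMM) orbF => /eqP.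
have [||||B [k [z [t [_ ku t0 fz gz]]]]] :=
    @limit_analysis C n dg f 0 {poly {mpoly C[N]}} p1 p2 0 fhom _ vcrit p12.
- exact: dhomog0.
- move=> x; exists (x%:MP)%:P; rewrite /p1 /p2 /= /horner_eval !map_polyC !hornerC /=.
  by rewrite mmapC /= mpolyCK.
- move=> m; exists (\sum_i (vbas i)@_m *: 'X_i)%:P.
  rewrite /p1 /p2 /= /horner_eval !map_polyC !hornerC /= mcoeff0; split.
    rewrite {1}(gcoordK cc homX) raddf_sum (raddf_sum (mcoeff m)) /=; apply: eq_bigr => i _.
    by rewrite mmapZ mmapX mmap1U mcoeffZ mcoeff_map_mpoly /= mulrC.
  rewrite (raddf_sum (mcoeff _)) big1 // => i _ /=.
  by rewrite mcoeffZ mcoeffX mnm1_eq0 mulr0.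
- exists 'X; rewrite /p1 /p2 /= /horner_eval !map_polyX !hornerX expr1; split=> //.
  exact: oner_neq0.
apply/negP; rewrite negbK -(inj_eq val_inj) /= -/f; apply/eqP.
suff f0 : lsub k f = 0.
  by rewrite -[f]lsub1 -(mulVmx ku) -lsubM f0 raddf0.
apply/mpolyP => m; rewrite mcoeff0; apply/eqP; apply: contraT => fm.
have [_ /(_ (fz _ fm))] := gz m; rewrite raddf0 mcoeff0 => /esym/eqP.
rewrite mulf_eq0 (negPf fm) orbF => /prodf_eq0[l _].
by rewrite expf_eq0 (negPf (t0 l)) andbF.
Qed.

End Coordinates.

Arguments vcoord {C n' dg} i v.
Arguments vbas {C n' dg} i.

(** * Weights and tangent spaces of orbits *)

Lemma mnm_ind n (P : 'X_{1..n} -> Prop) :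
  P 0%MM -> (forall i m, P m -> P (U_(i) + m)%MM) -> forall m, P m.
Proof.
move=> P0 PU m; have [k] := ubnP (mdeg m); elim: k m => // k IH m lt_mk.
have [->//|m_neq0] := eqVneq m 0%MM; have [i mi] := mnm_neq0P m_neq0.
have le_im : (U_(i) <= m)%MM by rewrite lep1mP.
rewrite -(submK le_im) addmC; apply: PU; apply: IH.
rewrite -(submK le_im) mdegD mdeg1 addn1 in lt_mk.
exact: lt_mk.
Qed.

Section WeightFiltration.
Variables (F : fieldType) (n : nat) (z : 'cV[int]_n).
Implicit Types (p q : {mpoly F[n]}) (c : int).

Definition wle c p := forall m, m \in msupp p -> mwt z m <= c.

Lemma wleD c p q : wle c p -> wle c q -> wle c (p + q).
Proof. by move=> hp hq m /msuppD_le; rewrite mem_cat => /orP[/hp|/hq]. Qed.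

Lemma wleN c p : wle c p -> wle c (- p).
Proof. by move=> hp m; rewrite (perm_mem (msuppN p)) => /hp. Qed.

Lemma wleB c p q : wle c p -> wle c q -> wle c (p - q).
Proof. by move=> hp /wleN hq; apply: wleD. Qed.

Lemma wleZ c a p : wle c p -> wle c (a *: p).
Proof. by move=> hp m /msuppZ_le /hp. Qed.

Lemma wleM c d p q : wle c p -> wle d q -> wle (c + d) (p * q).
Proof.
move=> hp hq m /msuppM_le /allpairsP[[m1 m2] /= [/hp h1 /hq h2 ->]].
by rewrite mwtD lerD.
Qed.

Lemma wle_mono c d p : c <= d -> wle c p -> wle d p.
Proof. by move=> cd hp m /hp /le_trans; apply. Qed.

Lemma wle0 c : wle c 0.
Proof. by move=> m; rewrite msupp0. Qed.

Lemma wle_sum c I (r : seq I) (G : I -> {mpoly F[n]}) :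
  (forall i, wle c (G i)) -> wle c (\sum_(i <- r) G i).
Proof. by move=> hG; apply: big_ind => [|p q|i _]; [exact: wle0|exact: wleD|exact: hG]. Qed.

Lemma wleX m : wle (mwt z m) 'X_[m].
Proof. by move=> m'; rewrite msuppX inE => /eqP->. Qed.

Variables (Y : 'M[F]_n) (k : int).
Hypothesis Yk : forall i j, Y i j != 0 -> z i 0 = z j 0 - k.
Hypothesis k_ge0 : 0 <= k.

(** The infinitesimal action of Y, a derivation; the hypothesis on Y makes it lower weights by k. *)
Definition lie_act p := \sum_j lsub Y 'X_j * p^`M(j).

Lemma lie_actM p q : lie_act (p * q) = lie_act p * q + p * lie_act q.
Proof.
rewrite /lie_act mulr_suml mulr_sumr -big_split /=; apply: eq_bigr => j _.
by rewrite mderivM mulrDr mulrA (mulrCA _ p).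
Qed.

Lemma lie_actX i : lie_act 'X_i = lsub Y 'X_i.
Proof.
rewrite /lie_act (bigD1 i) //= big1 ?addr0 => [|j ji]; rewrite mderivX mnm1E.
  by rewrite eqxx scale1r mnm_subUU mpolyX0 mulr1.
by rewrite eq_sym (negPf ji) scale0r mulr0.
Qed.

Lemma lie_act1 : lie_act 1 = 0.
Proof. by rewrite /lie_act big1 // => j _; rewrite -mpolyC1 mderivC mulr0. Qed.

Lemma lie_actZ a p : lie_act (a *: p) = a *: lie_act p.
Proof.
by rewrite /lie_act scaler_sumr; apply: eq_bigr => j _; rewrite mderivZ scalerAr.
Qed.

Lemma lie_actD p q : lie_act (p + q) = lie_act p + lie_act q.
Proof. by rewrite -big_split /=; apply: eq_bigr => j _; rewrite mderivD mulrDr. Qed.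

Lemma lie_act_sum I (r : seq I) (G : I -> {mpoly F[n]}) :
  lie_act (\sum_(i <- r) G i) = \sum_(i <- r) lie_act (G i).
Proof.
apply: (big_morph lie_act); first exact: lie_actD.
by rewrite -(scale0r 0) lie_actZ !scale0r.
Qed.

Lemma wle_lsubX i : wle (z i 0 - k) (lsub Y 'X_i).
Proof.
rewrite lsubX; apply: wle_sum => j.
have [->|Yji] := eqVneq (Y j i) 0; first by rewrite scale0r; apply: wle0.
by apply: wleZ; rewrite -(Yk Yji) -(mwtU z j); apply: wleX.
Qed.

Lemma lsub_sub1X i : lsub (1%:M - Y) 'X_i = 'X_i - lsub Y 'X_i.
Proof.
rewrite -[X in _ = X - _]lsub1 !lsubX -sumrB; apply: eq_bigr => j _.
by rewrite !mxE scalerBl.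
Qed.

(** To first order 1 - Y acts as p - [lie_act p]. The remainder is of second order in Y, so it
    lowers weights by 2k; the Leibniz rule carries both bounds from m to m times a variable. *)
Lemma wle_lie_mono m : wle (mwt z m - k) (lie_act 'X_[m]) /\
  wle (mwt z m - k *+ 2) (lsub (1%:M - Y) 'X_[m] - 'X_[m] + lie_act 'X_[m]).
Proof.
elim/mnm_ind: m => [|i m [IH1 IH2]].
  by rewrite mpolyX0 lie_act1 rmorph1 subrr addr0; split; apply: wle0.
rewrite mwtD mwtU mpolyXD lie_actM lie_actX rmorphM /= lsub_sub1X.
set a := lsub _ 'X_[m] in IH2 *; set b := 'X_[m] in IH1 IH2 *.
set y := lsub Y 'X_i; set d := lie_act b in IH1 IH2 *; have yk : wle (z i 0 - k) y by apply: wle_lsubX.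
have Xi : wle (z i 0) ('X_i : {mpoly F[n]}) by rewrite -(mwtU z i); apply: wleX.
split.
  apply: wleD.
    by rewrite addrAC; apply: wleM; [exact: yk|exact: wleX].
  by rewrite -addrA; apply: wleM.
set r := a - b + d in IH2.
have -> : ('X_i - y) * a - 'X_i * b + (y * b + 'X_i * d) = 'X_i * r - y * r + y * d.
  by rewrite /r; ring.
apply: wleD; [apply: wleB|].
- by rewrite -addrA; apply: wleM.
- apply: (@wle_mono (z i 0 - k + (mwt z m - k *+ 2))); last exact: wleM.
  by lia.
- apply: (@wle_mono (z i 0 - k + (mwt z m - k))); last exact: wleM.
  by lia.
Qed.

Lemma wle_lie c p : wle c p -> wle (c - k) (lie_act p).
Proof.
move=> hp; rewrite [p]mpolyE lie_act_sum big_seq.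
apply: big_ind => [|q1 q2|m mp]; [exact: wle0|exact: wleD|].
rewrite lie_actZ; apply: wleZ; have [/wle_mono h _] := wle_lie_mono m.
by apply: h; rewrite lerD2r hp.
Qed.

Lemma wle_lsub_sub1 c p : wle c p ->
  wle (c - k *+ 2) (lsub (1%:M - Y) p - p + lie_act p).
Proof.
move=> hp; rewrite [in X in wle _ X](mpolyE p) lsub_sum lie_act_sum -sumrB -big_split /= big_seq.
apply: big_ind => [|q1 q2|m mp]; [exact: wle0|exact: wleD|].
rewrite lsubZ lie_actZ -scalerBr -scalerDr; apply: wleZ.
have [_ /wle_mono h] := wle_lie_mono m.
by apply: h; rewrite lerD2r hp.
Qed.

End WeightFiltration.

(** Powers of Y shift weights by multiples of k, beyond the finite range of weights in the end; so Y
    is nilpotent and the geometric series inverts 1 - Y. *)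
Lemma graded_unipotent_unit (F : fieldType) n' (z : 'cV[int]_n'.+1) (Y : 'M[F]_n'.+1) (k : nat) :
  (0 < k)%N -> (forall i j, Y i j != 0 -> z i 0 = z j 0 - k%:Z) -> 1%:M - Y \in unitmx.
Proof.
move=> k0 Yk.
have YX e i j : (Y ^+ e) i j != 0 -> z i 0 = z j 0 - (e * k)%N%:Z.
  elim: e i j => [|e IH] i j.
    rewrite expr0 mxE; have [->|] := eqVneq i j; first by rewrite mul0n subr0.
    by rewrite eqxx.
  rewrite exprS mxE => nz; apply/eqP; apply: contraNT nz => ne; apply/eqP.
  apply: big1 => l _; apply/eqP; rewrite mulf_eq0; apply: contraT.
  rewrite negb_or => /andP[/Yk E1 /IH E2]; case/eqP: ne.
  by rewrite E1 E2 mulSn; lia.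
pose e := (\sum_i `|z i 0%R|)%N.*2.+1.
have Ye : Y ^+ e = 0.
  apply/matrixP => i j; rewrite mxE; apply/eqP; apply: contraT => /YX E.
  have bnd l : (`|z l 0%R| <= \sum_i `|z i 0%R|)%N by rewrite (bigD1 l) //= leq_addr.
  have := bnd i; have := bnd j.
  have : (e <= e * k)%N by rewrite leq_pmulr.
  by rewrite /e; lia.
have := subrX1 Y e; rewrite Ye sub0r -[Y - 1]opprB mulNr => /oppr_inj/esym.
by move=> /mulmx1_unit[].
Qed.

(** Semicontinuity of the rank in determinantal form: with L and R fixed, the determinant of the
    product is a polynomial in the matrix, equal to 1 at M and to 0 at matrices of smaller rank
    ([rank_lt_det0]). *)
Lemma rank_witness (F : fieldType) p q (M : 'M[F]_(p, q)) :
  exists (L : 'M_(\rank M, p)) (R : 'M_(q, \rank M)), L *m M *m R = 1%:M.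
Proof.
exists (pid_mx (\rank M) *m invmx (col_ebase M)), (invmx (row_ebase M) *m pid_mx (\rank M)).
rewrite -[X in _ *m X *m (_ *m _)](mulmx_ebase M) !mulmxA mulmxKV ?col_ebase_unit // -!mulmxA.
rewrite mulmxA (mulmxA (row_ebase M)) mulmxV ?row_ebase_unit // mul1mx.
by rewrite !pid_mx_id ?rank_leq_row ?rank_leq_col ?leqnn // pid_mx_1.
Qed.

Lemma rank_lt_det0 (F : fieldType) p q r (M : 'M[F]_(p, q)) (L : 'M_(r, p)) (R : 'M_(q, r)) :
  (\rank M < r)%N -> \det (L *m M *m R) = 0.
Proof.
move=> ltr; apply/eqP; apply: contraTT ltr => d0; rewrite -leqNgt.
have /mxrank_unit {1}<- : L *m M *m R \in unitmx by rewrite unitmxE unitfE.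
exact: leq_trans (mxrankM_maxl _ _) (mxrankM_maxr _ _).
Qed.

Section Tangent.
Variables (n dg : nat).
Local Notation NN := #|{: 'I_n * 'I_n}|.
Local Notation Mon := 'X_{1..n < dg.+1}.

(* The matrix of the differential at 1 of the orbit map of h. *)
Definition tanmx (A : comNzRingType) (h : {mpoly A[n]}) : 'M[A]_(NN, #|{: Mon}|) :=
  \matrix_(r, s) ('X_((enum_val r).1) * h^`M((enum_val r).2))@_(val (enum_val s)).

Lemma map_tanmx (A A' : comNzRingType) (s : {rmorphism A -> A'}) (h : {mpoly A[n]}) :
  map_mx s (tanmx h) = tanmx (map_mpoly s h).
Proof.
apply/matrixP => r c; rewrite !mxE -mcoeff_map_mpoly rmorphM /= map_mpolyX mderiv_map.
by [].
Qed.

Lemma dhomog_mulX_deriv (A : comNzRingType) (h : {mpoly A[n]}) i j :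
  h \is dg.-homog -> 'X_i * h^`M(j) \is dg.-homog.
Proof.
move=> /dhomogP hh; apply/dhomogP => m /msuppM_le /allpairsP[[m1 m2] /= [+ + ->]].
rewrite msuppX inE => /eqP->; rewrite mcoeff_msupp mcoeff_deriv => hm.
have hm' : h@_(m2 + U_(j)) != 0 by apply: contraNneq hm => ->; rewrite mul0rn.
rewrite -mcoeff_msupp in hm'; transitivity (mdeg (m2 + U_(j))%MM); last exact: hh.
by rewrite !mdegD !mdeg1 addnC.
Qed.

(** The tangent space of the orbit at B h is the image under B of the one at h, up to conjugation of
    the Lie algebra. *)
Lemma mderiv_lsub_conj (A : comNzRingType) (B B' : 'M[A]_n) (h : {mpoly A[n]}) i j :
  B *m B' = 1%:M ->
  'X_i * (lsub B h)^`M(j) = lsub B (\sum_k \sum_l (B' k i * B j l) *: ('X_k * h^`M(l))).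
Proof.
move=> BB'; have Xi : 'X_i = lsub B (\sum_k B' k i *: 'X_k).
  by rewrite -lsubX lsubM BB' lsub1.
rewrite {1}Xi mderiv_lsub lsub_sum mulr_suml lsub_sum; apply: eq_bigr => k _.
rewrite lsubZ -scalerAl mulr_sumr lsub_sum scaler_sumr; apply: eq_bigr => l _.
by rewrite -scalerAr scalerA lsubZ rmorphM.
Qed.

Lemma rank_tanmx_lsub (F : fieldType) (B : 'M[F]_n) (h : {mpoly F[n]}) :
  h \is dg.-homog -> B \in unitmx -> (\rank (tanmx (lsub B h)) <= \rank (tanmx h))%N.
Proof.
move=> hh Bu; pose B' := invmx B.
pose P : 'M[F]_NN := \matrix_(r, r')
  (B' (enum_val r').1 (enum_val r).1 * B (enum_val r).2 (enum_val r').2).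
pose Q : 'M[F]_(#|{: Mon}|) := \matrix_(s, s') (lsub B 'X_[val (enum_val s)])@_(val (enum_val s')).
suff -> : tanmx (lsub B h) = P *m tanmx h *m Q.
  exact: leq_trans (mxrankM_maxl _ _) (mxrankM_maxr _ _).
have lsubQ (q : {mpoly F[n]}) m : q \is dg.-homog ->
    (lsub B q)@_m = \sum_s q@_(val (enum_val s)) * (lsub B 'X_[val (enum_val (A := {: Mon}) s)])@_m.
  move=> hq; have le_sz : (msize q <= dg.+1)%N.
    rewrite msizeE; apply/bigmax_leqP_seq => m' mv _; rewrite ltnS.
    by have /dhomogP-> := hq.
  rewrite {1}(mpolywE le_sz) lsub_sum (raddf_sum (mcoeff m)) /=.
  rewrite [RHS](reindex (@enum_rank {: Mon})) /=; last by apply: onW_bij; apply: enum_rank_bij.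
  by apply: eq_bigr => m' _; rewrite enum_rankK lsubZ mcoeffZ.
apply/matrixP => r s; rewrite [LHS]mxE (mderiv_lsub_conj _ _ _ (mulmxV Bu)) lsubQ; last first.
  apply: rpred_sum => k _; apply: rpred_sum => l _; apply: rpredZ.
  exact: dhomog_mulX_deriv.
rewrite [RHS]mxE; apply: eq_bigr => s' _; rewrite [Q _ _]mxE; congr (_ * _).
rewrite mxE pair_big (raddf_sum (mcoeff _)) /=.
rewrite [RHS](reindex (@enum_rank {: 'I_n * 'I_n})) /=; last by apply: onW_bij; apply: enum_rank_bij.
by apply: eq_bigr => -[k l] _; rewrite !mxE enum_rankK /= mcoeffZ.
Qed.

End Tangent.

(** * Removing the terms of negative weight *)

Section Slice.
Variables (C : numClosedFieldType) (n' dg : nat).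
Local Notation n := n'.+1.
Local Notation NN := #|{: 'I_n * 'I_n}|.
Local Notation Mon := 'X_{1..n < dg.+1}.
Variables (z : 'cV[int]_n) (f : {mpoly C[n]}).
Hypothesis fhom : f \is dg.-homog.
Hypothesis f0 : forall m, f@_m != 0 -> mwt z m = 0.

Lemma mwt_mulX_deriv (h : {mpoly C[n]}) i j m : ('X_i * h^`M(j))@_m != 0 ->
  exists m', h@_m' != 0 /\ mwt z m' = mwt z m - z i 0 + z j 0.
Proof.
rewrite -mcoeff_msupp => /msuppM_le /allpairsP[[m1 m2] /= [+ + ->]].
rewrite msuppX inE => /eqP->; rewrite mcoeff_msupp mcoeff_deriv => hm.
exists (m2 + U_(j))%MM; split; first by apply: contraNneq hm => ->; rewrite mul0rn.
by rewrite !mwtD !mwtU; ring.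
Qed.

(* Letting s tend to 0 in the action of s^-z on h shows that the leading term
   of h - f is tangent to the orbit of f. *)
Lemma leading_term_tangent (h : {mpoly C[n]}) (k : nat) : (0 < k)%N ->
  wle z (- k%:Z) (h - f) ->
  (\rank (tanmx dg h) <= \rank (tanmx dg f))%N ->
  exists Y : 'M[C]_n, forall m, (mdeg m <= dg)%N ->
    (\sum_i \sum_j Y i j *: ('X_i * f^`M(j)))@_m = h@_m *+ (mwt z m == - k%:Z).
Proof.
move=> k0 hf rk.
have hE : h = f + (h - f) by rewrite addrC subrK.
have hfm m : (h - f)@_m != 0 -> mwt z m <= - k%:Z by move=> hm; apply: hf; rewrite mcoeff_msupp.
pose src (r : 'I_NN) (s : 'I_#|{: Mon}|) : int :=
  mwt z (val (enum_val s)) - z (enum_val r).1 0 + z (enum_val r).2 0.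
pose wt (s : 'I_#|{: Mon}|) : int := mwt z (val (enum_val s)).
(* With the variable as s, M1 is the tangent matrix of s^-z h, and the row M2 is the weight
   derivation applied to s^-z h, divided by s^k. The truncation in the exponent of M2 affects only
   weight 0, where the coefficient is 0. *)
pose M1 : 'M[{poly C}]_(NN, #|{: Mon}|) :=
  \matrix_(r, s) (tanmx dg h r s *: 'X^(`|src r s|)).
pose M2 : 'M[{poly C}]_(1, #|{: Mon}|) :=
  \matrix_(r, s) (((wt s)%:~R * h@_(val (enum_val s))) *: 'X^(`|wt s| - k)).
pose M := col_mx M1 M2.
pose nk : 'rV[C]_#|{: Mon}| := \row_s ((wt s)%:~R * (h@_(val (enum_val s)) *+ (wt s == - k%:Z))).
have hwt m : h@_m != 0 -> mwt z m = 0 \/ mwt z m <= - k%:Z.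
  rewrite hE mcoeffD; have [fm|/f0] := eqVneq f@_m 0; last by left.
  by rewrite fm add0r => /hfm; right.
have ev0 : map_mx (horner_eval 0) M = col_mx (tanmx dg f) nk.
  rewrite map_col_mx; congr col_mx; apply/matrixP => r s; rewrite !mxE /horner_eval hornerZ hornerXn.
    set e := src r s; set i := (enum_val r).1; set j := (enum_val r).2; set m := val (enum_val s).
    rewrite expr0n absz_eq0.
    have hsplit : ('X_i * h^`M(j))@_m = ('X_i * f^`M(j))@_m + ('X_i * (h - f)^`M(j))@_m.
      by rewrite -mcoeffD -mulrDr -mderivD -hE.
    have [e0|e_neq0] := eqVneq e 0.
      rewrite mulr1 hsplit (_ : ('X_i * (h - f)^`M(j))@_m = 0) ?addr0 //.
      apply/eqP; apply: contraT => /mwt_mulX_deriv[m' [/hfm + E]].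
      by rewrite E -/i -/j -[_ - _ + _]/e e0; lia.
    rewrite mulr0; apply/esym/eqP; apply: contraNT e_neq0 => /mwt_mulX_deriv[m' [/f0 E0 E]].
    by rewrite -[e]E E0.
  rewrite expr0n; set w := wt s; have [->|hm] := eqVneq h@_(val (enum_val s)) 0.
    by rewrite mulr0 mul0r mul0rn mulr0.
  have := hwt _ hm; rewrite -/(wt s) -/w => -[->|lew]; first by rewrite !mul0r.
  have -> : (`|w| - k == 0)%N = (w == - k%:Z) by lia.
  by case: eqP => _; rewrite ?mulr1 ?mulr0 ?mulr1n ?mulr0n ?mulr0.
(* Away from s = 0 all rows come from the tangent matrix of h, the last one as the combination of
   the rows x_i d/dx_i with coefficients z_i. *)
have evs (s : C) : s != 0 -> exists (P : 'M_(NN + 1, NN)) Q,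
    map_mx (horner_eval s) M = P *m tanmx dg h *m Q.
  move=> s0; pose E : 'M[C]_NN := diag_mx (\row_r s ^ (z (enum_val r).1 0 - z (enum_val r).2 0)).
  pose H : 'M[C]_(1, NN) := \row_r (s ^ (- k%:Z) * (z (enum_val r).1 0)%:~R *+ ((enum_val r).1 == (enum_val r).2)).
  exists (col_mx E H), (diag_mx (\row_c s ^ (- wt c))).
  rewrite map_col_mx mul_col_mx mul_col_mx; congr col_mx; apply/matrixP => r c.
    rewrite mul_diag_mx mul_mx_diag !mxE /horner_eval hornerZ hornerXn.
    set i := (enum_val r).1; set j := (enum_val r).2; set m := val (enum_val c).
    have [->|nz] := eqVneq ('X_i * h^`M(j))@_m 0; first by rewrite mul0r mulr0 mul0r.
    have srcle : src r c <= 0.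
      have [m' [/hwt hm' E']] := mwt_mulX_deriv nz.
      by rewrite /src -/i -/j -/m -E'; case: hm' => [->//|]; lia.
    rewrite mulrAC -expfzDr // mulrC; congr (_ * _); rewrite exprnP; congr (_ ^ _).
    by move: srcle; rewrite /src /wt -/i -/j -/m; lia.
  rewrite mul_mx_diag !mxE /horner_eval hornerZ hornerXn.
  set m := val (enum_val c).
  have -> : \sum_j H r j * tanmx dg h j c = s ^ (- k%:Z) * ((wt c)%:~R * h@_m).
    rewrite (reindex (@enum_rank {: 'I_n * 'I_n})) /=; last by apply: onW_bij; apply: enum_rank_bij.
    rewrite (eq_bigr (fun u : 'I_n * 'I_n => (fun i j =>
       (s ^ (- k%:Z) * (z i 0)%:~R *+ (i == j)) * ('X_i * h^`M(j))@_m) u.1 u.2)); last first.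
      by move=> u _; rewrite !mxE enum_rankK.
    rewrite -(pair_bigA _ (fun i j =>
       (s ^ (- k%:Z) * (z i 0)%:~R *+ (i == j)) * ('X_i * h^`M(j))@_m)) /=.
    rewrite /wt mwtE rmorph_sum mulr_suml mulr_sumr; apply: eq_bigr => i _.
    rewrite (bigD1 i) //= big1 ?addr0 => [|j ji]; last by rewrite eq_sym (negPf ji) mulr0n mul0r.
    rewrite eqxx mulr1n mcoeff_mulX_deriv rmorphM /= -[h@_m *+ _]mulr_natl.
    by rewrite -!mulrA; congr (_ * _); rewrite mulrCA !mulrA.
  have [->|hm] := eqVneq h@_m 0; first by rewrite !mulr0 !mul0r.
  have := hwt _ hm; rewrite -/(wt c) => -[->|lew]; first by rewrite !(mul0r, mulr0).
  rewrite [RHS]mulrAC -expfzDr // mulrC; congr (_ * _); rewrite exprnP; congr (_ ^ _).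
  by move: lew; lia.
(* The rank at s = 0 is at most the rank at s != 0, hence at most that for h and for f; so [nk] lies
   in the tangent space at f. *)
have rkle : (\rank (col_mx (tanmx dg f) nk) <= \rank (tanmx dg f))%N.
  apply: leq_trans rk; have [L [R LR]] := rank_witness (col_mx (tanmx dg f) nk).
  set rr := \rank _ in L R LR *; rewrite leqNgt; apply/negP => ltr.
  pose p := \det (map_mx polyC L *m M *m map_mx polyC R).
  have pE s : p.[s] = \det (L *m map_mx (horner_eval s) M *m R).
    rewrite -[LHS]/(horner_eval s p) -det_map_mx !map_mxM -!map_mx_comp.
    by congr (\det (_ *m _ *m _)); apply/matrixP => x y; rewrite !mxE /= /horner_eval hornerC.
  have : p = 0.
    apply: poly_vanish => s s0; rewrite pE; have [P [Q ->]] := evs s s0.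
    have -> : L *m (P *m tanmx dg h *m Q) *m R = (L *m P) *m tanmx dg h *m (Q *m R).
      by rewrite !mulmxA.
    exact: rank_lt_det0.
  move=> p0; have := pE 0; rewrite ev0 LR det1 p0 horner0 => /esym/eqP.
  by rewrite oner_eq0.
have : (nk <= tanmx dg f)%MS.
  have sub : (tanmx dg f <= col_mx (tanmx dg f) nk)%MS by rewrite -addsmxE addsmxSl.
  have [_ /esym] := mxrank_leqif_sup sub; rewrite eqn_leq rkle mxrankS //= => sub'.
  by apply: submx_trans sub'; rewrite -addsmxE addsmxSr.
move=> /submxP[y yE].
(* The row [nk] carries the factor -k, whence the division by -k; the condition keeps the part of y
   that produces weight -k from f. *)
exists (\matrix_(i, j) (if z i 0 - z j 0 == - k%:Z then - y 0 (enum_rank (i, j)) / k%:R else 0)).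
move=> m lem; pose s : 'I_#|{: Mon}| := enum_rank (BMultinom (lem : (mdeg m < dg.+1)%N)).
have sE : val (enum_val s) = m by rewrite enum_rankK.
have kC : k%:R != 0 :> C by rewrite pnatr_eq0 -lt0n.
have /matrixP/(_ 0 s) := yE; rewrite [LHS]mxE sE /wt sE [RHS]mxE.
rewrite (reindex (@enum_rank {: 'I_n * 'I_n})) /=; last by apply: onW_bij; apply: enum_rank_bij.
rewrite (eq_bigr (fun u : 'I_n * 'I_n => (fun i j =>
   y 0 (enum_rank (i, j)) * ('X_i * f^`M(j))@_m) u.1 u.2)); last first.
  by move=> [i j] _; rewrite [tanmx _ _ _ _]mxE sE enum_rankK.
rewrite -(pair_bigA _ (fun i j => y 0 (enum_rank (i, j)) * ('X_i * f^`M(j))@_m)) /= => yE'.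
rewrite (raddf_sum (mcoeff m)) /=; under eq_bigr do rewrite (raddf_sum (mcoeff m)) /=.
have fwt i j : ('X_i * f^`M(j))@_m != 0 -> z i 0 - z j 0 = mwt z m.
  by move=> /mwt_mulX_deriv[m' [/f0 -> E]]; lia.
have [wk|wk] := eqVneq (mwt z m) (- k%:Z); last first.
  rewrite mulr0n big1 // => i _; rewrite big1 // => j _; rewrite mcoeffZ mxE.
  have [->|/fwt E] := eqVneq ('X_i * f^`M(j))@_m 0; first by rewrite mulr0.
  by rewrite E (negPf wk) mul0r.
rewrite wk eqxx mulr1n in yE' *.
have {yE'} -> : h@_m = \sum_i \sum_j (- y 0 (enum_rank (i, j)) / k%:R) * ('X_i * f^`M(j))@_m.
  transitivity (- k%:R^-1 * \sum_i \sum_j y 0 (enum_rank (i, j)) * ('X_i * f^`M(j))@_m).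
    by rewrite -yE' rmorphN /= mulrA mulrNN mulVf ?mul1r.
  rewrite mulr_sumr; apply: eq_bigr => i _; rewrite mulr_sumr; apply: eq_bigr => j _.
  by rewrite mulrA; congr (_ * _); rewrite mulNr mulrC mulNr.
apply: eq_bigr => i _; apply: eq_bigr => j _; rewrite mcoeffZ mxE.
have [->|/fwt ->] := eqVneq ('X_i * f^`M(j))@_m 0; first by rewrite !mulr0.
by rewrite wk eqxx.
Qed.

(** The term of weight -k in h - f is [lie_act Y f] for some Y lowering weights by k, and 1 - Y
    subtracts it; all other new terms have weight at most -2k. *)
Lemma slice_step (h : {mpoly C[n]}) (k : nat) : h \is dg.-homog -> (0 < k)%N ->
  wle z (- k%:Z) (h - f) -> (\rank (tanmx dg h) <= \rank (tanmx dg f))%N ->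
  exists2 B : 'M[C]_n, B \in unitmx & wle z (- k.+1%:Z) (lsub B h - f).
Proof.
move=> hhom k0 hf rk; have [Y0 Y0E] := leading_term_tangent k0 hf rk.
pose Y : 'M[C]_n := \matrix_(i, j) (Y0 i j *+ (z i 0 - z j 0 == - k%:Z)).
have Yk i j : Y i j != 0 -> z i 0 = z j 0 - k%:Z.
  rewrite mxE; have [E _|_] := eqVneq (z i 0 - z j 0) (- k%:Z); first by lia.
  by rewrite mulr0n eqxx.
have fwt i j m : ('X_i * f^`M(j))@_m != 0 -> z i 0 - z j 0 = mwt z m.
  by move=> /mwt_mulX_deriv[m' [/f0 -> E]]; lia.
exists (1%:M - Y); first exact: (graded_unipotent_unit k0 Yk).
have kz : 0 <= k%:Z by [].
have lieE : lie_act Y f = \sum_i \sum_j Y i j *: ('X_i * f^`M(j)).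
  rewrite /lie_act exchange_big /=; apply: eq_bigr => j _.
  by rewrite lsubX mulr_suml; apply: eq_bigr => i _; rewrite scalerAl.
have liem m : (lie_act Y f)@_m = (h - f)@_m *+ (mwt z m == - k%:Z).
  have [lem|gtm] := leqP (mdeg m) dg; last first.
    have zero (q : {mpoly C[n]}) : q \is dg.-homog -> q@_m = 0.
      by move=> hq; apply: (dhomog_nemf_coeff hq); rewrite gtn_eqF.
    rewrite !zero ?mul0rn ?rpredB // lieE.
    by apply: rpred_sum => i _; apply: rpred_sum => j _; apply: rpredZ; apply: dhomog_mulX_deriv.
  have [wk|wk] := eqVneq (mwt z m) (- k%:Z); last first.
    rewrite mulr0n lieE (raddf_sum (mcoeff m)) big1 //= => i _.
    rewrite (raddf_sum (mcoeff m)) big1 //= => j _; rewrite mcoeffZ mxE.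
    have [->|/fwt ->] := eqVneq ('X_i * f^`M(j))@_m 0; first by rewrite mulr0.
    by rewrite (negPf wk) mulr0n mul0r.
  have fm : f@_m = 0.
    by apply/eqP; apply: contraT => /f0; rewrite wk; lia.
  have := Y0E m lem; rewrite wk eqxx !mulr1n mcoeffB fm subr0 => <-.
  rewrite lieE !(raddf_sum (mcoeff m)); apply: eq_bigr => i _ /=.
  rewrite !(raddf_sum (mcoeff m)); apply: eq_bigr => j _ /=; rewrite !mcoeffZ mxE.
  have [->|/fwt ->] := eqVneq ('X_i * f^`M(j))@_m 0; first by rewrite !mulr0.
  by rewrite wk eqxx.
set q := h - f in hf liem.
have f_wle : wle z 0 f by move=> m; rewrite mcoeff_msupp => /f0 ->.
have Wf := wle_lsub_sub1 Yk kz f_wle; have Wq := wle_lsub_sub1 Yk kz hf.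
have Dq := wle_lie Yk kz hf.
have -> : lsub (1%:M - Y) h - f = (lsub (1%:M - Y) f - f + lie_act Y f) +
    ((lsub (1%:M - Y) q - q + lie_act Y q) - lie_act Y q) + (q - lie_act Y f).
  have -> : h = f + q by rewrite /q addrC subrK.
  by rewrite lsubD; ring.
apply: wleD; [apply: wleD; [|apply: wleB]|].
- by apply: wle_mono Wf; lia.
- by apply: wle_mono Wq; lia.
- by apply: wle_mono Dq; lia.
- move=> m; rewrite mcoeff_msupp mcoeffB liem => qm.
  have qm0 : q@_m != 0 by apply: contraNneq qm => ->; rewrite mul0rn subrr.
  have := hf m; rewrite mcoeff_msupp => /(_ qm0) le1.
  have ne : mwt z m != - k%:Z by apply: contraNneq qm => ->; rewrite eqxx mulr1n subrr.
  by lia.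
Qed.

(** Forms of degree dg have weights bounded below by -b, so after finitely many uses of [slice_step]
    the difference is 0; the rank bound survives each step. *)
Lemma slice_orbit (h : {mpoly C[n]}) : h \is dg.-homog -> wle z (-1) (h - f) ->
  (\rank (tanmx dg h) <= \rank (tanmx dg f))%N ->
  exists2 B : 'M[C]_n, B \in unitmx & lsub B h = f.
Proof.
move=> hhom; pose b := (dg * \sum_i `|z i 0%R|)%N.
have bnd m : mdeg m = dg -> - b%:Z <= mwt z m.
  move=> md; have le1 : (`|mwt z m| <= b)%N.
    rewrite /b -md mdegE mwtE; apply: leq_trans (_ : \sum_i (m i * `|z i 0%R|) <= _)%N.
      elim/big_rec2: _ => [//|i y x _ IH]; set a := (m i)%:Z * z i 0.
      have -> : (m i * `|z i 0%R|)%N = `|a|%N by rewrite abszM.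
      by lia.
    rewrite big_distrl /=; apply: leq_sum => i _.
    by rewrite leq_mul2l (bigD1 i) //= leq_addr orbT.
  by lia.
suff main e (h' : {mpoly C[n]}) k : (0 < k)%N -> (b < k + e)%N -> h' \is dg.-homog ->
    wle z (- k%:Z) (h' - f) -> (\rank (tanmx dg h') <= \rank (tanmx dg f))%N ->
    exists2 B : 'M[C]_n, B \in unitmx & lsub B h' = f.
  by move=> hf rk; apply: (main b.+1 h 1%N).
elim: e h' k => [|e IH] h' k k0 bk hom' hf rk.
  exists 1%:M; rewrite ?unitmx1 // lsub1; apply/eqP; rewrite -subr_eq0; apply/eqP/mpolyP => m.
  rewrite mcoeff0; apply/eqP; apply: contraT; rewrite -mcoeff_msupp => mh.
  have md : mdeg m = dg by have /dhomogP-> : h' - f \is dg.-homog by rewrite rpredB.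
  have := hf _ mh; have := bnd _ md; rewrite addn0 in bk; lia.
have [B Bu hB] := slice_step hom' k0 hf rk.
have bk' : (b < k.+1 + e)%N by rewrite addSnnS.
have rk' : (\rank (tanmx dg (lsub B h')) <= \rank (tanmx dg f))%N.
  by apply: leq_trans rk; apply: rank_tanmx_lsub.
have [B' B'u E] := IH _ k.+1 isT bk' (dhomog_lsub B hom') hB rk'.
by exists (B' *m B); rewrite ?unitmx_mul ?B'u // -lsubM.
Qed.

End Slice.

(** * Closed orbits *)

Lemma intr_le_oppr1 (x : int) : x <= 0 -> x != 0 -> x <= -1.
Proof. by lia. Qed.

Section ClosedOrbit.
Variables (C : numClosedFieldType) (n' dg : nat).
Hypothesis dg_gt0 : (0 < dg)%N.
Local Notation n := n'.+1.
Local Notation V := (dhomog n C dg).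
Local Notation N := (\dim {:V}).
Local Notation NN := #|{: 'I_n * 'I_n}|.
Implicit Type v w g : V.

Definition gl_act (B : 'M[C]_n) v : V := DHomog (dhomog_lsub B (dhomog_is_dhomog v)).

(** Scalar matrices act by dg-th powers, so over an algebraically closed field with dg > 0 this
    orbit is a cone, the cone over the SL-orbit. *)
Definition gl_orbit v w := exists2 B : 'M[C]_n, B \in unitmx & w = gl_act B v.

Lemma val_gl_act B v : val (gl_act B v) = lsub B (val v).
Proof. by []. Qed.

Lemma gl_actM A B v : gl_act A (gl_act B v) = gl_act (A *m B) v.
Proof. by apply: val_inj; rewrite !val_gl_act lsubM. Qed.

Lemma gl_act1 v : gl_act 1%:M v = v.
Proof. by apply: val_inj; rewrite val_gl_act lsub1. Qed.

Lemma gl_act_scalar a v : gl_act a%:M v = a ^+ dg *: v.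
Proof.
apply: val_inj; rewrite val_gl_act val_dhomogZ; apply: lsub_scalar.
exact: dhomog_is_dhomog.
Qed.

Lemma gl_orbit_sym v w : gl_orbit v w -> gl_orbit w v.
Proof.
move=> [B Bu ->]; exists (invmx B); first by rewrite unitmx_inv.
by rewrite gl_actM mulVmx // gl_act1.
Qed.

Lemma gl_orbit_trans u v w : gl_orbit u v -> gl_orbit v w -> gl_orbit u w.
Proof.
move=> [B Bu ->] [A Au ->]; exists (A *m B); first by rewrite unitmx_mul Au.
by rewrite gl_actM.
Qed.

Lemma scalar_unitmx (a : C) : a != 0 -> a%:M \in @unitmx C n.
Proof. by move=> a0; rewrite unitmxE det_scalar unitfE expf_neq0. Qed.

Lemma gl_orbit_scale v w a : a != 0 -> gl_orbit v w -> gl_orbit v (a *: w).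
Proof.
move=> a0 vw; apply: gl_orbit_trans vw _; exists ((dg.-root a)%:M).
  by rewrite scalar_unitmx // rootC_eq0.
by rewrite gl_act_scalar rootCK.
Qed.

Lemma gl_sl_decomposition (B : 'M[C]_n) : B \in unitmx ->
  exists (a : C) (A : 'M[C]_n), [/\ a != 0, a ^+ n = \det B, \det A = 1 & B = a%:M *m A].
Proof.
rewrite unitmxE unitfE => B0; pose a := n.-root (\det B).
have a0 : a != 0 by rewrite rootC_eq0.
have an : a ^+ n = \det B by rewrite rootCK.
exists a, (a^-1 *: B); split=> //; first by rewrite detZ exprVn an mulVf.
by rewrite mul_scalar_mx scalerA divff // scale1r.
Qed.

Lemma polyfun_homog d (Q : {mpoly C[N]}) a v : Q \is d.-homog ->
  polyfun Q (a *: v) = a ^+ d * polyfun Q v.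
Proof.
move=> Qh; rewrite /polyfun -(meval_homog _ _ Qh); apply: meval_eq => i.
by rewrite linearZ.
Qed.

(** For B = a A with det A = 1, Q is multiplied by a^(dg d); passing to n-th powers replaces a by
    det B, which is polynomial in B. *)
Lemma polyfun_gl_act d (Q : {mpoly C[N]}) B v : Q \is d.-homog -> sl_inv Q -> B \in unitmx ->
  polyfun Q (gl_act B v) ^+ n = \det B ^+ (dg * d) * polyfun Q v ^+ n.
Proof.
move=> Qh Qi /gl_sl_decomposition[a [A [a0 an detA ->]]].
rewrite -gl_actM gl_act_scalar (polyfun_homog _ _ Qh) (Qi A v (gl_act A v)) //.
rewrite det_mulmx det_scalar detA mulr1 exprMn -!exprM.
by congr (_ ^+ _ * _); rewrite mulnA mulnC.
Qed.

Definition in_orbit_closure v g := forall d (P : {mpoly C[N]}), P \is d.-homog ->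
  (forall w, gl_orbit v w -> polyfun P w = 0) -> polyfun P g = 0.

(** The orbit is a cone, so each homogeneous component of P vanishes on it. *)
Lemma in_orbit_closure_poly v g (P : {mpoly C[N]}) : in_orbit_closure v g ->
  (forall w, gl_orbit v w -> polyfun P w = 0) -> polyfun P g = 0.
Proof.
move=> clo P0; rewrite /polyfun {1}(pihomog_partitionE (leqnn (msize P))) raddf_sum /=.
apply: big1 => d _; apply: (clo _ _ (pihomogP mdeg d P)) => w vw.
apply: homog_component_vanish => a a0.
rewrite -[RHS](P0 _ (gl_orbit_scale a0 vw)) /polyfun; apply: meval_eq => i.
by rewrite linearZ.
Qed.

Lemma rank_orbit_closure v g : in_orbit_closure v g ->
  (\rank (tanmx dg (val g)) <= \rank (tanmx dg (val v)))%N.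
Proof.
move=> clo; rewrite leqNgt; apply/negP => ltr.
have [L [R LR]] := rank_witness (tanmx dg (val g)); set r := \rank _ in L R LR ltr.
pose P : {mpoly C[N]} := \det (map_mx (@mpolyC N C) L *m tanmx dg (gen_vec C n' dg) *m
  map_mx (@mpolyC N C) R).
have PE w : polyfun P w = \det (L *m tanmx dg (val w) *m R).
  rewrite -[LHS]/(meval (vcoord^~ w) P) /P -det_map_mx !map_mxM /= map_tanmx gen_vec_eval.
  congr (\det (_ *m _ *m _)); apply/matrixP => i j; rewrite !mxE; exact: mevalC.
have /eqP : polyfun P g = 0.
  apply: (in_orbit_closure_poly clo) => w [B Bu ->]; rewrite PE; apply: rank_lt_det0.
  apply: leq_ltn_trans ltr; apply: rank_tanmx_lsub => //.
  exact: dhomog_is_dhomog.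
by rewrite PE LR det1 oner_eq0.
Qed.

(** The invariant Q keeps det X a unit along the place. The limit g is then, in suitable
    coordinates, a point of the orbit of v plus terms of negative weight, and [slice_orbit] removes
    these. *)
Theorem critical_closed v g d (Q : {mpoly C[N]}) : critical (val v) ->
  (0 < d)%N -> Q \is d.-homog -> sl_inv Q -> polyfun Q g != 0 ->
  in_orbit_closure v g -> gl_orbit v g.
Proof.
move=> vcrit d0 Qh Qi Qg clo; set f := val v in vcrit.
have fhom : f \is dg.-homog by apply: dhomog_is_dhomog.
have Qv : polyfun Q v != 0.
  apply: contraNneq Qg => Qv; apply/eqP; apply: (clo _ _ Qh) => w [B Bu ->].
  apply/eqP; have := polyfun_gl_act v Qh Qi Bu; rewrite Qv expr0n mulr0 => /eqP.
  by rewrite expf_eq0.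
pose cc : {rmorphism C -> {mpoly C[NN]}} := @mpolyC NN C.
pose p1 : {rmorphism {mpoly C[N]} -> {mpoly C[NN]}} := mmap cc (fun i => gcoord cc i (gen_act f)).
pose p2 : {rmorphism {mpoly C[N]} -> C} := meval (vcoord^~ g).
have p1E P B : (p1 P).@[mxeval B] = polyfun P (gl_act B v).
  rewrite -peval_id val_gl_act -mxeval_gen_act.
  by apply: (peval_map (c := cc) (s := meval (mxeval B))) => x; apply: mevalC.
have homX : gen_act f \is dg.-homog by apply: dhomog_lsub; apply: dhomog_map.
have ghom : val g \is dg.-homog by apply: dhomog_is_dhomog.
have [||||B [k [z [t [Bu ku t0 fz gz]]]]] :=
  @limit_analysis C n dg f (val g) {mpoly C[N]} p1 p2 (dg * d).-1 fhom ghom vcrit.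
- move=> P p1P; apply: (in_orbit_closure_poly clo) => w [B Bu ->].
  by rewrite -p1E p1P meval0.
- by move=> x; exists x%:MP; rewrite /p1 /p2 /= mmapC mevalC.
- move=> m; exists (\sum_i (vbas i)@_m *: 'X_i); split.
    rewrite {1}(gcoordK cc homX) /p1 raddf_sum (raddf_sum (mcoeff m)) /=; apply: eq_bigr => i _.
    by rewrite mmapZ mmapX mmap1U mcoeffZ mcoeff_map_mpoly /= mulrC.
  rewrite (vcoordK g) /p2 raddf_sum (raddf_sum (mcoeff m)) /=; apply: eq_bigr => i _.
  by rewrite mevalZ mevalXU mcoeffZ mulrC.
(* By [polyfun_gl_act] this normalized power of Q takes the value det X^(dg d) at X f, and it does
   not vanish at g. *)
- exists ((polyfun Q v ^+ n)^-1 *: Q ^+ n); split; last first.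
    by rewrite /p2 /= mevalZ rmorphXn /= mulf_neq0 ?invr_eq0 ?expf_neq0.
  rewrite prednK ?muln_gt0 ?dg_gt0 //; apply/eqP; rewrite -subr_eq0; apply/eqP.
  apply: mpoly_vanish_unitmx => B Bu; rewrite mevalB rmorphXn /= mxeval_det p1E.
  rewrite [polyfun _ _](_ : _ = (polyfun Q v ^+ n)^-1 * polyfun Q (gl_act B v) ^+ n).
    by rewrite (polyfun_gl_act v Qh Qi Bu) mulrCA mulVf ?mulr1 ?subrr // expf_neq0.
  by rewrite /polyfun mevalZ rmorphXn.
pose Dt := diag_mx t; pose f2 := lsub Dt (lsub k f).
have Du : Dt \in unitmx.
  by rewrite unitmxE det_diag unitfE; apply/prodf_neq0 => i _.
have f2E m : f2@_m = (\prod_l t 0 l ^+ m l) * (lsub k f)@_m by rewrite lsub_diag_mx.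
have f2wt m : f2@_m != 0 -> mwt z m = 0.
  by rewrite f2E mulf_eq0 negb_or => /andP[_ /fz].
have f2hom : f2 \is dg.-homog by rewrite !dhomog_lsub.
have hhom : lsub B (val g) \is dg.-homog by rewrite dhomog_lsub.
have rk : (\rank (tanmx dg (lsub B (val g))) <= \rank (tanmx dg f2))%N.
  apply: leq_trans (rank_tanmx_lsub ghom Bu) _; apply: leq_trans (rank_orbit_closure clo) _.
  have fE : val v = lsub (invmx (Dt *m k)) f2.
    by rewrite /f2 (lsubM Dt) lsubM mulVmx ?lsub1 // unitmx_mul Du.
  by rewrite fE; apply: rank_tanmx_lsub; rewrite ?unitmx_inv ?unitmx_mul ?Du.
have hf : wle z (-1) (lsub B (val g) - f2).
  move=> m; rewrite mcoeff_msupp mcoeffB; have [le0 eq0] := gz m.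
  have [w0|wn0] := eqVneq (mwt z m) 0; first by rewrite (eq0 w0) f2E subrr eqxx.
  have -> : f2@_m = 0 by apply/eqP; apply: contraNT wn0 => /f2wt ->.
  by rewrite subr0 => /le0 wle0; apply: intr_le_oppr1.
have [A Au AE] := slice_orbit f2hom f2wt hhom hf rk.
have e1 : gl_orbit v (gl_act (Dt *m k) v) by exists (Dt *m k); rewrite // unitmx_mul Du.
apply: gl_orbit_trans e1 _; apply: gl_orbit_sym; exists (A *m B); first by rewrite unitmx_mul Au.
by apply: val_inj; rewrite !val_gl_act -!lsubM AE.
Qed.

End ClosedOrbit.

(** * Sparse critical forms and degenerations *)

Section CriticalForms.
Variables (C : numClosedFieldType) (n r : nat) (c : 'I_r -> C) (e : 'I_r -> 'X_{1..n}).

Lemma mfact_sub (m : 'X_{1..n}) i : m i != 0%N -> mfact m = (m i * mfact (m - U_(i)))%N.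
Proof.
move=> mi; have le_im : (U_(i) <= m)%MM by rewrite lep1mP.
rewrite -{1}(submK le_im) mfactU mnmBE mnm1E eqxx subn1 prednK ?lt0n //.
Qed.

Lemma apo_mono m m' : apo ('X_[m] : {mpoly C[n]}) 'X_[m'] = (mfact m)%:R *+ (m == m').
Proof.
by rewrite apoX mcoeffX eq_sym; case: eqP => _; rewrite ?mulr1n ?mulr0n ?mul0rn.
Qed.

(* If no two monomials of f differ by a single variable, the moment matrix of f
   is diagonal, and its diagonal is the weighted barycentre of the exponents. *)
Lemma critical_sparse s :
  (forall k l, k != l -> (2 <= \sum_x (e k x - e l x))%N) ->
  (forall i, \sum_k `|c k| ^+ 2 *+ (e k i * mfact (e k)) = s) ->
  critical (\sum_k c k *: 'X_[e k]).
Proof.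
move=> sparse bary; exists s => i j; rewrite /moment.
have dE h : (\sum_k c k *: 'X_[e k])^`M(h) = \sum_k (c k * (e k h)%:R) *: 'X_[e k - U_(h)].
  rewrite (raddf_sum (mderiv h)); apply: eq_bigr => k _ /=.
  by rewrite mderivZ mderivX scalerA.
rewrite !dE (raddf_sum (map_mpoly _)) /= apo_suml.
have off k l : (k != l) || (i != j) -> (e k i != 0)%N -> (e l j != 0)%N ->
    (e k - U_(i))%MM != (e l - U_(j))%MM.
  move=> klij ki lj; apply/eqP => E.
  have E' : (e k + U_(j) = e l + U_(i))%MM.
    have lk : (U_(i) <= e k)%MM by rewrite lep1mP.
    have ll : (U_(j) <= e l)%MM by rewrite lep1mP.
    by rewrite -(submK lk) -(submK ll) E -!addmA [(U_(i) + _)%MM]addmC.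
  have [kl|kl] := eqVneq k l.
    rewrite kl eqxx /= in klij; move: E'; rewrite kl => /addmI /eqP.
    by rewrite eq_mnm1 eq_sym (negPf klij).
  have := sparse _ _ kl; rewrite ltnNge => /negP; apply.
  apply: leq_trans (_ : \sum_x (i == x) <= _)%N; last first.
    by rewrite (bigD1 i) //= eqxx big1 // => x; rewrite eq_sym => /negPf ->.
  apply: leq_sum => x _; have /mnmP/(_ x) := E'; rewrite !mnmDE !mnm1E.
  by rewrite leq_subLR => <-; rewrite leq_addr.
have term k l : c k * (e k i)%:R * ((c l * (e l j)%:R)^* * ((mfact (e k - U_(i))%MM)%:R *+
    ((e k - U_(i))%MM == (e l - U_(j))%MM))) =
    (`|c k| ^+ 2 *+ (e k i * mfact (e k))) *+ ((k == l) && (i == j)).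
  have [/andP[/eqP kl /eqP ij]|ne] := boolP ((k == l) && (i == j)).
    rewrite -kl -ij eqxx !mulr1n rmorphM rmorph_nat normCK.
    have [ki0|ki] := eqVneq (e k i) 0%N; first by rewrite ki0 mul0n mulr0 mul0r mulr0n.
    rewrite (mfact_sub ki) -[RHS]mulr_natr !natrM; ring.
  rewrite negb_and in ne; rewrite mulr0n.
  have [->|ki] := eqVneq (e k i) 0%N; first by rewrite mulr0 mul0r.
  have [->|lj] := eqVneq (e l j) 0%N; first by rewrite mulr0 rmorph0 mul0r mulr0.
  by rewrite (negPf (off k l ne ki lj)) mulr0n !mulr0.
transitivity (\sum_k \sum_l (`|c k| ^+ 2 *+ (e k i * mfact (e k))) *+ ((k == l) && (i == j))).
  apply: eq_bigr => k _; rewrite apoZl apo_sumr mulr_sumr; apply: eq_bigr => l _.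
  by rewrite map_mpolyZ map_mpolyX apoZr apo_mono; exact: term.
have [->|ij] := eqVneq i j; last first.
  by rewrite mulr0n big1 // => k _; rewrite big1 // => l _; rewrite andbF.
rewrite mulr1n -(bary j); apply: eq_bigr => k _.
rewrite (bigD1 k) //= eqxx mulr1n big1 ?addr0 // => l lk.
by rewrite eq_sym (negPf lk) mulr0n.
Qed.

End CriticalForms.

Section Degeneration.
Variables (C : numClosedFieldType) (n' dg : nat).
Local Notation V := (dhomog n'.+1 C dg).
Local Notation N := (\dim {:V}).
Implicit Type v w : V.

Lemma gl_actD B v w : gl_act B (v + w) = gl_act B v + gl_act B w.
Proof. by apply: val_inj; rewrite val_gl_act [LHS]lsubD. Qed.

Lemma gl_actZ B a v : gl_act B (a *: v) = a *: gl_act B v.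
Proof. by apply: val_inj; rewrite val_gl_act [LHS]lsubZ. Qed.

(** For each B, the value of P at B (v0 + s^2 v1) is polynomial in s and vanishes for s != 0, hence
    also at s = 0. *)
Lemma polyfun_degeneration v v0 v1 (P : {mpoly C[N]}) :
  (forall s, s != 0 -> gl_orbit v (v0 + s ^+ 2 *: v1)) ->
  (forall w, gl_orbit v w -> polyfun P w = 0) ->
  forall w, gl_orbit v0 w -> polyfun P w = 0.
Proof.
move=> lim P0 _ [B Bu ->].
pose x i : {poly C} := (vcoord i (gl_act B v0))%:P + vcoord i (gl_act B v1) *: 'X^2.
have xE s : (mmap (@polyC C) x P).[s] = polyfun P (gl_act B (v0 + s ^+ 2 *: v1)).
  apply: (mpoly_morph_eq (f := horner_eval s \o mmap (@polyC C) x)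
     (g := meval (vcoord^~ (gl_act B (v0 + s ^+ 2 *: v1))))) => [a|i] /=.
    by rewrite mmapC mevalC /horner_eval hornerC.
  rewrite mmapX mmap1U mevalXU /horner_eval hornerD hornerZ hornerC hornerXn.
  by rewrite gl_actD gl_actZ /vcoord linearD linearZ /= mulrC.
have : mmap (@polyC C) x P = 0.
  apply: poly_vanish => s s0; rewrite xE; apply: P0.
  by apply: gl_orbit_trans (lim s s0) _; exists B.
move=> mP0; have := xE 0; rewrite mP0 horner0 expr0n scale0r addr0.
by move=> <-.
Qed.

End Degeneration.

(** * Cubic fourfolds: semistability and closedness criteria *)

Section Cubics.
Variable R : realType.
Local Notation C := R[i].
Implicit Type f g : cubic R.

Lemma sl_actE (A : 'M[C]_6) f : sl_act A f = gl_act A f.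
Proof. exact: val_inj. Qed.

Lemma gl_act_neq0 (B : 'M[C]_6) f : B \in unitmx -> f != 0 -> gl_act B f != 0.
Proof.
move=> Bu; apply: contra => /eqP f0; rewrite -(gl_act1 f) -(mulVmx Bu) -gl_actM f0.
by have := gl_actZ (invmx B) 0 (0 : cubic R); rewrite !scale0r => ->.
Qed.

Lemma proj_orbitE f g : f != 0 -> proj_orbit f g <-> gl_orbit f g.
Proof.
move=> f0; split.
  move=> [_ [a [A [a0 detA ->]]]]; rewrite sl_actE; apply: gl_orbit_scale => //.
  by exists A => //; rewrite unitmxE detA unitr1.
move=> [B Bu ->]; split; first exact: gl_act_neq0.
have [a [A [a0 _ detA ->]]] := gl_sl_decomposition Bu.
exists (a ^+ 3), A; split=> //; first by rewrite expf_neq0.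
by rewrite sl_actE -gl_actM gl_act_scalar.
Qed.

Lemma semistableE f : semistable f <-> f != 0 /\
  exists d (P : {mpoly C[\dim {:cubic R}]}),
    [/\ (0 < d)%N, P \is d.-homog, sl_inv P & polyfun P f != 0].
Proof.
split=> -[f0 [d [P [d0 Ph Pi Pf]]]]; split=> //; exists d, P; split=> //.
  move=> B v w detB wE; have -> : w = sl_act B v by rewrite sl_actE; apply: val_inj.
  exact: Pi.
by move=> A detA g; apply: (Pi A) => //; rewrite sl_actE.
Qed.

Lemma semistable_orbit f g : gl_orbit f g -> semistable f -> semistable g.
Proof.
move=> [B Bu ->] /semistableE[f0 [d [P [d0 Ph Pi Pf]]]]; apply/semistableE.
split; first exact: gl_act_neq0.
exists d, P; split=> //; have := polyfun_gl_act f Ph Pi Bu.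
move=> E; have : polyfun P (gl_act B f) ^+ 6 != 0.
  have detB : \det B != 0 by move: Bu; rewrite unitmxE unitfE.
  by rewrite E mulf_neq0 // expf_neq0.
by rewrite expf_eq0.
Qed.

Lemma semistable_critical f : critical (val f) -> f != 0 -> semistable f.
Proof. by move=> fcrit f0; apply/semistableE; split=> //; apply: critical_semistable. Qed.

Lemma closed_orbit_critical f : critical (val f) -> f != 0 -> closed_orbit f.
Proof.
move=> fcrit f0; have fss := semistable_critical fcrit f0.
(* The forms vanishing on the orbit cut out its closure; a semistable point of it brings the
   invariant that [critical_closed] asks for. *)
pose F : set {mpoly C[\dim {:cubic R}]} :=
  [set P | (exists d, P \is d.-homog) /\ forall w, proj_orbit f w -> polyfun P w = 0].
exists (proj_zeros F); split; first by exists F; split=> // P [].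
apply/seteqP; split=> [g fg|g [gss [g0 gF]]].
  split; first by apply: semistable_orbit fss; apply/proj_orbitE.
  split; first by case: fg.
  by move=> P [_]; apply.
have [_ [d [Q [d0 Qh Qi Qg]]]] := proj1 (semistableE g) gss.
apply/proj_orbitE => //; apply: (critical_closed _ fcrit d0 Qh Qi Qg) => // e P Ph P0.
apply: gF; split; first by exists e.
by move=> w /proj_orbitE fw; apply: P0; apply: fw.
Qed.

Lemma closed_orbit_orbit f g : f != 0 -> gl_orbit f g -> closed_orbit f -> closed_orbit g.
Proof.
move=> f0 fg; have g0 : g != 0 by case: fg => B Bu ->; apply: gl_act_neq0.
suff E : proj_orbit f = proj_orbit g by rewrite /closed_orbit E.
apply/seteqP; split=> w /proj_orbitE fw; apply/proj_orbitE => //.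
  by apply: gl_orbit_trans (gl_orbit_sym fg) (fw f0).
by apply: gl_orbit_trans fg (fw g0).
Qed.

End Cubics.

(** * The cubics zeta and tau *)

Definition mon6 (s : seq nat) : 'X_{1..6} := [multinom nth 0%N s i | i < 6].

Lemma mon6E (A : comNzRingType) i j k s :
  (forall x : 'I_6, ((inord i == x) + (inord j == x) + (inord k == x))%N = nth 0%N s x) ->
  'X_(inord i) * 'X_(inord j) * 'X_(inord k) = 'X_[mon6 s] :> {mpoly A[6]}.
Proof.
move=> E; rewrite -!mpolyXD; congr 'X_[_]; apply/mnmP => x.
by rewrite !mnmDE !mnm1E mnmE E.
Qed.

Lemma mfact_mon6 s : mfact (mon6 s) = (\prod_(x < 6) (nth 0 s x)`!)%N.
Proof. by apply: eq_bigr => x _; rewrite mnmE. Qed.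

Lemma lsub_diagX (A : comNzRingType) n (t : 'rV[A]_n) m :
  lsub (diag_mx t) 'X_[m] = (\prod_l t 0 l ^+ m l) *: 'X_[m].
Proof.
apply/mpolyP => m'; rewrite lsub_diag_mx mcoeffZ mcoeffX.
by have [->|] := eqVneq m m'; rewrite ?mulr0.
Qed.

Definition zeta_exp (k : 'I_2) : 'X_{1..6} :=
  mon6 (nth [::] [:: [:: 1; 0; 0; 0; 1; 1]; [:: 0; 1; 1; 1; 0; 0]] k)%N.

Definition tau_exp (k : 'I_5) : 'X_{1..6} :=
  mon6 (nth [::] [:: [:: 1; 0; 0; 2; 0; 0]; [:: 1; 0; 0; 0; 1; 1]; [:: 0; 2; 0; 0; 1; 0];
                     [:: 0; 1; 1; 1; 0; 0]; [:: 0; 0; 2; 0; 0; 1]] k)%N.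

Lemma zeta_exp_sparse k l : k != l -> (2 <= \sum_x (zeta_exp k x - zeta_exp l x))%N.
Proof.
by move: k l; do 2!(case=> [[|[|//]] ?]); rewrite // !big_ord_recl big_ord0 !mnmE.
Qed.

Lemma tau_exp_sparse k l : k != l -> (2 <= \sum_x (tau_exp k x - tau_exp l x))%N.
Proof.
by move: k l; do 2!(case=> [[|[|[|[|[|//]]]]] ?]); rewrite // !big_ord_recl big_ord0 !mnmE.
Qed.

Section ZetaTau.
Variable R : realType.
Local Notation C := R[i].

Lemma zeta_formE : zeta_form R = \sum_k 1 *: 'X_[zeta_exp k].
Proof.
rewrite !big_ord_recl big_ord0 !scale1r addr0 /zeta_form.
congr (_ + _); apply: mon6E; case=> -[|[|[|[|[|[|//]]]]]] ?;
  by rewrite -!val_eqE /= !inordK.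
Qed.

Definition tau_coef (a : C) (k : 'I_5) : C := nth 0 [:: 1; -1; 1; - (a + 1); a] k.

Lemma tau_formE (a : C) : tau_form a = \sum_k tau_coef a k *: 'X_[tau_exp k].
Proof.
rewrite !big_ord_recl big_ord0 addr0 /tau_coef /= scale1r scale1r scaleN1r scaleNr.
rewrite /tau_form mulrBr !expr2 !mulrA !addrA.
congr (_ - _ + _ - _ *: _ + _ *: _); apply: mon6E; case=> -[|[|[|[|[|[|//]]]]]] ?;
  by rewrite -!val_eqE /= !inordK.
Qed.

Lemma mcoeff_zeta : (val (zeta R))@_(zeta_exp 0) = 1.
Proof.
rewrite [val _]zeta_formE !big_ord_recl big_ord0 addr0 mcoeffD !mcoeffZ !mcoeffX eqxx.
rewrite (_ : (_ == _) = false) ?mulr0 ?addr0 ?mulr1 //.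
by apply/eqP => /mnmP/(_ 0); rewrite !mnmE.
Qed.

Lemma zeta_neq0 : zeta R != 0.
Proof.
apply/eqP => z0; have := mcoeff_zeta; rewrite z0 mcoeff0 => /esym/eqP.
by rewrite oner_eq0.
Qed.

Lemma mcoeff_tau (a : C) : (val (tau a))@_(tau_exp 0) = 1.
Proof.
rewrite [val _]tau_formE (raddf_sum (mcoeff _)) (bigD1 ord0) //= mcoeffZ mcoeffX eqxx mulr1.
rewrite big1 ?addr0 // => k k0; rewrite mcoeffZ mcoeffX (_ : (_ == _) = false) ?mulr0 //.
apply/eqP => E; have := tau_exp_sparse k0; rewrite E.
by rewrite big1 // => x _; rewrite subnn.
Qed.

Lemma tau_neq0 (a : C) : tau a != 0.
Proof.
apply/eqP => z0; have := mcoeff_tau a; rewrite z0 mcoeff0 => /esym/eqP.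
by rewrite oner_eq0.
Qed.

(** Each variable divides exactly one of the two monomials, with exponent 1, so the weighted
    barycentre is (1, ..., 1). *)
Lemma critical_zeta : critical (val (zeta R)).
Proof.
rewrite [val _]zeta_formE; apply: (critical_sparse (s := 1)); first exact: zeta_exp_sparse.
move=> i; rewrite !big_ord_recl big_ord0 addr0 normr1 expr1n !mfact_mon6.
rewrite !big_ord_recl !big_ord0 /= !mnmE.
by case: i => -[|[|[|[|[|[|//]]]]]] ? /=; rewrite ?mulr1n ?mulr0n ?addr0 ?add0r.
Qed.

(* Scaling the coordinates balances the squared norms of the five terms of tau
   to p, 1 - p, p, 1 - 2p, p; since the exponents satisfy one relation, p has
   to solve the cubic equation below. *)
Lemma tau_balance (A B : R) : 0 < A -> 0 <= B ->
  exists p, [/\ 0 < p, p <= 2^-1 & p ^+ 3 * B ^+ 2 = 8 * A * (1 - p) * (1 - 2 * p) ^+ 2].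
Proof.
move=> A0 B0.
pose q : {poly R} := (B ^+ 2) *: 'X^3 - (8 * A) *: ((1 - 'X) * (1 - 2 *: 'X) ^+ 2).
have qE x : q.[x] = x ^+ 3 * B ^+ 2 - 8 * A * (1 - x) * (1 - 2 * x) ^+ 2.
  rewrite /q !hornerE /=; ring.
(* The polynomial q takes the values -8A < 0 at 0 and B^2/8 >= 0 at 1/2. *)
have [||x /andP[x0 x1] /eqP qx] := @poly_ivt R q 0 2^-1.
- by rewrite invr_ge0 ler0n.
- rewrite !qE; apply/andP; split; first by rewrite expr0n /=; lra.
  by rewrite [2 * _]divff ?pnatr_eq0 // subrr expr0n /= mulr0 subr0 mulr_ge0 ?exprn_ge0 // invr_ge0 ler0n.
exists x; split=> //; last by apply/eqP; rewrite -subr_eq0 -qE; apply/eqP.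
rewrite lt_neqAle x0 andbT; apply/eqP => E; move: qx; rewrite qE -E expr0n /=; lra.
Qed.

Lemma tau_critical_orbit (a : C) : a != 0 -> exists2 f : cubic R, critical (val f) & gl_orbit f (tau a).
Proof.
move=> a0; pose A := complex.Re (`|a| ^+ 2); pose B := complex.Re (`|a + 1| ^+ 2).
have AE : real_complex R A = `|a| ^+ 2 by rewrite RRe_real // ger0_real // exprn_ge0.
have BE : real_complex R B = `|a + 1| ^+ 2 by rewrite RRe_real // ger0_real // exprn_ge0.
have A0 : 0 < A by rewrite -ltcR AE exprn_gt0 // normr_gt0.
have B0 : 0 <= B by rewrite -lecR BE exprn_ge0.
have [p0 [p0_gt0 p0_le p0E]] := tau_balance A0 B0.
pose p : C := real_complex R p0.
have p_gt0 : 0 < p by rewrite ltcR.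
have p_le : 2 * p <= 1.
  by rewrite -(rmorph_nat (real_complex R)) -rmorphM -(rmorph1 (real_complex R)) lecR; lra.
have pE : p ^+ 3 * (`|a + 1| ^+ 2) ^+ 2 = 8 * `|a| ^+ 2 * (1 - p) * (1 - 2 * p) ^+ 2.
  transitivity (real_complex R (p0 ^+ 3 * B ^+ 2)).
    by rewrite -BE rmorphM !rmorphXn.
  rewrite p0E -AE -(rmorph_nat (real_complex R) 8) -(rmorph_nat (real_complex R) 2).
  rewrite -(rmorph1 (real_complex R)) /p -(rmorphM _ 2%:R) -!rmorphB -rmorphXn -!rmorphM.
  by [].
have np : 0 < `|a| ^+ 2 by rewrite exprn_gt0 // normr_gt0.
have p1 : 0 < 1 - p by rewrite subr_gt0 (lt_le_trans _ p_le) // mulrDl mul1r ltrDl.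
(* Here x_1 and x_3 are scaled by t1, x_2 by t2, x_5 by t5. The squared norms of four terms give 2
   t1^4 = p (twice), t5^2 = 1 - p and 2 |a|^2 t2^4 t5^2 = p; the remaining term x_1 x_2 x_3 is then
   right by the cubic equation for p. *)
pose t1 := 4.-root (p / 2); pose t5 := 2.-root (1 - p).
pose t2 := 4.-root (p / (2 * `|a| ^+ 2 * (1 - p))).
have E1 : t1 ^+ 4 = p / 2 by rewrite rootCK.
have E5 : t5 ^+ 2 = 1 - p by rewrite rootCK.
have E2 : t2 ^+ 4 = p / (2 * `|a| ^+ 2 * (1 - p)) by rewrite rootCK.
have t1_gt0 : 0 < t1 by rewrite rootC_gt0 // divr_gt0.
have t5_gt0 : 0 < t5 by rewrite rootC_gt0.
have t2_gt0 : 0 < t2 by rewrite rootC_gt0 // divr_gt0 // mulr_gt0 // mulr_gt0.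
have [nt1 nt2 nt5] : [/\ `|t1| = t1, `|t2| = t2 & `|t5| = t5] by rewrite !gtr0_norm.
pose t : 'rV[C]_6 := \row_i nth 1 [:: 1; t1; t2; t1; 1; t5] i.
have t_neq0 i : t 0 i != 0.
  by rewrite mxE; case: i => -[|[|[|[|[|[|//]]]]]] ? /=; rewrite ?oner_neq0 ?gt_eqF.
have tu : diag_mx t \in unitmx by rewrite unitmxE det_diag unitfE; apply/prodf_neq0.
exists (gl_act (diag_mx t) (tau a)); last by apply: gl_orbit_sym; exists (diag_mx t).
rewrite val_gl_act [val _]tau_formE lsub_sum.
pose b k := tau_coef a k * \prod_l t 0 l ^+ tau_exp k l.
rewrite (eq_bigr (fun k => b k *: 'X_[tau_exp k])); last first.
  by move=> k _; rewrite lsubZ lsub_diagX scalerA.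
have pn0 : 1 - p != 0 by rewrite gt_eqF.
have an0 : `|a| != 0 by rewrite normr_eq0.
have bE k : `|b k| ^+ 2 *+ mfact (tau_exp k) = nth 0 [:: p; 1 - p; p; 1 - 2 * p; p] k.
  rewrite /b /tau_coef; case: k => -[|[|[|[|[|//]]]]] h;
    rewrite mfact_mon6 !big_ord_recl !big_ord0 !mxE !mnmE /= ?expr0 ?expr1 ?expr1n ?mulr1 ?mul1r.
  - by rewrite normrX nt1 -exprM E1 -mulr_natr divfK ?pnatr_eq0.
  - by rewrite mulN1r normrN nt5 E5.
  - by rewrite normrX nt1 -exprM E1 -mulr_natr divfK ?pnatr_eq0.
  (* The term contains t2^2, but only t2^4 is given explicitly; so squares of nonnegative numbers
     are compared. *)
  - apply/eqP; rewrite mulr1n -(@eqrXn2 _ 2) ?exprn_ge0 ?subr_ge0 //; apply/eqP.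
    rewrite mulNr normrN !normrM nt1 nt2.
    transitivity ((`|a + 1| ^+ 2) ^+ 2 * (t1 ^+ 4) ^+ 2 * t2 ^+ 4); first by ring.
    rewrite E1 E2; apply: (mulIf (x := 8 * `|a| ^+ 2 * (1 - p))).
      by rewrite !mulf_neq0 ?pnatr_eq0 ?expf_neq0.
    rewrite [RHS]mulrC -pE; field.
    by rewrite an0 pn0.
  - rewrite -[X in _ *+ X = _]/2%N !normrM nt2 nt5 -mulr_natr.
    transitivity (`|a| ^+ 2 * t2 ^+ 4 * t5 ^+ 2 * 2); first by ring.
    rewrite E2 E5; field.
    by rewrite an0 pn0.
apply: (critical_sparse (s := 1)); first exact: tau_exp_sparse.
move=> i; under eq_bigr do rewrite mulnC mulrnA bE.
rewrite !big_ord_recl big_ord0 !mnmE /=.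
by case: i => -[|[|[|[|[|[|//]]]]]] ? /=; rewrite ?mulr0n ?mulr1n ?mulr2n; ring.
Qed.

Lemma zeta_orbit_opp : gl_orbit (- zeta R) (zeta R).
Proof.
have E : gl_orbit (zeta R) (- zeta R).
  rewrite -scaleN1r; apply: gl_orbit_scale => //; first by rewrite oppr_eq0 oner_eq0.
  by exists 1%:M; rewrite ?unitmx1 ?gl_act1.
exact: gl_orbit_sym.
Qed.

Lemma tau0_degeneration : exists v1 : cubic R, forall s : C, s != 0 ->
  gl_orbit (tau (0 : C)) (- zeta R + s ^+ 2 *: v1).
Proof.
pose v1 : cubic R := tau (0 : C) + zeta R; exists v1 => s s0.
(* These weights fix x_0 x_4 x_5 and x_1 x_2 x_3 and multiply x_0 x_3^2 and x_1^2 x_4 by s^2. The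
   monomial x_2^2 x_5, scaled by s^-4, has coefficient a = 0. *)
pose t : 'rV[C]_6 := \row_i nth 1 [:: 1; s; s ^- 2; s; 1; 1] i.
have t_neq0 i : t 0 i != 0.
  rewrite mxE; case: i => -[|[|[|[|[|[|//]]]]]] ? /=; rewrite ?oner_neq0 ?s0 //.
  by rewrite invr_eq0 expf_neq0.
exists (diag_mx t); first by rewrite unitmxE det_diag unitfE; apply/prodf_neq0.
apply: val_inj; rewrite val_gl_act.
have -> : val (- zeta R + s ^+ 2 *: v1) = - zeta_form R + s ^+ 2 *: (tau_form 0 + zeta_form R) by [].
have prodE k : \prod_l t 0 l ^+ tau_exp k l = nth 0 [:: s ^+ 2; 1; s ^+ 2; 1; (s ^- 2) ^+ 2] k.
  case: k => -[|[|[|[|[|//]]]]] h; rewrite !big_ord_recl big_ord0 !mxE !mnmE /=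
    ?expr0 ?expr1 ?expr1n ?mulr1 ?mul1r //.
  by rewrite mulrCA mulrC -expr2 mulfV ?expf_neq0.
have -> : zeta_form R = 'X_[tau_exp (Ordinal (isT : 1 < 5)%N)] + 'X_[tau_exp (Ordinal (isT : 3 < 5)%N)].
  by rewrite zeta_formE !big_ord_recl big_ord0 !scale1r addr0.
rewrite [val _]tau_formE lsub_sum.
under [in RHS]eq_bigr do rewrite lsubZ lsub_diagX scalerA prodE.
rewrite tau_formE !big_ord_recl !big_ord0 /tau_coef /=.
set X1 := 'X_[tau_exp (Ordinal _)]; set X3 := 'X_[tau_exp (Ordinal _)].
rewrite -!mul_mpolyC !(mulN1r, mul0r, mul1r, mulr1, mpolyC0, mpolyC1, mpolyCN, addr0, add0r).
by ring.
Qed.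

Lemma polyfun_zeta_limit (P : {mpoly C[\dim {:cubic R}]}) :
  (forall w, gl_orbit (tau (0 : C)) w -> polyfun P w = 0) ->
  forall w, gl_orbit (zeta R) w -> polyfun P w = 0.
Proof.
move=> P0 w zw; have [v1 lim] := tau0_degeneration.
apply: (polyfun_degeneration lim P0).
exact: gl_orbit_trans zeta_orbit_opp zw.
Qed.

Lemma semistable_zeta : semistable (zeta R).
Proof. exact: semistable_critical critical_zeta zeta_neq0. Qed.

(** For a != 0 the orbit contains a critical form. For a = 0, an invariant that vanished at [tau 0]
    would vanish on its orbit, hence at the limit zeta, which is semistable. *)
Lemma semistable_tau (a : C) : semistable (tau a).
Proof.
have [->|a0] := eqVneq a 0; last first.
  have [f fcrit ft] := tau_critical_orbit a0; apply: (semistable_orbit ft).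
  apply: semistable_critical => //; case: (gl_orbit_sym ft) => B Bu ->.
  exact: gl_act_neq0 (tau_neq0 a).
have [_ [d [P [d0 Ph Pi Pz]]]] := proj1 (semistableE (zeta R)) semistable_zeta.
apply/semistableE; split; first exact: tau_neq0.
exists d, P; split=> //; apply: contraNneq Pz => Pt; apply/eqP.
apply: polyfun_zeta_limit => [w [B Bu ->]|].
  have := polyfun_gl_act (tau (0 : C)) Ph Pi Bu; rewrite Pt expr0n mulr0 => /eqP.
  by rewrite expf_eq0 => /eqP.
by exists 1%:M; rewrite ?unitmx1 ?gl_act1.
Qed.

End ZetaTau.

Theorem lemma4p3 (R : realType) :
  (semistable (zeta R) /\ closed_orbit (zeta R)) /\
  ((forall a : R[i], semistable (tau a)) /\ semistable (omega R)) /\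
  (forall a : R[i], a != 0 -> closed_orbit (tau a)) /\
  proj_orbit (zeta R) `<=` zariski_closure (proj_orbit (tau (0 : R[i]))).
Proof.
split; first by split; [exact: semistable_zeta | exact: closed_orbit_critical (critical_zeta R) (zeta_neq0 R)].
split; first by split=> [a|]; exact: semistable_tau.
split=> [a a0|g zg Z [F [Fh ->]] sub].
  have [f fcrit ft] := tau_critical_orbit a0.
  have f0 : f != 0.
    by case: (gl_orbit_sym ft) => B Bu ->; exact: gl_act_neq0 (tau_neq0 a).
  exact: closed_orbit_orbit f0 ft (closed_orbit_critical fcrit f0).
split; first by case: zg.
move=> P FP; apply: polyfun_zeta_limit; last by apply/proj_orbitE => //; exact: zeta_neq0.
move=> w tw; have [] : proj_zeros F w.
  by apply: sub; apply/proj_orbitE => //; exact: tau_neq0.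
by move=> _; apply.
Qed.
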